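(* Let $\Sigma = \llbracket 1, N \rrbracket$ with $N \in \mathbb{N}$ or $N = \infty$, and let $\Lambda \subset \mathbb{R}$ be an interval (with nonempty interior). Suppose that $\mathcal{L}^1$ and $\mathcal{L}^2$ are $\Sigma$-indexed line ensembles on $\Lambda$ that satisfy the partial Brownian Gibbs property, with laws $\mathbb{P}_1$ and $\mathbb{P}_2$ respectively. Suppose further that for every $k \in \mathbb{N}$, $t_1 < t_2 < \cdots < t_k$ with $t_i \in \Lambda$ and $x_1, \dots, x_k \in \mathbb{R}$ we have $$\mathbb{P}_1\left( \mathcal{L}^1_1(t_1) \leq x_1, \dots, \mathcal{L}^1_1(t_k) \leq x_k \right) = \mathbb{P}_2\left( \mathcal{L}^2_1(t_1) \leq x_1, \dots, \mathcal{L}^2_1(t_k) \leq x_k \right).$$ Then $\mathbb{P}_1 = \mathbb{P}_2$ (as probability measures on $C(\Sigma\times\Lambda)$).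
   Context: **Line ensembles.** $\llbracket p,q \rrbracket = \{p,p+1,\dots,q\}$ and $\llbracket 1, \infty\rrbracket=\mathbb{N}$. For $\Sigma \subset \mathbb{Z}$ (discrete topology) and an interval $\Lambda \subset \mathbb{R}$, $C(\Sigma\times\Lambda)$ is the space of continuous functions $\Sigma\times\Lambda\to\mathbb{R}$ with the topology of uniform convergence over compact sets and its Borel $\sigma$-algebra $\mathcal{C}_\Sigma$. A $\Sigma$-indexed line ensemble on $\Lambda$ is a random variable $\mathcal{L}$ with values in $(C(\Sigma\times\Lambda),\mathcal{C}_\Sigma)$; $\mathcal{L}_i = \mathcal{L}(i,\cdot)$ is its $i$-th curve. It is non-intersecting if almost surely $\mathcal{L}_i(r) > \mathcal{L}_j(r)$ for all $i<j$ and $r \in \Lambda$. **Brownian bridges and avoiding ensembles.** A Brownian bridge from $B(a)=x$ to $B(b)=y$ with diffusion parameter $1$ is $B(t) = (b-a)^{1/2}\tilde{B}\left(\frac{t-a}{b-a}\right) + \frac{b-t}{b-a}x + \frac{t-a}{b-a}y$, $t\in[a,b]$, where $\tilde B(t)=W_t - tW_1$ on $[0,1]$ with $W$ a standard Brownian motion. For $\vec{x},\vec{y}\in\mathbb{R}^k$, $\mathbb{P}^{a,b,\vec{x},\vec{y}}_{free}$ is the law of $k$ independent such bridges $B_1,\dots,B_k$ on $[a,b]$ from $B_i(a)=x_i$ to $B_i(b)=y_i$. Let $W^\circ_k = \{\vec{x}\in\mathbb{R}^k : x_1>x_2>\cdots>x_k\}$. For $a<b$, $\vec{x},\vec{y}\in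 W^\circ_k$, and continuous $f:[a,b]\to(-\infty,\infty]$, $g:[a,b]\to[-\infty,\infty)$ (each is either real-valued and continuous, or identically $\infty$, resp. $-\infty$) with $f>g$ on $[a,b]$, $f(a)>x_1$, $f(b)>y_1$, $g(a)<x_k$, $g(b)<y_k$, the law $\mathbb{P}_{avoid}^{a,b,\vec{x},\vec{y},f,g}$ (a law on $C(\llbracket 1,k\rrbracket\times[a,b])$) is $\mathbb{P}^{a,b,\vec{x},\vec{y}}_{free}$ conditioned on the (positive probability) event $\{f(r)>B_1(r)>\cdots>B_k(r)>g(r)\text{ for all } r\in[a,b]\}$; $\mathbb{E}_{avoid}^{a,b,\vec{x},\vec{y},f,g}$ denotes its expectation. **Partial Brownian Gibbs property.** Let $\Sigma=\llbracket 1,N\rrbracket$, $N\in\mathbb{N}$ or $N=\infty$. A $\Sigma$-indexed line ensemble $\mathcal{L}$ on $\Lambda$ satisfies the partial Brownian Gibbs property if it is non-intersecting and for any finite $K=\{k_1,k_1+1,\dots,k_2\}\subset\Sigma$ with $k_2\leq N-1$ (no restriction if $\Sigma=\mathbb{N}$), any $[a,b]\subset\Lambda$ with $a<b$, and any bounded Borel-measurable $F:C(K\times[a,b])\to\mathbb{R}$, almost surely $$\mathbb{E}\left[F(\mathcal{L}|_{K\times[a,b]}) \,\big|\, \mathcal{F}_{ext}(K\times(a,b))\right] = \mathbb{E}_{avoid}^{a,b,\vec{x},\vec{y},f,g}\bigl[F(\tilde{\mathcal{Q}})\bigr],$$ where $\mathcal{F}_{ext}(K\times(a,b)) = \sigma\{\mathcal{L}_i(s)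 : (i,s)\in(\Sigma\times\Lambda)\setminus(K\times(a,b))\}$, $\vec{x}=(\mathcal{L}_{k_1}(a),\dots,\mathcal{L}_{k_2}(a))$, $\vec{y}=(\mathcal{L}_{k_1}(b),\dots,\mathcal{L}_{k_2}(b))$, $f=\mathcal{L}_{k_1-1}|_{[a,b]}$ (with $f=\infty$ if $k_1-1\notin\Sigma$), $g=\mathcal{L}_{k_2+1}|_{[a,b]}$, and $\tilde{\mathcal{Q}}$ has law $\mathbb{P}_{avoid}^{a,b,\vec{x},\vec{y},f,g}$ with its curves re-indexed by $K$ in order. (If $N=1$ the condition is void.) *)

(* Defs.v *)
From HB Require Import structures.
From mathcomp Require Import all_boot all_order all_algebra.
From mathcomp Require Import all_classical all_reals all_analysis.
Set Implicit Arguments.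
Unset Strict Implicit.
Unset Printing Implicit Defensive.
Import Order.TTheory GRing.Theory Num.Theory.
Import numFieldNormedType.Exports.
Local Open Scope classical_set_scope.
Local Open Scope ring_scope.

(* The index set of a line ensemble; [None] stands for N = oo. *)
Definition index_set (N : option nat) : set nat :=
  [set i | (0 < i)%N && (if N is Some n then (i <= n)%N else true)].

Definition int_itv (p q : nat) : set nat := [set i | (p <= i <= q)%N].

Section curve_space.
Context {R : realType}.

(* C(A) for A a subset of nat * R: the subspace topology on A, and on C(A) the
   topology of uniform convergence over compact sets with its Borel sets. *)
Definition curve_space (A : set (nat * R)) := continuousType (set_type A) R.

HB.instance Definition _ (A : set (nat * R)) := Choice.on (curve_space A).
HB.instance Definition _ (A : set (nat * R)) :=
  isPointed.Build (curve_space A) (cst 0 : continuousType (set_type A) R).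
HB.instance Definition _ (A : set (nat * R)) :=
  Topological.copy (curve_space A)
    (initial_topology (id : curve_space A -> {family compact, set_type A -> R})).
HB.instance Definition _ (A : set (nat * R)) :=
  Measurable.copy (curve_space A) (g_sigma_algebraType (@open (curve_space A))).

(* The value h(i, t), or 0 if (i, t) is not in A. *)
Definition curve (A : set (nat * R)) (h : curve_space A) (i : nat) (t : R) : R :=
  'valL_(0 : R) h (i, t).

Section pullback.
Variables (A B : set (nat * R)) (phi : nat * R -> nat * R).
Hypotheses (phi_cts : continuous phi) (phiBA : forall p, B p -> A (phi p)).

Definition pullback_point (p : set_type B) : set_type A :=
  exist _ (phi (set_val p)) (mem_set (phiBA (set_valP p))).

Lemma pullback_point_continuous : continuous pullback_point.
Proof.
apply/(@continuousP (set_type B) (initial_topology (set_val : A -> nat * R))).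
move=> _ [U oU <-].
rewrite (_ : _ @^-1` _ = (phi \o set_val : set_type B -> _) @^-1` U) //.
apply: open_comp => // p _; apply: continuous_comp; last exact: phi_cts.
exact: (@initial_continuous (set_type B) _ set_val).
Qed.

Lemma pullback_continuous (h : curve_space A) : continuous (h \o pullback_point).
Proof.
move=> p; apply: continuous_comp; first exact: pullback_point_continuous.
exact: cts_fun.
Qed.

Definition pullback (h : curve_space A) : curve_space B :=
  mkcts (@pullback_continuous h).

End pullback.

Definition restrict_curves (A B : set (nat * R)) (BA : B `<=` A) :
    curve_space A -> curve_space B :=
  @pullback A B idfun (fun p => cvg_id) BA.

Definition shift_index (k : nat) (p : nat * R) : nat * R := ((p.1.+1 - k)%N, p.2).

Lemma shift_index_continuous k : continuous (shift_index k).
Proof.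
move=> [i t] U [[V1 V2] /= [/nbhs_singleton V1i V2t] VU].
exists ([set i], V2); first by split=> //=; exact: discrete_set1.
by move=> [_ s] /= [-> V2s]; exact: VU.
Qed.

Lemma shift_index_subset (k1 k2 : nat) (I : set R) (p : nat * R) :
  (int_itv k1 k2 `*` I) p -> (int_itv 1 (k2 - k1).+1 `*` I) (shift_index k1 p).
Proof.
case: p => i t [/= /andP[k1i ik2] It]; split => //=.
by rewrite /int_itv/= subn_gt0 ltnS k1i /= subSn // ltnS leq_sub2r.
Qed.

(* Turns curves indexed by 1, ..., k2 - k1 + 1 into curves indexed by
   k1, ..., k2, in order. *)
Definition reindex_curves (k1 k2 : nat) (I : set R) :
    curve_space (int_itv 1 (k2 - k1).+1 `*` I) ->
    curve_space (int_itv k1 k2 `*` I) :=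
  pullback (@shift_index_continuous k1) (@shift_index_subset k1 k2 I).

End curve_space.

Section probability_notions.
Context {R : realType} {d : measure_display} {T : measurableType d}.
Variable P : probability T R.

Definition sigma_generated (J : Type) (D : set J) (X : J -> T -> R) :
    set (set T) :=
  <<s \bigcup_(j in D) preimage_set_system setT (X j) measurable >>.

(* Mutual independence of the sigma-algebras F 1, ..., F n; since each contains
   the whole space, the product rule for subfamilies is included. *)
Definition mutual_independence (n : nat) (F : nat -> set (set T)) : Prop :=
  forall E : nat -> set T, (forall i, int_itv 1 n i -> F i (E i)) ->
    P (\bigcap_(i in int_itv 1 n) E i) = (\prod_(1 <= i < n.+1) P (E i))%E.

(* Y is a version of the conditional expectation of X given G. *)
Definition cond_expectation (G : set (set T)) (X Y : T -> R) : Prop :=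
  [/\ forall B : set R, measurable B -> G (Y @^-1` B),
      P.-integrable setT (EFin \o Y)
    & forall E, G E ->
        (\int[P]_(w in E) (Y w)%:E = \int[P]_(w in E) (X w)%:E)%E].

(* Standard Brownian motion on [0, oo); only nonnegative times matter. *)
Definition brownian_motion (W : R -> {RV P >-> R}) : Prop :=
  [/\ forall w, W 0 w = 0,
      forall w, {within `[0, +oo[, continuous (fun t => W t w)},
      forall s t, 0 <= s -> s < t -> forall B : set R, measurable B ->
        P [set w | B (W t w - W s w)] = normal_prob 0 (Num.sqrt (t - s)) B
    & forall (n : nat) (t : nat -> R), 0 <= t 0%N ->
        (forall i, int_itv 1 n i -> t i.-1 <= t i) ->
        mutual_independence n (fun i =>
          sigma_generated [set: unit] (fun _ w => W (t i) w - W (t i.-1) w))].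

End probability_notions.

Section avoiding_bridges.
Context {R : realType}.

(* The bridge from x at time a to y at time b driven by the path W. *)
Definition bridge (a b x y : R) (W : R -> R) (t : R) : R :=
  let u := (t - a) / (b - a) in
  Num.sqrt (b - a) * (W u - u * W 1) +
  (b - t) / (b - a) * x + (t - a) / (b - a) * y.

(* Vectors in R^k are functions x : nat -> R read at the indices 1, ..., k. *)
Variables (k : nat) (a b : R) (x y : nat -> R).

Local Notation paths := (curve_space (int_itv 1 k `*` `[a, b])).

(* nu is the law of k independent Brownian bridges; the choice of driving
   Brownian motions does not affect the law. *)
Definition is_free_law (nu : probability paths R) : Prop :=
  exists (d : measure_display) (T : measurableType d) (P : probability T R)
    (W : nat -> R -> {RV P >-> R}) (B : {RV P >-> paths}),
    [/\ forall i, int_itv 1 k i -> brownian_motion (W i),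
        mutual_independence P k (fun i =>
          sigma_generated `[0, +oo[ (fun t => W i t : T -> R)),
        forall w i t, int_itv 1 k i -> t \in `[a, b] ->
          curve (B w) i t = bridge a b (x i) (y i) (fun s => W i s w) t
      & forall E, measurable E -> nu E = distribution P B E].

Definition weyl_chamber (z : nat -> R) : Prop :=
  forall i, (1 <= i < k)%N -> z i.+1 < z i.

Variables f g : R -> \bar R.

Definition continuous_or_cst (c : \bar R) (h : R -> \bar R) : Prop :=
  (forall t, t \in `[a, b] -> h t = c) \/
  exists2 h0 : R -> R, {within `[a, b], continuous h0} &
    forall t, t \in `[a, b] -> h t = (h0 t)%:E.

Definition avoid_data : Prop :=
  [/\ [/\ (0 < k)%N, a < b, weyl_chamber x & weyl_chamber y],
      continuous_or_cst +oo%E f /\ continuous_or_cst -oo%E g,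
      forall r, r \in `[a, b] -> (g r < f r)%E,
      ((x 1)%:E < f a)%E /\ ((y 1)%:E < f b)%E
    & (g a < (x k)%:E)%E /\ (g b < (y k)%:E)%E].

Definition avoid_event : set paths :=
  [set h | forall r, r \in `[a, b] ->
    [/\ ((curve h 1 r)%:E < f r)%E,
        forall i, (1 <= i < k)%N -> curve h i.+1 r < curve h i r
      & (g r < (curve h k r)%:E)%E]].

(* mu is the free law conditioned on avoid_event. *)
Definition is_avoid_law (mu : probability paths R) : Prop :=
  avoid_data /\
  exists nu : probability paths R,
    [/\ is_free_law nu, (0 < nu avoid_event)%E
      & forall E, measurable E ->
          mu E = (fine (nu (E `&` avoid_event)) / fine (nu avoid_event))%:E].

End avoiding_bridges.

Lemma setX_subset (U V : Type) (A1 A2 : set U) (B1 B2 : set V) :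
  A1 `<=` A2 -> B1 `<=` B2 -> A1 `*` B1 `<=` A2 `*` B2.
Proof. by move=> A12 B12 p [/A12 ? /B12 ?]; split. Qed.

Section gibbs.
Context {R : realType} (N : option nat) (Lam : set R).
Context {d : measure_display} {T : measurableType d} {P : probability T R}.

Local Notation Sigma := (index_set N).

Variable L : {RV P >-> curve_space (Sigma `*` Lam)}.

Definition non_intersecting : Prop :=
  {ae P, forall w, forall (i j : nat) (r : R),
    Sigma i -> Sigma j -> (i < j)%N -> Lam r ->
    curve (L w) j r < curve (L w) i r}.

Definition ext_sigma (k1 k2 : nat) (a b : R) : set (set T) :=
  sigma_generated ((Sigma `*` Lam) `\` (int_itv k1 k2 `*` `]a, b[))
    (fun p w => curve (L w) p.1 p.2).

(* Conditional expectations are defined up to null sets: the identity says that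
   some version Y agrees almost surely with the expectation under the avoiding
   law. That law depends on w and is defined only when the random boundary data
   satisfy avoid_data, which holds almost surely by non-intersection. *)
Definition partial_brownian_gibbs : Prop :=
  non_intersecting /\
  forall (k1 k2 : nat) (a b : R), (k1 <= k2)%N -> a < b ->
  forall (KS : int_itv k1 k2 `<=` Sigma) (IL : `[a, b] `<=` Lam),
  (if N is Some n then (k2 <= n - 1)%N else true) ->
  forall F : curve_space (int_itv k1 k2 `*` `[a, b]) -> R,
  measurable_fun setT F -> (exists M, forall q, `|F q| <= M) ->
  exists2 Y : T -> R,
    cond_expectation P (ext_sigma k1 k2 a b)
      (fun w => F (restrict_curves (setX_subset KS IL) (L w))) Y
  & {ae P, forall w,
      exists2 Q : probability
                    (curve_space (int_itv 1 (k2 - k1).+1 `*` `[a, b])) R,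
        is_avoid_law
          (fun i => curve (L w) (k1 + i).-1 a)
          (fun i => curve (L w) (k1 + i).-1 b)
          (fun r => if k1.-1 \in Sigma then (curve (L w) k1.-1 r)%:E else +oo%E)
          (fun r => (curve (L w) k2.+1 r)%:E) Q
      & ((Y w)%:E = \int[Q]_q (F (reindex_curves q))%:E)%E}.

End gibbs.

(* Main.v *)
Require Import Defs.
From HB Require Import structures.
From mathcomp Require Import all_boot all_order all_algebra.
From mathcomp Require Import all_classical all_reals all_analysis.
From mathcomp Require Import measurable_realfun ring lra.
Set Implicit Arguments.
Unset Strict Implicit.
Unset Printing Implicit Defensive.
Import Order.TTheory GRing.Theory Num.Theory.
Import numFieldNormedType.Exports.

(** The law of the top k curves determines that of the top k + 1 curves: this is
    the content of the theorem, and an induction that starts from the hypothesis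
    on the first curve and ends with the fact that Borel sets of a curve space
    are generated by cylinders ([borel_cylinders], [curve_measure_unique]).

    To see curve k + 1 through the top k curves, fix an interior time s and a
    level lev, and let [a, b] be a short interval around s. Given everything
    outside, the top k curves on [a, b] are Brownian bridges conditioned to be
    ordered and to stay above curve k + 1. Suppose that curve k is lowered by a
    tent that brings it at time s just below lev, or just below its original
    height if that is smaller. When curve k + 1 is below lev at s, the lowered
    curve still stays above it with high probability; otherwise it does so with
    small probability only. Lowering a curve cannot be observed directly, but
    by the Cameron-Martin formula ([free_cameron_martin]) it amounts to
    multiplying by a density, and the density of a tent shift depends only on
    the values of curve k at a, b and the midpoint. The [observable] is this
    density, multiplied by the indicator that the curves are ordered once the
    lowering is undone and truncated to be bounded. It is a function of the top
    k curves alone; its conditional expectation is a ratio P(N) / P(D), where D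
    is the event that the bridges are ordered and avoid curve k + 1, and N the
    part of D where this persists after lowering, up to truncation
    ([avoid_integral]). So this expectation is in [0, 1] ([lower_avoids]).

    As the interval shrinks, the bridges concentrate near their chords, uniformly
    over all the realizations of Brownian motion since these have the same law
    ([free_law_unique], [bm_tail]), and the ratio tends to the indicator of
    curve k + 1 being below lev at time s ([observable_limit]). By the Gibbs
    property and dominated convergence, integrals of the observable over external
    events tend to probabilities that involve curve k + 1 ([gibbs_limit]).
    Conditions on curve k + 1 are themselves external, so they can be added one
    by one ([same_top_below_cons]), and all finite-dimensional distributions of
    the top k + 1 curves are obtained from the law of the top k ones. *)

Local Open Scope classical_set_scope.
Local Open Scope ring_scope.

(** * Curve spaces: evaluations and cylinders *)

Section curve_space_basics.
Context {R : realType} (A : set (nat * R)).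
Implicit Types h : curve_space A.

Lemma curveE h i t (Ait : (i, t) \in A) : curve h i t = h (exist _ (i, t) Ait).
Proof.
have := congr1 (fun f => f (exist (fun x => x \in A) (i, t) Ait)) (valLK 0 h).
by rewrite /sigL /= => <-.
Qed.

Lemma curve_out h i t : ~ A (i, t) -> curve h i t = 0.
Proof.
move=> NA; rewrite /curve /valL_ oinv_set_val /=.
by case: insubP => // u /set_mem.
Qed.

Lemma curve_within_continuous h :
  {within A, continuous (fun p : nat * R => curve h p.1 p.2)}.
Proof.
have -> : (fun p : nat * R => curve h p.1 p.2) = valL_ 0 h.
  by apply/funext => -[i t].
apply/subspace_valL_continuousP'; exact: cts_fun.
Qed.

(** Evaluation at one point only involves the compact set consisting of that
    point, so it is continuous for uniform convergence on compact sets. *)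
Lemma open_eval i t (O : set R) : A (i, t) -> open O ->
  open [set h : curve_space A | O (curve h i t)].
Proof.
move=> Ait oO; pose p : set_type A := exist _ (i, t) (mem_set Ait).
pose V : set {family compact, set_type A -> R} := [set f | O (f p)].
have -> : [set h : curve_space A | O (curve h i t)] = id @^-1` V.
  by apply/seteqP; split=> h /=; rewrite (curveE h (mem_set Ait)).
exists V => //; rewrite openE => f /= Of.
have : nbhs (f p) O by exact: open_nbhs_nbhs.
rewrite -nbhs_entourageE => -[E entE EO].
apply: (filterS _ (@fam_nbhs _ _ compact [set p] E f entE (@compact_set1 _ p))).
by move=> g /= /(_ p erefl) Efg; apply: EO; exact/xsectionP.
Qed.

Lemma measurable_curve i t :
  measurable_fun setT (fun h : curve_space A => curve h i t).
Proof.
have [Ait|NAit] := pselect (A (i, t)); last first.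
  by rewrite (_ : (fun _ => _) = cst 0)//; apply/funext=> h; rewrite curve_out.
apply: (measurability _ (measurable_realfun.RGenOpens.measurableE R)).
move=> _ [_ [x [y ->]] <-]; rewrite setTI; apply: sub_sigma_algebra.
by apply: open_eval => //; exact: interval_open.
Qed.

End curve_space_basics.

Lemma measurable_set_lt d (T : measurableType d) (R : realType) (f g : T -> R) :
  measurable_fun setT f -> measurable_fun setT g ->
  measurable [set x | f x < g x].
Proof.
move=> mf mg; rewrite (_ : [set _ | _] = (fun x => f x < g x) @^-1` [set true]).
  by rewrite -[X in measurable X]setTI; exact: measurable_fun_ltr.
by apply/seteqP; split=> x.
Qed.

Lemma measurable_set_le d (T : measurableType d) (R : realType) (f g : T -> R) :
  measurable_fun setT f -> measurable_fun setT g ->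
  measurable [set x | f x <= g x].
Proof.
move=> mf mg; rewrite (_ : [set _ | _] = (fun x => f x <= g x) @^-1` [set true]).
  by rewrite -[X in measurable X]setTI; exact: measurable_fun_ler.
by apply/seteqP; split=> x.
Qed.

Lemma countable_bigcapT_measurable d (T : measurableType d) U
    (F : U -> set T) : countable [set: U] ->
  (forall i, measurable (F i)) -> measurable (\bigcap_i F i).
Proof.
move=> cU mF; rewrite -[X in measurable X]setCK setC_bigcap.
by apply/measurableC/countable_bigcupT_measurable => // i; exact/measurableC.
Qed.

Section cylinders.
Context {R : realType}.

(** The flag b selects non-strict inequalities. Both kinds are used: the given
    finite-dimensional distributions are stated with non-strict ones, while the
    limit theorem for the next curve produces strict ones. *)
Definition cylinder (A : set (nat * R)) (b : bool) (l : seq (nat * R * R)) :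
    set (curve_space A) :=
  [set h | forall e, e \in l -> curve h e.1.1 e.1.2 < e.2 ?<= if b].

Definition dense_in (D Lam : set R) :=
  forall t p q, Lam t -> p < t -> t < q -> exists2 s, D s & p < s < q.

Definition cylinders (I : set nat) (D Lam : set R) (b : bool) :
    set (set (curve_space (I `*` Lam))) :=
  [set E | exists2 l : seq (nat * R * R),
     (forall e, e \in l -> I e.1.1 /\ D e.1.2) & E = cylinder b l].

(** Continuity on I * Lam restricted to one curve: the first coordinate is
    discrete, so only the time variable matters. *)
Lemma curve_near (I : set nat) (Lam : set R) (h : curve_space (I `*` Lam)) i t
    (V : set R) : I i -> Lam t -> nbhs (curve h i t) V ->
  exists2 e : R, 0 < e & forall s, Lam s -> `|t - s| < e -> V (curve h i s).
Proof.
move=> Ii Lt nV.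
have Ait : (I `*` Lam) (i, t) by [].
have := @curve_within_continuous R (I `*` Lam) h (i, t) _ nV.
rewrite nbhs_simpl/= /nbhs/= -nbhs_subspace_in//.
rewrite withinE => -[W [[U1 U2] /= [/nbhs_singleton U1i U2t] UW] WE].
case/nbhs_ballP : U2t => e /= e0 eU; exists e => // s Ls ts.
have : (W `&` (I `*` Lam)) (i, s) by split=> //; apply: UW; split => //; exact: eU.
by rewrite -WE => -[].
Qed.

Arguments cylinders : clear implicits.

Variables (I : set nat) (D Lam : set R) (b : bool).
Hypothesis DLam : D `<=` Lam.
Hypothesis D_dense : dense_in D Lam.

Local Notation CS := (curve_space (I `*` Lam)).
Local Notation cyls := (cylinders I D Lam b).
Local Notation S := (g_sigma_algebraType cyls).

Lemma measurable_cylinder l : measurable (cylinder b l : set CS).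
Proof.
rewrite (_ : cylinder b l = \big[setI/setT]_(e <- l)
    [set h : CS | curve h e.1.1 e.1.2 < e.2 ?<= if b]); last first.
  apply/seteqP; split=> [h hl|h].
    by rewrite -bigcap_seq => e; exact: hl.
  by rewrite -bigcap_seq => hl e; exact: hl.
apply: big_ind => //; first exact: measurableI.
move=> e _.
by case: b => /=; [apply: measurable_set_le|apply: measurable_set_lt] => //;
  exact: measurable_curve.
Qed.

Lemma setI_closed_cylinders : setI_closed cyls.
Proof.
move=> _ _ [l1 l1P ->] [l2 l2P ->]; exists (l1 ++ l2).
  by move=> e; rewrite mem_cat => /orP[/l1P|/l2P].
apply/seteqP; split=> [h [h1 h2] e|h hl].
  by rewrite mem_cat => /orP[/h1|/h2].
by split=> e el; apply: hl; rewrite mem_cat el ?orbT.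
Qed.

Let measurable_curve_cyl i t : I i -> D t ->
  measurable_fun setT (fun h : S => curve (h : CS) i t).
Proof.
move=> Ii Dt.
have cyl1 x : measurable ([set h | curve (h : CS) i t < x ?<= if b] : set S).
  apply: sub_sigma_algebra; exists [:: (i, t, x)].
    by move=> e; rewrite inE => /eqP ->.
  apply/seteqP; split=> h /=; first by move=> hx e; rewrite inE => /eqP ->.
  by move=> /(_ (i, t, x)); apply; rewrite inE.
move: cyl1; case: b => cyl1.
  apply: (measurability _ (measurable_realfun.RGenOInfty.measurableE R)).
  move=> _ [_ [x ->] <-]; rewrite setTI (_ : _ @^-1` _ =
    ~` [set h : S | curve (h : CS) i t <= x]); first exact: measurableC (cyl1 x).
  apply/seteqP; split=> h /=; rewrite in_itv/= andbT ltNge; first by move/negP.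
  by move/negP.
apply: (measurability _ (measurable_realfun.RGenInftyO.measurableE R)).
move=> _ [_ [x ->] <-]; rewrite setTI (_ : _ @^-1` _ =
    [set h : S | curve (h : CS) i t < x]); first exact: (cyl1 x).
by apply/seteqP; split=> h /=; rewrite in_itv.
Qed.

(** The curve with index i stays in a rational value interval during a rational
    time interval. There are countably many boxes; their finite intersections
    are a base of neighbourhoods, and each is determined by countably many
    times of D. They thus link open sets to cylinders. *)
Let box (v : nat * rat * rat * rat * rat) : set CS :=
  let: (i, p, q, c, d) := v in
  [set h | I i -> forall t, Lam t -> ratr p < t < ratr q ->
    ratr c <= curve h i t <= ratr d].

Let inside (p q : rat) := [set s | D s /\ ratr p < s < ratr q].

(** A box is an intersection over uncountably many times. By continuity it is
    enough to test, for each pair of rational times, one chosen time of D lying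
    between them. *)
Let measurable_box v : measurable (box v : set S).
Proof.
move: v => [[[[i p] q] c] d].
have [Ii|NIi] := pselect (I i); last first.
  by rewrite (_ : box _ = setT)//; apply/seteqP; split=> h // _ /NIi.
pose G (u : rat * rat) := [set h : S | inside u.1 u.2 !=set0 ->
  p <= u.1 -> u.2 <= q ->
  ratr c <= curve (h : CS) i (get (inside u.1 u.2)) <= ratr d].
have -> : box (i, p, q, c, d) = \bigcap_u G u.
  apply/seteqP; split=> h /= hb.
    move=> [p' q'] _ /= /getPex[Ds /andP[ps sq]] pp' qq'.
    apply: hb => //; first exact: DLam.
    by rewrite (le_lt_trans _ ps) ?ler_rat// (lt_le_trans sq) ?ler_rat.
  move=> _ t Lt /andP[pt tq].
  rewrite -[X in is_true X]negbK; apply/negP => Hn.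
  have oC : open (~` [set y : R | ratr c <= y <= ratr d]).
    rewrite openC (_ : [set _ | _] = `[ratr c, ratr d]%classic).
      exact: interval_closed.
    by apply/seteqP; split=> y; rewrite /= in_itv.
  have nh : nbhs (curve h i t) (~` [set y : R | ratr c <= y <= ratr d]).
    by apply: open_nbhs_nbhs; split => //; exact/negP.
  have [e e0 eV] : exists2 e : R, 0 < e & forall s, Lam s -> `|t - s| < e ->
      ~ (ratr c <= curve h i s <= ratr d).
    exact: curve_near nh.
  have [p' /itvP p'P] : exists q, ratr q \in `]Num.max (ratr p) (t - e), t[.
    by apply: rat_in_itvoo; rewrite gt_max pt/= ltrBlDr ltrDl.
  have [q' /itvP q'P] : exists q0, ratr q0 \in `]t, Num.min (ratr q) (t + e)[.
    by apply: rat_in_itvoo; rewrite lt_min tq/= ltrDl.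
  have p't : ratr p' < t by rewrite p'P.
  have tq' : t < ratr q' by rewrite q'P.
  have [pp' tep'] : (ratr p < ratr p' :> R) /\ (t - e < ratr p').
    by apply/andP; rewrite -gt_max p'P.
  have [qq' q'te] : (ratr q' < ratr q :> R) /\ (ratr q' < t + e).
    by apply/andP; rewrite -lt_min q'P.
  have [s Ds psq] := D_dense Lt p't tq'.
  have ins : inside p' q' !=set0 by exists s.
  have [Ds' /andP[ps' sq']] := getPex ins.
  have := hb (p', q') Logic.I ins; rewrite /=.
  rewrite -(ler_rat R) (ltW pp') -(ler_rat R) (ltW qq') => /(_ isT isT).
  apply: eV; first exact: DLam.
  rewrite ltr_distlC (lt_trans tep' ps')/=.
  exact: lt_trans sq' q'te.
apply: countable_bigcapT_measurable => [|[p' q']]; first exact: countableP.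
rewrite /G/=.
have [[ins [pp' qq']]|NN] := pselect
   (inside p' q' !=set0 /\ (p <= p')%O /\ (q' <= q)%O); last first.
  rewrite (_ : [set _ | _] = setT)//; apply/seteqP; split => // h _ ins pp' qq'.
  by exfalso; apply: NN.
have [Ds _] := getPex ins.
rewrite (_ : [set _ | _] =
    [set h : S | ratr c <= curve (h : CS) i (get (inside p' q'))] `&`
    [set h : S | curve (h : CS) i (get (inside p' q')) <= ratr d]).
  by apply: measurableI; apply: measurable_set_le => //;
    exact: measurable_curve_cyl.
apply/seteqP; split=> h /=.
  by move=> /(_ ins pp' qq')/andP[].
by move=> [-> ->].
Qed.

Let boxes (l : seq (nat * rat * rat * rat * rat)) : set CS :=
  [set h | forall v, v \in l -> box v h].

Let measurable_boxes l : measurable (boxes l : set S).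
Proof.
rewrite (_ : boxes l = \big[setI/setT]_(v <- l) (box v : set S)); last first.
  apply/seteqP; split=> [h hl|h].
    by rewrite -bigcap_seq => v; exact: hl.
  by rewrite -bigcap_seq => hl v; exact: hl.
by apply: big_ind => //; exact: measurableI.
Qed.

Let box_nbhs (h : CS) : set_system CS :=
  filter_from [set l | boxes l h] boxes.

Let box_nbhs_filter h : Filter (box_nbhs h).
Proof.
apply: filter_from_filter; first by exists [::].
move=> l1 l2 h1 h2; exists (l1 ++ l2).
  by move=> v; rewrite mem_cat => /orP[/h1|/h2].
by move=> g gl; split=> v vl; apply: gl; rewrite mem_cat vl ?orbT.
Qed.

(** The boxes around h form a filter that converges to h: near each point of a
    compact set some box controls the distance to h, and compactness turns this
    local control into uniform control. *)
Let box_nbhs_cvg (h : CS) : box_nbhs h --> h.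
Proof.
have FF := box_nbhs_filter h.
move=> U [_ [[U' oU' <-] /= U'h U'U]].
suff cvgh : {family compact, (fun g : CS => (g : set_type (I `*` Lam) -> R)) @
    box_nbhs h --> (h : set_type (I `*` Lam) -> R)}.
  have : nbhs (h : {family compact, set_type (I `*` Lam) -> R}) U'.
    exact: open_nbhs_nbhs.
  by move/cvgh => H; exact: (@filterS _ (box_nbhs h) _ _ _ U'U H).
apply/fam_cvgP => K /compact_near_coveringP cK W /uniform_nbhs[E [entE EW]].
suff : box_nbhs h [set g : CS | forall y, K y -> E (h y, g y)].
  move=> H.
  suff: box_nbhs h
      ((fun g : CS => (g : set_type (I `*` Lam) -> R)) @^-1` W) by [].
  by apply: (@filterS _ (box_nbhs h) _ _ _ _ H) => g Kg; exact: EW.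
have := cK CS (box_nbhs h) (fun g y => E (h y, g y)) FF.
apply => y Ky.
move: entE; rewrite -entourage_ballE => -[e /= e0 eE].
case: y Ky => -[i t] Ait Ky; have [/= Ii Lt] := set_mem Ait.
pose e2 := e / 2; have e20 : 0 < e2 by rewrite divr_gt0.
have [c /itvP cP] := @rat_in_itvoo R (curve h i t - e2) (curve h i t)
  ltac:(by rewrite ltrBlDr ltrDl).
have [d /itvP dP] := @rat_in_itvoo R (curve h i t) (curve h i t + e2)
  ltac:(by rewrite ltrDl).
have [r r0 rP] : exists2 r : R, 0 < r & forall s, Lam s -> `|t - s| < r ->
    (ratr c <= curve h i s <= ratr d).
  apply: (@curve_near _ _ _ _ _ [set y : R | ratr c <= y <= ratr d]) => //.
  have : nbhs (curve h i t) (`]ratr c, ratr d[%classic : set R).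
    by apply: near_in_itvoo; rewrite in_itv/= cP dP.
  by apply: filterS => y; rewrite /= in_itv/= => /andP[/ltW-> /ltW->].
have [p /itvP pP] := @rat_in_itvoo R (t - r) t ltac:(by rewrite ltrBlDr ltrDl).
have [q /itvP qP] := @rat_in_itvoo R t (t + r) ltac:(by rewrite ltrDl).
pose v := (i, p, q, c, d).
pose y : set_type (I `*` Lam) := exist _ (i, t) Ait.
have nb : nbhs y [set z : set_type (I `*` Lam) |
    (set_val z).1 = i /\ ratr p < (set_val z).2 < ratr q].
  apply: (@initial_continuous (set_type (I `*` Lam)) _ set_val y
    [set z | z.1 = i /\ ratr p < z.2 < ratr q]).
  exists ([set i], `]ratr p, ratr q[%classic) => /=.
    split; first exact: discrete_set1.
    by apply: near_in_itvoo; rewrite in_itv/= pP qP.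
  by move=> [j s] /= [-> ]; rewrite in_itv.
exists ([set z : set_type (I `*` Lam) |
    (set_val z).1 = i /\ ratr p < (set_val z).2 < ratr q], box v) => /=.
  split => //.
  exists [:: v] => [w|g /(_ v)].
    rewrite inE => /eqP -> _ s Ls /andP[ps sq]; apply: rP => //.
    have ptr : t - r < ratr p by rewrite pP.
    have qtr : ratr q < t + r by rewrite qP.
    by rewrite ltr_distlC (lt_trans ptr ps) (lt_trans sq qtr).
  by apply; rewrite inE.
move=> [[[j s] Ajs] g]/= [[/= ji spq] bg]; apply: eE => /=.
have [/= Ij Ls] := set_mem Ajs.
subst j; rewrite /ball/= -!curveE.
have /andP[gc gd] := bg Ij s Ls spq.
have /andP[ps sq] := spq.
have ptr : t - r < ratr p by rewrite pP.
have qtr : ratr q < t + r by rewrite qP.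
have /andP[hc hd] : ratr c <= curve h i s <= ratr d.
  by apply: rP => //; rewrite ltr_distlC (lt_trans ptr ps) (lt_trans sq qtr).
have cde : ratr d - ratr c < e.
  have c1 : curve h i t - e2 < ratr c by rewrite cP.
  have d1 : ratr d < curve h i t + e2 by rewrite dP.
  have := splitr e; rewrite -/e2; lra.
by rewrite ltr_distl; apply/andP; split; lra.
Qed.

(** An open set is the union of the finite intersections of boxes that it
    contains, and there are only countably many of these. *)
Lemma borel_cylinders (E : set CS) : measurable E -> <<s cyls >> E.
Proof.
apply: smallest_sub; first exact: smallest_sigma_algebra.
move=> U oU.
have -> : U = \bigcup_l [set h | boxes l h /\ boxes l `<=` U].
  apply/seteqP; split=> [h Uh|h [l _ [lh lU]]]; last exact: lU.
  have [l lh lU] := box_nbhs_cvg (open_nbhs_nbhs (conj oU Uh)).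
  by exists l.
apply: (@countable_bigcupT_measurable _ S) => [|l]; first exact: countableP.
have [lU|NlU] := pselect (boxes l `<=` U).
  rewrite (_ : [set _ | _] = boxes l); first exact: measurable_boxes.
  by apply/seteqP; split=> h // -[].
by rewrite (_ : [set _ | _] = set0)// -subset0 => h -[].
Qed.

(** Cylinders are stable under intersection and generate the Borel sets, so the
    pi-lambda theorem applies. Restricting the times to a dense set D is what
    later allows one time to be left out. *)
Lemma curve_measure_unique (m1 m2 : {measure set CS -> \bar R}) :
  (m1 setT < +oo)%E ->
  (forall l : seq (nat * R * R), (forall e, e \in l -> I e.1.1 /\ D e.1.2) ->
     m1 (cylinder b l) = m2 (cylinder b l)) ->
  forall E, measurable E -> m1 E = m2 E.
Proof.
move=> m1oo m12 E /borel_cylinders; apply: (@g_sigma_algebra_measure_unique _ _ _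
    cyls _ (fun=> cylinder b [::])) => //.
- by move=> _ [l _ ->]; exact: measurable_cylinder.
- by move=> _; exists [::].
- by apply/seteqP; split=> // h _; exists 0%N.
- exact: setI_closed_cylinders.
- by move=> _ [l lP ->]; exact: m12.
- move=> _; apply: le_lt_trans m1oo; apply: le_measure => //.
    by rewrite inE; exact: measurable_cylinder.
  by rewrite inE.
Qed.

Lemma measurable_curve_valued d (T : measurableType d) (f : T -> CS) :
  (forall i t, I i -> D t -> measurable_fun setT (fun w => curve (f w) i t)) ->
  measurable_fun setT f.
Proof.
move=> mf _ E /borel_cylinders; rewrite setTI.
pose G := [set E : set CS | measurable (f @^-1` E)].
apply: (smallest_sub (X := G)) E.
  split; first by rewrite /G/= preimage_set0.
    move=> A GA; rewrite /G/= setTD preimage_setC; exact: measurableC.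
  by move=> F GF; rewrite /G/= preimage_bigcup; exact: bigcupT_measurable.
move=> _ [l lP ->]; rewrite /G/=.
rewrite (_ : f @^-1` _ = \bigcap_(e in [set` l])
    [set w | curve (f w) e.1.1 e.1.2 < e.2 ?<= if b]); last first.
  by apply/seteqP; split.
rewrite bigcap_seq big_seq; apply: big_ind => //; first exact: measurableI.
move=> e /lP[Ie De].
by case: b => /=; [apply: measurable_set_le|apply: measurable_set_lt] => //;
  exact: mf.
Qed.

End cylinders.

(** * Integration against a density *)

Section density.
Context d d' (T : measurableType d) (S : measurableType d') (R : realType).
Variables (mu : {measure set T -> \bar R}) (nu : {measure set S -> \bar R}).
Variables (E : set T) (X : T -> S) (Y : T -> R).
Hypotheses (mE : measurable E) (mX : measurable_fun setT X).
Hypotheses (mY : measurable_fun setT Y) (Y0 : forall w, 0 <= Y w).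
Hypothesis XY_nu : forall A, measurable A ->
  (\int[mu]_(w in E `&` X @^-1` A) (Y w)%:E = nu A)%E.

Import HBNNSimple.

(** If nu is the image under X of the measure with density Y, then integrals
    against nu pull back. The restriction to a set E lets the same statement
    serve for conditioned and for sub-probability measures. *)
Lemma ge0_integral_density (f : S -> R) A : measurable A ->
  measurable_fun setT f -> (forall x, 0 <= f x) ->
  (\int[mu]_(w in E `&` X @^-1` A) (f (X w) * Y w)%:E =
   \int[nu]_(x in A) (f x)%:E)%E.
Proof.
move=> mA mf f0.
have mXA B : measurable B -> measurable (X @^-1` B).
  by move=> mB; rewrite -(setTI (_ @^-1` _)); exact: mX.
have mEA : measurable (E `&` X @^-1` A) by exact/measurableI/mXA.
have mfE : measurable_fun A (EFin \o f).
  exact/measurable_EFinP/measurable_funTS.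
pose f_ := nnsfun_approx mA mfE.
have f_f x : A x -> (EFin \o f_^~ x) @ \oo --> (f x)%:E.
  by move=> Ax; apply: cvg_nnsfun_approx => // y _; rewrite /= lee_fin.
transitivity (limn (fun n => \int[nu]_(x in A) (f_ n x)%:E))%E; last first.
  rewrite -monotone_convergence//.
  - by apply: eq_integral => y /[!inE] yA; apply/cvg_lim => //; exact: f_f.
  - by move=> n; exact/measurable_EFinP/measurable_funP.
  - by move=> n y _; rewrite lee_fin.
  - by move=> y _ m n mn; rewrite lee_fin; exact/lefP/nd_nnsfun_approx.
transitivity (limn (fun n => \int[mu]_(w in E `&` X @^-1` A)
    (f_ n (X w) * Y w)%:E))%E.
  rewrite -monotone_convergence//.
  - apply: eq_integral => w /[!inE] -[_ Aw]; apply/esym/cvg_lim => //.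
    rewrite EFinM; under eq_fun do rewrite EFinM.
    by apply: cvgeZr => //; exact: f_f.
  - move=> n; apply/measurable_EFinP/measurable_funM; last first.
      exact: measurable_funTS.
    by apply: measurable_funTS; exact: measurableT_comp.
  - by move=> n y _; rewrite lee_fin mulr_ge0.
  - move=> y _ m n mn; rewrite lee_fin ler_wpM2r//.
    exact/lefP/nd_nnsfun_approx.
apply: congr_lim; apply/funext => n; set h := f_ n.
transitivity (\sum_(k \in range h) k%:E * nu (h @^-1` [set k] `&` A))%E;
    last first.
  under eq_integral do rewrite fimfunE -fsumEFin//.
  rewrite ge0_integral_fsum//; last 2 first.
  - by move=> y; exact/measurable_EFinP/measurable_funM.
  - by move=> y x _; rewrite nnfun_muleindic_ge0.
  apply: eq_fsbigr => r _; rewrite integralZl_indic_nnsfun//.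
  by rewrite integral_indic.
transitivity (\sum_(k \in range h)
    \int[mu]_(w in E `&` X @^-1` A) (k * \1_(h @^-1` [set k]) (X w) * Y w)%:E)%E.
  rewrite -ge0_integral_fsum//.
  - apply: eq_integral => w _; rewrite fsumEFin//; congr EFin.
    by rewrite {1}fimfunE mulr_fsuml.
  - move=> r; apply/measurable_EFinP/measurable_funTS/measurable_funM => //.
    apply: measurable_funM => //.
    by apply: (@measurableT_comp _ _ _ _ _ _ (\1_(h @^-1` [set r]) : S -> R)).
  - by move=> r w _; rewrite EFinM mule_ge0 ?lee_fin// -lee_fin
       nnfun_muleindic_ge0.
apply: eq_fsbigr => r; rewrite inE => -[x0 _ rE].
have r0 : 0 <= r by rewrite -rE.
under eq_integral do rewrite -mulrA EFinM.
rewrite ge0_integralZl_EFin//; last 2 first.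
- by move=> w _; rewrite lee_fin mulr_ge0.
- apply/measurable_EFinP/measurable_funTS/measurable_funM => //.
  by apply: (@measurableT_comp _ _ _ _ _ _ (\1_(h @^-1` [set r]) : S -> R)).
congr (_ * _)%E; rewrite -XY_nu; last exact: measurableI.
rewrite preimage_setI (setIC (X @^-1` (h @^-1` _))) setIA.
rewrite [RHS]integral_mkcondr; apply: eq_integral => w _.
rewrite /patch indicE.
have -> : (X w \in h @^-1` [set r]) = (w \in X @^-1` (h @^-1` [set r])).
  by apply/idP/idP; rewrite !inE.
by case: ifPn => _; rewrite ?mul1r ?mul0r.
Qed.

End density.

(** * Shifting independent Gaussian variables *)

Section normal_shift.
Context {R : realType}.
Implicit Types (s m x : R) (A : set R).

Lemma measurable_shift_preimage A m : measurable A ->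
  measurable [set x | A (x - m)].
Proof.
move=> mA; have mB : measurable_fun setT (fun x : R => x - m).
  by apply: measurable_funB.
by rewrite -[X in measurable X]setTI; exact: mB.
Qed.

Lemma lebesgue_measure_shift A m : measurable A ->
  pushforward lebesgue_measure ((fun x => x + m) : R -> measurableTypeR R) A =
  lebesgue_measure A.
Proof.
move=> mA; apply/esym/lebesgue_measure_unique => //=.
  by apply: measurable_funD.
move=> _ _ [[a b]] _ <-.
rewrite /pushforward (_ : _ @^-1` _ = `]a - m, b - m]%classic).
  rewrite !lebesgue_measure_itv/= !lte_fin ltrD2r.
  case: ifPn => // _.
  by rewrite -!EFinD; congr EFin; lra.
by apply/seteqP; split=> x /=; rewrite !in_itv/= ltrBlDr lerBrDr.
Qed.

(** Translation invariance of Lebesgue measure, after completing the square: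
    the exponential is the ratio of the density of the Gaussian law translated
    by - m to the centred one. *)
Lemma normal_shift s m A : s != 0 -> measurable A ->
  (\int[normal_prob 0 s]_(x in A)
     (expR (- (x * m *+ 2 + m ^+ 2) / (s ^+ 2 *+ 2)))%:E =
   normal_prob 0 s [set x | A (x - m)%R])%E.
Proof.
move=> s0 mA.
pose f x := expR (- (x * m *+ 2 + m ^+ 2) / (s ^+ 2 *+ 2)).
have mf : measurable_fun setT f.
  apply: measurableT_comp => //; apply: measurable_funM => //.
  apply: measurableT_comp => //; apply: measurable_funD => //.
  under eq_fun do rewrite -mulrnAr.
  by apply: measurable_funM.
have mpdf := measurable_normal_pdf (0 : R) s.
have pdf_ge0 := normal_pdf_ge0 (0 : R) s.
rewrite -(@ge0_integral_density _ _ _ _ _ lebesgue_measure (normal_prob 0 s)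
   setT id (normal_pdf 0 s) _ _ _ _ _ f) ?setTI//; last 2 first.
- by move=> B mB; rewrite setTI.
- by move=> x; exact: expR_ge0.
pose phi : measurableTypeR R -> measurableTypeR R := fun x => x + m.
have mphi : measurable_fun setT phi.
  by apply: measurable_funD.
have mAm := measurable_shift_preimage m mA.
transitivity (\int[lebesgue_measure]_(x in phi @^-1` [set x | A (x - m)%R])
    (normal_pdf 0 s (phi x))%:E)%E.
  have -> : phi @^-1` [set x | A (x - m)] = A.
    by apply/seteqP; split=> x; rewrite /phi/= addrK.
  apply: eq_integral => x _; congr EFin.
  rewrite !normal_pdfE// mulrCA; congr (_ * _).
  rewrite /f /normal_fun -expRD !subr0 /phi; congr expR.
  rewrite -mulrDl; congr (_ / _); lra.
rewrite -(@ge0_integral_pushforward _ _ _ _ _ phi mphi lebesgue_measure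
   [set x | A (x - m)] (EFin \o normal_pdf 0 s))//.
- rewrite /normal_prob; apply: eq_measure_integral => B mB _.
  exact: lebesgue_measure_shift.
- exact/measurable_EFinP/measurable_funTS.
- by move=> x _; rewrite lee_fin.
Qed.

End normal_shift.

Section gaussian_vector_shift.
Context {R : realType} {d : measure_display} {T : measurableType d}.
Context (P : probability T R) (J : choiceType) (js : seq J) (X : J -> T -> R) (s : R).
Hypotheses (js_uniq : uniq js) (s0 : s != 0).
Hypothesis mX : forall j, measurable_fun setT (X j).

Let event (B : J -> set R) := [set w | forall j, j \in js -> B j (X j w)].

Hypothesis indep : forall B : J -> set R, (forall j, measurable (B j)) ->
  P (event B) = (\prod_(j <- js) fine (normal_prob 0 s (B j)))%:E.

Variable m : J -> R.

Definition shift_density (l : seq J) (w : T) : R :=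
  \prod_(j <- l) expR (- (X j w * m j *+ 2 + m j ^+ 2) / (s ^+ 2 *+ 2)).

Lemma shift_density_ge0 l w : 0 <= shift_density l w.
Proof. by apply: prodr_ge0 => j _; exact: expR_ge0. Qed.

Let mdens j : measurable_fun setT
  (fun x : R => expR (- (x * m j *+ 2 + m j ^+ 2) / (s ^+ 2 *+ 2))).
Proof.
apply: measurableT_comp => //; apply: measurable_funM => //.
apply: measurableT_comp => //; apply: measurable_funD => //.
by under eq_fun do rewrite -mulrnAr; apply: measurable_funM.
Qed.

Lemma measurable_shift_density l : measurable_fun setT (shift_density l).
Proof.
rewrite /shift_density; apply: measurable_prod => j _.
exact: (measurableT_comp (mdens j) (mX j)).
Qed.

Lemma measurable_coordinate_event B : (forall j, measurable (B j)) ->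
  measurable (event B).
Proof.
move=> mB; have -> : event B = \bigcap_(j in [set` js]) (X j @^-1` B j).
  by apply/seteqP; split=> w.
rewrite bigcap_seq; apply: big_ind => //; first exact: measurableI.
by move=> j _; rewrite -[X in measurable X]setTI; exact: mX.
Qed.

(** The coordinates are shifted one at a time. When j is added, the measure
    with the density for the coordinates in l, viewed through X j, is a multiple
    of the centred Gaussian law, and the one-dimensional formula applies. *)
Lemma integral_shift_density l : uniq l -> {subset l <= js} ->
  forall B : J -> set R, (forall j, measurable (B j)) ->
  (\int[P]_(w in event B) (shift_density l w)%:E =
   (\prod_(j <- js) fine (normal_prob 0 s
      (if j \in l then [set x | B j (x - m j)%R] else B j)))%:E)%E.
Proof.
elim: l => [_ _ B mB|j l IHl /= /andP[jl ul] ls B mB].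
  rewrite -indep//.
  under eq_integral do rewrite /shift_density big_nil.
  by rewrite integral_cst ?mul1e//; exact: measurable_coordinate_event.
have jjs : j \in js by apply: ls; rewrite mem_head.
have {}ls : {subset l <= js} by move=> i il; apply: ls; rewrite inE il orbT.
pose nB (B : J -> set R) i := fine (normal_prob 0 s
  (if i \in l then [set x | B i (x - m i)%R] else B i)).
pose C (i : J) := if i == j then setT else B i.
have mC i : measurable (C i) by rewrite /C; case: eqP.
pose c : R := \prod_(i <- js | i != j) nB B i.
have c0 : 0 <= c by apply: prodr_ge0 => i _; rewrite fine_ge0.
have eventB A : event C `&` X j @^-1` A = event (fun i => if i == j then A else B i).
  apply/seteqP; split=> w.
    move=> [Cw Aw] i ijs; have := Cw i ijs; rewrite /C.
    by case: eqP => // ->.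
  move=> Hw; split; last by have := Hw j jjs; rewrite eqxx.
  by move=> i ijs; have := Hw i ijs; rewrite /C; case: eqP.
have BE : event B = event C `&` X j @^-1` B j.
  rewrite eventB; apply/seteqP; split=> w Bw i ijs; have := Bw i ijs.
    by case: eqP => // ->.
  by case: eqP => // ->.
rewrite BE; under eq_integral do rewrite /shift_density big_cons.
(* c collects the contributions of the coordinates other than j. *)
pose nu := mscale (NngNum c0) (normal_prob 0 s).
rewrite (@ge0_integral_density _ _ _ _ _ P nu (event C) (X j)
  (shift_density l) _ _ _ _ _
  (fun x : R => expR (- (x * m j *+ 2 + m j ^+ 2) / (s ^+ 2 *+ 2))))//.
- rewrite ge0_integral_mscale//=; first last.
  + by apply: measurable_funTS; apply/measurable_EFinP; exact: mdens.
  + exact: mB.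
  rewrite normal_shift// (bigD1_seq j)//= mem_head EFinM muleC.
  congr (_ * _)%E; first by rewrite fineK// fin_num_measure//;
    exact: measurable_shift_preimage.
  congr EFin; rewrite /c big_seq_cond [RHS]big_seq_cond.
  by apply: eq_bigr => i /andP[_ ij]; rewrite /nB inE (negbTE ij).
- exact: measurable_coordinate_event.
- exact: mX.
- exact: measurable_shift_density.
- exact: shift_density_ge0.
- move=> A mA; rewrite eventB IHl//; last by move=> i; case: eqP.
  rewrite (bigD1_seq j)//= (negbTE jl) eqxx EFinM muleC.
  rewrite /nu /mscale/=; congr (_ * _)%E.
    congr EFin; rewrite /c; apply: eq_bigr => i ij.
    by rewrite /nB (negbTE ij).
  by rewrite fineK// fin_num_measure.
- exact: mB.
- exact: mdens.
Qed.

End gaussian_vector_shift.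

(** * Increments of Brownian motions on a grid *)

Section tilt.
Context {d : measure_display} {T : measurableType d} {R : realType}.
Variables (mu : {measure set T -> \bar R}) (Y : T -> R).
Hypotheses (mY : measurable_fun setT Y) (Y0 : forall w, 0 <= Y w).

(** The measure with density Y with respect to mu. The proofs about Y are
    arguments so that the measure structure can be recovered from the term. *)
Definition tilt & measurable_fun setT Y & (forall w, 0 <= Y w) :
  set T -> \bar R := fun A => (\int[mu]_(w in A) (Y w)%:E)%E.

Local Notation nu := (tilt mY Y0).

Let tilt0 : nu set0 = 0%E.
Proof. by rewrite /tilt integral_set0. Qed.

Let tilt_ge0 A : (0 <= nu A)%E.
Proof. by apply: integral_ge0 => w _; rewrite lee_fin. Qed.

Let tilt_sigma_additive : semi_sigma_additive nu.
Proof.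
move=> /= A mA tA mUA.
rewrite /tilt ge0_integral_bigcup//=.
- by apply: is_cvg_ereal_nneg_natsum_cond => n _ _; exact: tilt_ge0.
- exact/measurable_EFinP/measurable_funTS.
- by move=> w _; rewrite lee_fin.
Qed.

HB.instance Definition _ := isMeasure.Build _ _ _
  nu tilt0 tilt_ge0 tilt_sigma_additive.

End tilt.

Section sigma_generated.
Context {R : realType} {d : measure_display} {T : measurableType d}.

Lemma measurable_sigma_generated (J : Type) (D : set J) (X : J -> T -> R) j :
  D j -> measurable_fun setT (X j : g_sigma_algebraType
     (\bigcup_(j in D) preimage_set_system setT (X j) measurable) -> R).
Proof.
move=> Dj _ B mB; apply: sub_sigma_algebra.
by exists j => //; exists B.
Qed.

End sigma_generated.

Section increments.
Context {R : realType} (k N : nat).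

(** Rows are the curve indices 1, ..., k; column j stands for the increment from
    time j / N to time (j + 1) / N. *)
Definition grid : seq (nat * nat) := [seq (i, j) | i <- iota 1 k, j <- iota 0 N].

Definition rectangles : set (set (nat * nat -> R)) :=
  [set A | exists2 B : nat * nat -> set R, (forall e, measurable (B e)) &
     A = [set f | forall e, e \in grid -> B e (f e)]].

Lemma mem_grid i j : ((i, j) \in grid) = (0 < i <= k)%N && (j < N)%N.
Proof.
apply/allpairsP/idP => [[[i' j'] /= [+ + [-> ->]]]|/andP[ik jN]].
  by rewrite !mem_iota add1n ltnS => -> ->.
by exists (i, j); split=> //=; rewrite mem_iota// add1n ltnS.
Qed.

Lemma grid_uniq : uniq grid.
Proof.
apply: allpairs_uniq; [exact: iota_uniq|exact: iota_uniq|].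
by move=> [? ?] [? ?].
Qed.

Lemma measurable_grid e : e \in grid ->
  measurable_fun setT (fun f : g_sigma_algebraType rectangles => f e).
Proof.
move=> eg _ B mB; rewrite setTI; apply: sub_sigma_algebra.
exists (fun e' => if e' == e then B else setT); first by move=> e'; case: eqP.
apply/seteqP; split=> f /=; first by move=> fB e' _; case: eqP => // ->.
by move=> /(_ e eg); rewrite eqxx.
Qed.

Lemma setI_closed_rectangles : setI_closed rectangles.
Proof.
move=> _ _ [B1 mB1 ->] [B2 mB2 ->]; exists (fun e => B1 e `&` B2 e).
  by move=> e; exact: measurableI.
apply/seteqP; split=> [f [f1 f2] e eg|f fB]; first by split; [exact: f1|exact: f2].
by split=> e /fB[].
Qed.

Section one_family.
Context {d : measure_display} {T : measurableType d} (P : probability T R).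
Variable W : nat -> R -> {RV P >-> R}.

Definition bm_family : Prop :=
  (forall i, int_itv 1 k i -> brownian_motion (W i)) /\
  mutual_independence P k (fun i =>
    sigma_generated `[0, +oo[ (fun t => W i t : T -> R)).

Definition increment (e : nat * nat) (w : T) : R :=
  W e.1 (e.2.+1%:R / N%:R) w - W e.1 (e.2%:R / N%:R) w.

Definition increments (w : T) : g_sigma_algebraType rectangles :=
  fun e => increment e w.

Lemma measurable_increment e : measurable_fun setT (increment e).
Proof. by apply: measurable_funB; exact: measurable_funPT. Qed.

Hypotheses (bmW : bm_family) (N0 : (0 < N)%N).

Lemma increments_independent (B : nat * nat -> set R) :
  (forall e, measurable (B e)) ->
  P [set w | forall e, e \in grid -> B e (increment e w)] =
  (\prod_(e <- grid) fine (normal_prob 0 (Num.sqrt N%:R^-1) (B e)))%:E.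
Proof.
move=> mB; have [bm ind] := bmW.
pose E i := [set w | forall j, (j < N)%N -> B (i, j) (increment (i, j) w)].
have -> : [set w | forall e, e \in grid -> B e (increment e w)] =
    \bigcap_(i in int_itv 1 k) E i.
  apply/seteqP; split=> [w wB i ik j jN|w wE [i j]].
    by apply: wB; rewrite mem_grid jN andbT.
  by rewrite mem_grid => /andP[ik jN]; exact: wE.
rewrite ind; last first.
  move=> i ik.
  pose S := g_sigma_algebraType (\bigcup_(t in `[0, +oo[)
    preimage_set_system setT (W i t : T -> R) measurable).
  rewrite (_ : E i = \bigcap_(j in [set j | (j < N)%N])
      (increment (i, j) @^-1` B (i, j))); last first.
    by apply/seteqP; split.
  apply: (@bigcap_measurableType _ S) => j _.
  have mI : measurable_fun setT (increment (i, j) : S -> R).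
    apply: measurable_funB; apply: measurable_sigma_generated;
      by rewrite /= in_itv/= andbT divr_ge0.
  by rewrite -[X in measurable X]setTI; exact: mI.
transitivity (\prod_(1 <= i < k.+1) \prod_(0 <= j < N)
   fine (normal_prob 0 (Num.sqrt N%:R^-1) (B (i, j))))%:E; last first.
  congr EFin; rewrite /grid big_allpairs_dep/=.
  rewrite /index_iota subn0 subSS subn0//.
rewrite -prodEFin big_seq [RHS]big_seq; apply: eq_bigr => i.
rewrite mem_index_iota ltnS => ik.
have [_ _ Wnormal Wind] := bm _ ik.
pose t j : R := j%:R / N%:R.
have -> : E i = \bigcap_(j in int_itv 1 N) (increment (i, j.-1) @^-1` B (i, j.-1)).
  apply/seteqP; split=> w Hw j.
    by move=> /andP[j0 jN]; apply: Hw; rewrite prednK.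
  by move=> jN; apply: (Hw j.+1); rewrite /int_itv/= jN.
rewrite (Wind N t).
- rewrite big_add1/= -prodEFin; apply: eq_bigr => j _.
  have := Wnormal (t j) (t j.+1).
  rewrite /t/= divr_ge0// -mulrBl -natrB// subSnn mul1r.
  rewrite ltr_pM2r ?invr_gt0 ?ltr0n// ltr_nat ltnSn => /(_ isT isT) <-//.
  rewrite fineK//; apply: fin_num_measure.
  by have := measurable_increment (i, j) measurableT (mB (i, j)); rewrite setTI.
- by rewrite /t mul0r.
- move=> j _; rewrite /t ler_pM2r ?invr_gt0 ?ltr0n// ler_nat; exact: leq_pred.
- move=> j /andP[j0 jN]; rewrite /sigma_generated; apply: sub_sigma_algebra.
  exists tt => //; by exists (B (i, j.-1)) => //; rewrite setTI /increment /t/= prednK.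
Qed.

Lemma measurable_increments : measurable_fun setT increments.
Proof.
apply: (@measurability _ _ _ (g_sigma_algebraType rectangles) _ _ rectangles) => //.
move=> _ [_ [B mB ->] <-]; rewrite setTI.
have -> : increments @^-1` [set f | forall e, e \in grid -> B e (f e)] =
    \bigcap_(e in [set` grid]) (increment e @^-1` B e).
  by apply/seteqP; split.
rewrite bigcap_seq; apply: big_ind => //; first exact: measurableI.
by move=> e _; rewrite -[X in measurable X]setTI; apply: measurable_increment.
Qed.

End one_family.

Lemma measurable_shift_rectangles (m : nat * nat -> R) :
  measurable_fun setT (fun f : g_sigma_algebraType rectangles =>
    (fun e => f e - m e) : g_sigma_algebraType rectangles).
Proof.
apply: (@measurability _ _ _ (g_sigma_algebraType rectangles) _ _ rectangles) => //.
move=> _ [_ [B mB ->] <-]; rewrite setTI.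
apply: sub_sigma_algebra; exists (fun e => [set x | B e (x - m e)]).
  by move=> e; exact: measurable_shift_preimage.
by apply/seteqP; split.
Qed.

Section two_families.
Context {d1 d2 : measure_display} {T1 : measurableType d1} {T2 : measurableType d2}.
Context {P1 : probability T1 R} {P2 : probability T2 R}.
Variables (W1 : nat -> R -> {RV P1 >-> R}) (W2 : nat -> R -> {RV P2 >-> R}).
Hypotheses (bm1 : bm_family W1) (bm2 : bm_family W2) (N0 : (0 < N)%N).
Variable m : nat * nat -> R.

Let s : R := Num.sqrt N%:R^-1.
Let s0 : s != 0.
Proof. by rewrite gt_eqF// sqrtr_gt0 invr_gt0 ltr0n. Qed.

Local Notation dens := (shift_density (increment W1) s m grid).

(** Two families of Brownian motions are involved, on different probability
    spaces: taking m = 0 then says that the law of the increments is the same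
    for every realization, and general m is the discrete Cameron-Martin
    formula. Both sides are measures in A that agree on rectangles. *)
Lemma increments_cameron_martin A :
  measurable (A : set (g_sigma_algebraType rectangles)) ->
  (\int[P1]_(w in increments W1 @^-1` A) (dens w)%:E =
   P2 [set w | A (fun e => increment W2 e w - m e)%R])%E.
Proof.
move=> mA.
have mD : measurable_fun setT dens.
  by apply: measurable_shift_density => e; exact: measurable_increment.
have D0 w : 0 <= dens w by exact: shift_density_ge0.
pose F2 w : g_sigma_algebraType rectangles := fun e => increment W2 e w - m e.
have mF1 := measurable_increments W1.
have mF2 : measurable_fun setT F2.
  exact: (measurableT_comp (measurable_shift_rectangles m)
                           (measurable_increments W2)).
pose m1 : {measure set _ -> \bar R} := pushforward (tilt P1 mD D0) (increments W1).
pose m2 : {measure set _ -> \bar R} := pushforward P2 F2.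
suff : m1 mF1 A = m2 mF2 A by [].
have m12 B : (forall e, measurable (B e)) ->
    m1 mF1 [set f | forall e, e \in grid -> B e (f e)] =
    m2 mF2 [set f | forall e, e \in grid -> B e (f e)].
  move=> mB; rewrite /m1 /m2 /= /pushforward /tilt.
  have := @integral_shift_density _ _ _ P1 _ grid (increment W1) s grid_uniq s0
    (measurable_increment W1) (increments_independent bm1 N0) m grid grid_uniq
    (fun=> id) B mB.
  move=> H; apply: (etrans H) => {H}.
  have mBm e : measurable [set x | B e (x - m e)].
    exact: measurable_shift_preimage.
  have := increments_independent bm2 N0 mBm => H.
  apply: etrans (esym H); congr EFin.
  by rewrite big_seq [RHS]big_seq; apply: eq_bigr => e ->.
apply: (@g_sigma_algebra_measure_unique _ R (g_sigma_algebraType rectangles)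
  rectangles _ (fun=> setT)) => //.
- by move=> B ?; exact: sub_sigma_algebra.
- by move=> _; exists (fun=> setT) => //; apply/seteqP; split.
- by apply/seteqP; split=> // f _; exists 0%N.
- exact: setI_closed_rectangles.
- by move=> _ [B mB ->]; exact: m12.
- move=> _; have := m12 (fun=> setT) (fun=> measurableT).
  rewrite (_ : [set _ | _] = setT); last by apply/seteqP; split.
  by move=> ->; rewrite /m2 /= /pushforward preimage_setT probability_setT ltry.
Qed.

End two_families.
End increments.

(** * Curves from functions, and inequalities uniform in time *)

Section curves_of.
Context {R : realType} (I : set nat) (Lam : set R).
Implicit Types F : nat -> R -> R.

Lemma within_near (f : R -> R) t (V : set R) :
  {within Lam, continuous f} -> Lam t -> nbhs (f t) V ->
  exists2 e : R, 0 < e & forall s, Lam s -> `|t - s| < e -> V (f s).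
Proof.
move=> cf Lt nV; have := cf t V nV.
rewrite nbhs_simpl/= /nbhs/= -nbhs_subspace_in//.
rewrite withinE => -[W nW WE].
case/nbhs_ballP : nW => e /= e0 eW; exists e => // s Ls ts.
have : (W `&` Lam) s by split=> //; exact: eW.
by rewrite -WE => -[].
Qed.

Lemma near_within (f : R -> R) :
  (forall t (V : set R), Lam t -> nbhs (f t) V ->
    exists2 e : R, 0 < e & forall s, Lam s -> `|t - s| < e -> V (f s)) ->
  {within Lam, continuous f}.
Proof.
move=> H; rewrite continuous_subspace_in => t; rewrite inE => Lt V nV.
have [e e0 eV] := H t V Lt nV.
rewrite nbhs_simpl/= /nbhs/= -nbhs_subspace_in//.
rewrite withinE; exists (ball t e `|` f @^-1` V).
  by apply/nbhs_ballP; exists e => // s; left.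
apply/seteqP; split=> s [ + Ls]; first by split => //; right.
by case=> // ts; split => //; exact: eV.
Qed.

Lemma curve_continuous (h : curve_space (I `*` Lam)) i : I i ->
  {within Lam, continuous (curve h i)}.
Proof. by move=> Ii; apply: near_within => t V Lt; exact: curve_near. Qed.

Lemma pasted_curves_continuous F :
  (forall i, I i -> {within Lam, continuous (F i)}) ->
  continuous (fun p : set_type (I `*` Lam) => F (set_val p).1 (set_val p).2).
Proof.
move=> cF [[i t] Ait] V /= nV; have [/= Ii Lt] := set_mem Ait.
have [e e0 eV] := within_near (cF i Ii) Lt nV.
rewrite nbhs_simpl/=.
pose U : set (nat * R) := [set z | z.1 = i /\ `|t - z.2| < e].
have nU : nbhs (i, t) U.
  exists ([set i], ball t e) => /=.
    by split; [exact: discrete_set1|exact: nbhsx_ballx].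
  by move=> [j s] /= [-> ].
pose p : set_type (I `*` Lam) := exist _ (i, t) Ait.
have nb : nbhs p [set z : set_type (I `*` Lam) | U (set_val z)].
  exact: (@initial_continuous (set_type (I `*` Lam)) _ set_val p U nU).
suff : nbhs p [set z : set_type (I `*` Lam) | V (F (set_val z).1 (set_val z).2)].
  by [].
apply: filterS nb => -[[j s] Ajs] /= [ji ts]; have [/= _ Ls] := set_mem Ajs.
change (V (F j s)); change (j = i) in ji; change (is_true (`|t - s| < e)) in ts.
by rewrite ji; exact: eV.
Qed.

(** A total constructor, with a default value for discontinuous families, so
    that maps into a curve space can be defined before continuity is proved. *)
Definition curves_of F : curve_space (I `*` Lam) :=
  match pselect (forall i, I i -> {within Lam, continuous (F i)}) with
  | left cF => mkcts (pasted_curves_continuous cF)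
  | right _ => point
  end.

Lemma curves_ofE F i t : (forall i, I i -> {within Lam, continuous (F i)}) ->
  I i -> Lam t -> curve (curves_of F) i t = F i t.
Proof.
move=> cF Ii Lt; have At : (i, t) \in I `*` Lam by rewrite inE.
by rewrite curveE /curves_of; case: pselect.
Qed.

End curves_of.

Section uniform_inequalities.
Context {R : realType} {d : measure_display} {T : measurableType d}.
Variables (a b : R) (u : T -> R -> R).
Hypothesis ab : a < b.
Hypothesis cu : forall w, {within `[a, b], continuous (u w)}.
Hypothesis mu : forall t, t \in `[a, b] -> measurable_fun setT (u^~ t).

(** Rational times suffice, by continuity. *)
Lemma measurable_forall_le c :
  measurable [set w | forall t, t \in `[a, b] -> u w t <= c].
Proof.
pose G (q : rat) := [set w | ratr q \in `[a, b] -> u w (ratr q) <= c].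
rewrite (_ : [set _ | _] = \bigcap_q G q).
  apply: countable_bigcapT_measurable => [|q]; first exact: countableP.
  have [qab|Nqab] := boolP (ratr q \in `[a, b]); last first.
    rewrite (_ : G q = setT)//; apply/seteqP; split=> // w _.
    by rewrite /G/= (negbTE Nqab).
  rewrite (_ : G q = [set w | u w (ratr q) <= c]).
    by apply: measurable_set_le => //; exact: mu.
  by apply/seteqP; split=> w; rewrite /G/= qab // => /(_ isT).
apply/seteqP; split=> [w wc q _|w wG t tab]; first exact: wc.
rewrite leNgt; apply/negP => ct.
have Lt : `[a, b]%classic t by [].
have nct : nbhs (u w t) `]c, +oo[%classic.
  apply: open_nbhs_nbhs; split; first exact: interval_open.
  by rewrite /= in_itv/= andbT.
have [e e0 eV] := within_near (@cu w) Lt nct.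
have [at_ tb] : a <= t /\ t <= b by apply/andP; move: tab; rewrite in_itv.
have lt_pq : Num.max a (t - e) < Num.min b (t + e).
  rewrite gt_max !lt_min ab (le_lt_trans at_) ?ltrDl//.
  by rewrite ltrBlDr (le_lt_trans tb) ?ltrDl// ltrBlDr -addrA ltrDl addr_gt0.
have [q] := rat_in_itvoo lt_pq.
rewrite in_itv/= gt_max lt_min => /andP[/andP[q1 q1'] /andP[q2 q2']].
have qab : ratr q \in `[a, b] by rewrite in_itv/= !ltW.
have := wG q Logic.I qab; rewrite leNgt => /negP; apply.
have := eV (ratr q) qab; rewrite /= in_itv/= andbT; apply.
by rewrite ltr_distlC q1' q2'.
Qed.

End uniform_inequalities.

(** Rational times do not suffice for strict inequalities, but on a compact
    interval a strict bound is attained with a margin, so the event is a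
    countable union of events with non-strict bounds. *)
Lemma measurable_forall_lt {R : realType} d (T : measurableType d)
    (a b : R) (u : T -> R -> R) :
  a < b -> (forall w, {within `[a, b], continuous (u w)}) ->
  (forall t, t \in `[a, b] -> measurable_fun setT (u^~ t)) -> forall c,
  measurable [set w | forall t, t \in `[a, b] -> u w t < c].
Proof.
move=> ab cu mu c.
have -> : [set w | forall t, t \in `[a, b] -> u w t < c] =
    \bigcup_n [set w | forall t, t \in `[a, b] -> u w t <= c - n.+1%:R^-1].
  apply/seteqP; split=> [w wc|w [n _ wn] t tab]; last first.
    by rewrite (le_lt_trans (wn t tab))// ltrBlDr ltrDl.
  have [t0 t0ab t0max] := EVT_max (ltW ab) (cu w).
  have := wc t0 t0ab; rewrite -subr_gt0 => /ltr_add_invr[n].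
  rewrite add0r => nc; exists n => // t tab.
  by rewrite (le_trans (t0max t tab))// lerBrDr -lerBrDl ltW.
by apply: bigcupT_measurable => n; exact: measurable_forall_le.
Qed.

(** * Tents and grids *)

Section tent_shift.
Context {R : realType}.
Implicit Types (f m : nat * nat -> R) (i j M : nat).

Definition partial_sum f i j : R := \sum_(0 <= l < j) f (i, l).

Definition tent_increments k M (eta : R) (e : nat * nat) : R :=
  (e.1 == k)%:R * (if (e.2 < M)%N then eta else - eta).

Lemma partial_sum_tent_low k M eta i j : (j <= M)%N ->
  partial_sum (tent_increments k M eta) i j = (i == k)%:R * (j%:R * eta).
Proof.
move=> jM; rewrite /partial_sum.
rewrite (eq_big_nat _ _ (F2 := fun=> (i == k)%:R * eta)); last first.
  by move=> l /= lj; rewrite /tent_increments/= (leq_trans lj jM).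
rewrite big_const_nat subn0 iter_addr_0 -[LHS]mulr_natl. by ring.
Qed.

Lemma partial_sum_tent_high k M eta i j : (M <= j)%N ->
  partial_sum (tent_increments k M eta) i j =
  (i == k)%:R * ((M%:R *+ 2 - j%:R) * eta).
Proof.
move=> Mj; rewrite /partial_sum (@big_cat_nat _ _ _ M)//=.
rewrite -/(partial_sum _ i M) partial_sum_tent_low//.
rewrite (eq_big_nat _ _ (F2 := fun=> (i == k)%:R * - eta)); last first.
  by move=> l /andP[Ml lj]; rewrite /tent_increments/= ltnNge Ml.
rewrite big_const_nat iter_addr_0 -[X in _ + X = _]mulr_natl natrB//.
by ring.
Qed.

(** The slope of a tent takes only the two values eta and - eta, so the product
    of Gaussian densities telescopes: the path enters only through its values at
    the midpoint and at the end. This is why the density of a bridge lowered by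
    a tent is a function of its midpoint value. *)
Lemma shift_density_tent {d} {T : measurableType d} (k M : nat) (eta : R)
    (X : nat * nat -> T -> R) (w : T) : (0 < k)%N -> (0 < M)%N ->
  let N := (M + M)%N in
  shift_density X (Num.sqrt N%:R^-1) (tent_increments k M eta) (grid k N) w =
  expR (- (N%:R * eta) * (partial_sum (X^~ w) k M *+ 2 - partial_sum (X^~ w) k N)
        - N%:R * M%:R * eta ^+ 2).
Proof.
move=> k0 M0 N.
rewrite /shift_density /grid big_allpairs_dep/=.
rewrite (bigD1_seq k) ?iota_uniq ?mem_iota ?k0 ?add1n ?ltnSn//=.
rewrite [X in _ * X]big1 => [|i ik]; last first.
  rewrite big1// => j _; rewrite /tent_increments/= (negbTE ik) mul0r mulr0.
  by rewrite mul0rn expr0n/= addr0 oppr0 mul0r expR0.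
rewrite mulr1 -expR_sum; congr expR.
have N0 : 0 < N%:R :> R by rewrite ltr0n addn_gt0 M0.
have s2 : Num.sqrt (N%:R^-1 : R) ^+ 2 = N%:R^-1 by rewrite sqr_sqrtr// invr_ge0 ltW.
have -> : iota 0 N = index_iota 0 N by rewrite /index_iota subn0.
set PS := partial_sum _ k.
have PSN : PS N = PS M + \sum_(M <= l < N) X (k, l) w.
  by rewrite /PS /partial_sum (@big_cat_nat _ _ _ M)//= leq_addr.
rewrite (@big_cat_nat _ _ _ M)//= ?leq_addr// s2.
have -> : \sum_(0 <= i < M) - (X (k, i) w * tent_increments k M eta (k, i) *+ 2 +
     tent_increments k M eta (k, i) ^+ 2) / (N%:R^-1 *+ 2) =
     - N%:R * (eta * PS M + M%:R * eta ^+ 2 / 2).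
  rewrite (eq_big_nat _ _ (F2 := fun l => - N%:R * eta * X (k, l) w +
      - (N%:R * eta ^+ 2 / 2))); last first.
    move=> l /= lM; rewrite /tent_increments/= eqxx lM mul1r.
    by field; rewrite gt_eqF.
  rewrite big_split/= -mulr_sumr -/(partial_sum (X^~ w) k M) -/PS.
  rewrite big_const_nat subn0 iter_addr_0 -[X in _ + X = _]mulr_natl.
  by field.
have -> : \sum_(M <= i < N) - (X (k, i) w * tent_increments k M eta (k, i) *+ 2 +
     tent_increments k M eta (k, i) ^+ 2) / (N%:R^-1 *+ 2) =
     - N%:R * (- eta * (PS N - PS M) + M%:R * eta ^+ 2 / 2).
  rewrite (eq_big_nat _ _ (F2 := fun l => N%:R * eta * X (k, l) w +
      - (N%:R * eta ^+ 2 / 2))); last first.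
    move=> l /andP[Ml lN]; rewrite /tent_increments/= eqxx ltnNge Ml mul1r/=.
    by field; rewrite gt_eqF.
  rewrite big_split/= -mulr_sumr PSN.
  rewrite big_const_nat /N addnK iter_addr_0 -[X in _ + X = _]mulr_natl.
  by field.
by field.
Qed.

End tent_shift.

Section tent.
Context {R : realType}.
Implicit Types (a b c t : R).

Definition tent a b t : R := 1 - `|t - (a + b) / 2| / ((b - a) / 2).

Lemma tent_continuous a b : continuous (tent a b).
Proof.
move=> t; apply: cvgB; first exact: cvg_cst.
apply: cvgMl; apply: cvg_norm; apply: cvgB; [exact: cvg_id|exact: cvg_cst].
Qed.

Lemma tent_end a b : a < b -> tent a b a = 0 /\ tent a b b = 0.
Proof.
move=> ab; have ba : 0 < b - a by rewrite subr_gt0.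
rewrite /tent (_ : a - (a + b) / 2 = - ((b - a) / 2)); last by field.
rewrite (_ : b - (a + b) / 2 = (b - a) / 2); last by field.
rewrite normrN ger0_norm ?divr_ge0 ?ltW//.
by rewrite divff ?subrr// mulf_neq0 ?gt_eqF// invr_gt0.
Qed.

Lemma tent_mid a b : tent a b ((a + b) / 2) = 1.
Proof. by rewrite /tent subrr normr0 mul0r subr0. Qed.

Lemma tent_ge0 a b t : a < b -> t \in `[a, b] -> 0 <= tent a b t <= 1.
Proof.
move=> ab; rewrite in_itv/= => /andP[at_ tb].
have h0 : 0 < (b - a) / 2 by rewrite divr_gt0 ?subr_gt0.
apply/andP; split; last by rewrite /tent gerBl divr_ge0// ltW.
rewrite /tent subr_ge0 ler_pdivrMr// mul1r ler_norml; apply/andP; split; lra.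
Qed.

Definition grid_time a b (N j : nat) : R := a + (b - a) * (j%:R / N%:R).

Lemma tent_grid_low a b M j : a < b -> (0 < M)%N -> (j <= M)%N ->
  tent a b (grid_time a b (M + M) j) = j%:R / M%:R.
Proof.
move=> ab M0 jM.
have ba : 0 < b - a by rewrite subr_gt0.
have M0' : 0 < M%:R :> R by rewrite ltr0n.
have jM' : j%:R <= M%:R :> R by rewrite ler_nat.
rewrite /tent /grid_time natrD ler0_norm.
  by field; rewrite !gt_eqF// addr_gt0.
rewrite (_ : _ - _ = (b - a) / 2 * (j%:R / M%:R - 1)); last first.
  by field; rewrite !gt_eqF// addr_gt0.
by rewrite pmulr_rle0 ?divr_gt0// subr_le0 ler_pdivrMr// mul1r.
Qed.

Lemma tent_grid_high a b M j : a < b -> (0 < M)%N -> (M <= j)%N ->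
  tent a b (grid_time a b (M + M) j) = (M%:R *+ 2 - j%:R) / M%:R.
Proof.
move=> ab M0 Mj.
have ba : 0 < b - a by rewrite subr_gt0.
have M0' : 0 < M%:R :> R by rewrite ltr0n.
have Mj' : M%:R <= j%:R :> R by rewrite ler_nat.
rewrite /tent /grid_time natrD ger0_norm.
  by field; rewrite !gt_eqF// addr_gt0.
rewrite (_ : _ - _ = (b - a) / 2 * (j%:R / M%:R - 1)); last first.
  by field; rewrite !gt_eqF// addr_gt0.
by rewrite pmulr_rge0 ?divr_gt0// subr_ge0 ler_pdivlMr// mul1r.
Qed.

Definition grid_times a b : set R :=
  [set t | exists N j, [/\ (0 < N)%N, (j <= N)%N & t = grid_time a b N j]].

Lemma grid_times_sub a b : a < b -> grid_times a b `<=` `[a, b].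
Proof.
move=> ab _ [N [j [N0 jN ->]]]; rewrite /= in_itv/= /grid_time.
have ba : 0 <= b - a by rewrite subr_ge0 ltW.
rewrite lerDl mulr_ge0 ?divr_ge0//= -lerBrDl ler_piMr//.
by rewrite ler_pdivrMr ?ltr0n// mul1r ler_nat.
Qed.

Lemma grid_times_dense a b : a < b -> dense_in (grid_times a b) `[a, b].
Proof.
move=> ab t p q; rewrite /= in_itv/= => /andP[at_ tb] pt tq.
have ba : 0 < b - a by rewrite subr_gt0.
have lt_pq : (Num.max a p - a) / (b - a) < (Num.min b q - a) / (b - a).
  rewrite ltr_pM2r ?invr_gt0// ltrD2r gt_max !lt_min ab (le_lt_trans at_ tq).
  by rewrite (lt_le_trans pt tb) (lt_trans pt tq).
have [r] := rat_in_itvoo lt_pq.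
rewrite in_itv/= ltr_pdivrMr// ltr_pdivlMr// ltrBDr ltrBrDr gt_max lt_min.
move=> /andP[/andP[ar pr] /andP[rb rq]].
have r0 : 0 < ratr r :> R by rewrite -(pmulr_lgt0 _ ba); lra.
have r1 : ratr r < 1 :> R by rewrite -(ltr_pM2r ba); lra.
have nE : (`|numq r|%N%:R : R) = (numq r)%:~R.
  by rewrite pmulrn gez0_abs// numq_ge0 -(ler_rat R) rmorph0 ltW.
have dE : (`|denq r|%N%:R : R) = (denq r)%:~R.
  by rewrite pmulrn gez0_abs// ltW// denq_gt0.
have d0 : 0 < `|denq r|%N%:R :> R by rewrite ltr0n absz_gt0 denq_eq0.
have rE : ratr r = `|numq r|%N%:R / `|denq r|%N%:R :> R.
  by rewrite nE dE.
exists (ratr r * (b - a) + a); last by rewrite pr rq.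
exists `|denq r|%N, `|numq r|%N; split.
- by rewrite absz_gt0 denq_eq0.
- by rewrite -(ler_nat R) -[leRHS]mul1r -ler_pdivrMr// -rE ltW.
- by rewrite /grid_time rE addrC mulrC.
Qed.

(** The number of grid steps is even, so that the midpoint, where the tent has
    its kink, is itself a grid point. *)
Lemma common_grid a b (l : seq (nat * R * R)) :
  (forall e, e \in l -> grid_times a b e.1.2) ->
  exists2 M, (0 < M)%N & forall e, e \in l ->
    exists2 j, (j <= M + M)%N & e.1.2 = grid_time a b (M + M) j.
Proof.
elim: l => [_|e l IHl lP]; first by exists 1%N.
have [|M M0 MP] := IHl; first by move=> e' el; apply: lP; rewrite inE el orbT.
have [N [j [N0 jN eE]]] := lP e (mem_head _ _).
have N0' : 0 < N%:R :> R by rewrite ltr0n.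
have M0' : 0 < M%:R :> R by rewrite ltr0n.
exists (M * N)%N; first by rewrite muln_gt0 M0.
move=> e'; rewrite inE => /orP[/eqP ->|/MP[j' j'M e'E]].
  exists (j * (M + M))%N; first by rewrite -mulnDl mulnC leq_mul2l jN orbT.
  rewrite eE /grid_time; congr (_ + _ * _); rewrite !(natrD, natrM).
  by field; rewrite !gt_eqF ?addr_gt0 ?mulr_gt0//.
exists (j' * N)%N; first by rewrite -mulnDl leq_mul2r j'M orbT.
rewrite e'E /grid_time; congr (_ + _ * _); rewrite !natrD !natrM.
by field; rewrite !gt_eqF ?addr_gt0 ?mulr_gt0//.
Qed.

End tent.

(** * The Cameron-Martin formula for Brownian bridges *)

Section bridge_values.
Context {R : realType} (k : nat) (a b : R) (x y : nat -> R).
Hypothesis ab : a < b.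

Local Notation paths := (curve_space (int_itv 1 k `*` `[a, b])).

Definition grid_bridge (N : nat) (f : nat * nat -> R) (i j : nat) : R :=
  let u := j%:R / N%:R in
  Num.sqrt (b - a) * (partial_sum f i j - u * partial_sum f i N) +
  (1 - u) * x i + u * y i.

Lemma partial_sum_increment d (T : measurableType d) (P : probability T R)
    (W : nat -> R -> {RV P >-> R}) N i j w : W i 0 w = 0 ->
  partial_sum (increment N W ^~ w) i j = W i (j%:R / N%:R) w.
Proof.
move=> W0; rewrite /partial_sum /increment/=.
rewrite (telescope_sumr (fun l => W i (l%:R / N%:R) w))//.
by rewrite mul0r W0 subr0.
Qed.

Lemma bridge_grid d (T : measurableType d) (P : probability T R)
    (W : nat -> R -> {RV P >-> R}) N i j w : W i 0 w = 0 -> (0 < N)%N ->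
  bridge a b (x i) (y i) (fun s => W i s w) (grid_time a b N j) =
  grid_bridge N (increment N W ^~ w) i j.
Proof.
move=> W0 N0; rewrite /bridge /grid_bridge !partial_sum_increment//.
have ba : b - a != 0 by rewrite subr_eq0 gt_eqF.
have N0' : N%:R != 0 :> R by rewrite pnatr_eq0 -lt0n.
have -> : (grid_time a b N j - a) / (b - a) = j%:R / N%:R.
  by rewrite /grid_time; field; rewrite ba N0'.
have -> : (b - grid_time a b N j) / (b - a) = 1 - j%:R / N%:R.
  by rewrite /grid_time; field; rewrite ba N0'.
by rewrite divff.
Qed.

Lemma measurable_grid_bridge N i j : (0 < i <= k)%N -> (j <= N)%N ->
  measurable_fun setT
    (fun f : g_sigma_algebraType (@rectangles R k N) => grid_bridge N f i j).
Proof.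
move=> ik jN.
have mS l : (l <= N)%N -> measurable_fun setT
    (fun f : g_sigma_algebraType (@rectangles R k N) => partial_sum f i l).
  elim: l => [_|l IHl lN]; rewrite /partial_sum.
    rewrite (_ : (fun _ => _) = cst 0)//.
    by apply/funext => f; rewrite big_geq.
  rewrite (_ : (fun _ => _) = (fun f : g_sigma_algebraType (@rectangles R k N) =>
      partial_sum f i l + f (i, l))); last first.
    by apply/funext => f; rewrite big_nat_recr.
  apply: measurable_funD; first exact: (IHl (ltnW lN)).
  by apply: (@measurable_grid R k N (i, l)); rewrite mem_grid ik lN.
apply: measurable_funD => //; apply: measurable_funD => //.
apply: measurable_funM => //; apply: measurable_funB; first exact: mS.
by apply: measurable_funM => //; exact: mS.
Qed.

Definition lower (c : R) (h : paths) : paths :=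
  curves_of _ _ (fun i t => curve h i t - (i == k)%:R * (c * tent a b t)).

Lemma lowerE c (h : paths) i t : int_itv 1 k i -> t \in `[a, b] ->
  curve (lower c h) i t = curve h i t - (i == k)%:R * (c * tent a b t).
Proof.
move=> ik tab; rewrite curves_ofE// => {}i {}ik; move=> s.
have cc : {within `[a, b], continuous (curve h i)} by exact: curve_continuous.
apply: cvgB; first exact: cc.
apply: cvgMr; apply: cvgMr.
by apply: continuous_subspaceT; exact: tent_continuous.
Qed.

Lemma measurable_lower c : measurable_fun setT (lower c).
Proof.
apply: (@measurable_curve_valued _ _ _ _ true (grid_times_sub ab)
  (grid_times_dense ab)) => i t ik /(grid_times_sub ab) tab.
rewrite (_ : (fun _ => _) = (fun h : paths =>
    curve h i t - (i == k)%:R * (c * tent a b t))); last first.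
  by apply/funext => h; rewrite lowerE.
by apply: measurable_funB => //; exact: measurable_curve.
Qed.

(** Lowering the bridge by a tent of height c amounts to shifting the increments
    of the driving motion by those of a tent; the bridge carries the factor
    sqrt (b - a), and the tent climbs to c in M steps, whence eta. *)
Lemma grid_bridge_tent c M (f : nat * nat -> R) i j : (0 < M)%N ->
  (j <= M + M)%N ->
  let eta := c / (Num.sqrt (b - a) * M%:R) in
  grid_bridge (M + M) (fun e => f e - tent_increments k M eta e) i j =
  grid_bridge (M + M) f i j -
    (i == k)%:R * (c * tent a b (grid_time a b (M + M) j)).
Proof.
move=> M0 jM eta.
have S0 : Num.sqrt (b - a) != 0 by rewrite gt_eqF// sqrtr_gt0 subr_gt0.
have M0' : M%:R != 0 :> R by rewrite pnatr_eq0 -lt0n.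
have MM0 : M%:R + M%:R != 0 :> R by rewrite -natrD pnatr_eq0 addn_eq0 andbb -lt0n.
have psB l : partial_sum (fun e => f e - tent_increments k M eta e) i l =
    partial_sum f i l - partial_sum (tent_increments k M eta) i l.
  by rewrite /partial_sum -sumrB.
rewrite /grid_bridge !psB (@partial_sum_tent_high _ k M eta i (M + M)) ?leq_addr//.
have [jM'|/ltnW Mj] := leqP j M.
  rewrite partial_sum_tent_low// tent_grid_low// /eta natrD.
  by field; rewrite ?MM0 ?M0' ?S0.
rewrite partial_sum_tent_high// tent_grid_high// /eta natrD.
by field; rewrite ?MM0 ?M0' ?S0.
Qed.

(** The density, with respect to the free law, of the law of the ensemble whose
    bottom curve is lowered by a tent of height c: the Cameron-Martin density,
    in which the stochastic integral of the slope of the tent reduces to the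
    distance from the midpoint value to the chord. *)
Definition cm_density (c : R) (h : paths) : R :=
  expR (- (2 * c * (curve h k ((a + b) / 2) - (x k + y k) / 2) + c ^+ 2)
        / ((b - a) / 2)).

Lemma measurable_cm_density c : measurable_fun setT (cm_density c).
Proof.
apply: measurableT_comp => //; apply: measurable_funM => //.
apply: measurableT_comp => //; apply: measurable_funD => //.
apply: measurable_funM => //; apply: measurable_funB => //.
exact: measurable_curve.
Qed.

(** Both sides are measures in E, so cylinders at grid times suffice. On these
    the curves are functions of finitely many increments, all on a common even
    grid, and the formula for Gaussian increments applies. Allowing two free
    laws makes uniqueness of the free law a special case. *)
Theorem free_cameron_martin (nu nu' : probability paths R) c : (0 < k)%N ->
  is_free_law x y nu -> is_free_law x y nu' -> forall E, measurable E ->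
  (\int[nu]_(h in E) (cm_density c h)%:E = nu' (lower c @^-1` E))%E.
Proof.
move=> k0 [d1 [T1 [P1 [W1 [B1 [bm1 ind1 B1E nu1E]]]]]].
move=> [d2 [T2 [P2 [W2 [B2 [bm2 ind2 B2E nu2E]]]]]].
have mD := measurable_cm_density c.
have D0 h : 0 <= cm_density c h by exact: expR_ge0.
pose m1 : {measure set _ -> \bar R} := tilt nu mD D0.
pose m2 : {measure set _ -> \bar R} := pushforward nu' (lower c).
have mL := measurable_lower c.
have m12 (l : seq (nat * R * R)) :
    (forall e, e \in l -> int_itv 1 k e.1.1 /\ grid_times a b e.1.2) ->
    m1 (cylinder false l) = m2 mL (cylinder false l).
  move=> lP; have [|M M0 MP] := @common_grid R a b l.
    by move=> e /lP[].
  set N := (M + M)%N in MP; have N0 : (0 < N)%N by rewrite addn_gt0 M0.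
  (* A grid index for each time that occurs in l. *)
  pose jj t := get [set j | (j <= N)%N /\ t = grid_time a b N j].
  have jjP e : e \in l -> (jj e.1.2 <= N)%N /\ e.1.2 = grid_time a b N (jj e.1.2).
    move=> /MP[j jN eE].
    by apply: (@getPex _ [set j | (j <= N)%N /\ e.1.2 = grid_time a b N j]); exists j.
  pose A : set (g_sigma_algebraType (@rectangles R k N)) :=
    [set f | forall e, e \in l -> grid_bridge N f e.1.1 (jj e.1.2) < e.2].
  have mA : measurable A.
    rewrite (_ : A = \bigcap_(e in [set` l])
       [set f | grid_bridge N f e.1.1 (jj e.1.2) < e.2]); last first.
      by apply/seteqP; split.
    rewrite bigcap_seq big_seq; apply: big_ind; [exact: measurableT| |].
      by move=> ? ? ? ?; exact: measurableI.
    move=> e el; have [ek _] := lP e el; have [jN _] := jjP e el.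
    by apply: measurable_set_lt => //; exact: measurable_grid_bridge.
  pose eta := c / (Num.sqrt (b - a) * M%:R).
  have W10 i w : int_itv 1 k i -> W1 i 0 w = 0 by move=> /bm1[].
  have W20 i w : int_itv 1 k i -> W2 i 0 w = 0 by move=> /bm2[].
  have := @increments_cameron_martin R k N _ _ T1 T2 P1 P2 W1 W2 (conj bm1 ind1)
    (conj bm2 ind2) N0 (tent_increments k M eta) A mA.
  have mcyl := @measurable_cylinder R (int_itv 1 k) `[a, b] false l.
  have gab e : e \in l -> e.1.2 \in `[a, b].
    by move=> /lP[_ /(grid_times_sub ab)].
  have -> : [set w | A (fun e => increment N W2 e w - tent_increments k M eta e)] =
      B2 @^-1` (lower c @^-1` cylinder false l).
    apply/seteqP; split=> w /= wl e el;
        have [ek _] := lP e el; have [jN eE] := jjP e el; have tab := gab e el.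
      rewrite lowerE// B2E// [in X in X - _]eE bridge_grid//; last exact: W20.
      by have := wl e el; rewrite grid_bridge_tent// -eE.
    have := wl e el.
    rewrite lowerE// B2E// [in X in X - _]eE bridge_grid//; last exact: W20.
    by rewrite grid_bridge_tent// -eE.
  rewrite /m2/= /pushforward nu2E; last first.
    by rewrite -[X in measurable X]setTI; exact: mL.
  move=> CM; apply: etrans CM.
  rewrite /m1/= /tilt.
  rewrite (@eq_measure_integral _ _ _ _ (distribution P1 B1)); last first.
    by move=> B mB _; exact: nu1E.
  rewrite ge0_integral_pushforward//=; last 2 first.
  - exact/measurable_EFinP/measurable_funTS.
  - by move=> h _; rewrite lee_fin.
  have -> : B1 @^-1` cylinder false l = increments k N W1 @^-1` A.
    have BE w e : e \in l -> curve (B1 w) e.1.1 e.1.2 =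
        grid_bridge N (increment N W1 ^~ w) e.1.1 (jj e.1.2).
      move=> el; have [ek _] := lP e el; have [jN eE] := jjP e el.
      rewrite B1E//; last exact: gab.
      by rewrite [in LHS]eE bridge_grid//; exact: W10.
    apply/seteqP; split=> w /= wl e el; first by rewrite -BE//; exact: wl.
    by rewrite BE//; exact: wl.
  apply: eq_integral => w _; congr EFin.
  rewrite shift_density_tent// /cm_density; congr expR.
  have kk : int_itv 1 k k by rewrite /int_itv/= k0 leqnn.
  have M0' : M%:R != 0 :> R by rewrite pnatr_eq0 -lt0n.
  have MM0 : M%:R + M%:R != 0 :> R by rewrite -natrD pnatr_eq0 -lt0n.
  have midE : (a + b) / 2 = grid_time a b N M.
    by rewrite /grid_time natrD; field; rewrite ?M0' ?MM0.
  have midab : (a + b) / 2 \in `[a, b] by rewrite in_itv/= !midf_le// ltW.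
  rewrite B1E// midE bridge_grid//; last exact: W10.
  rewrite /grid_bridge /eta.
  set S := Num.sqrt (b - a).
  have S0 : S != 0 by rewrite gt_eqF// sqrtr_gt0 subr_gt0.
  have -> : b - a = S ^+ 2 by rewrite sqr_sqrtr// subr_ge0 ltW.
  rewrite -/N (_ : N%:R = M%:R + M%:R); last by rewrite natrD.
  by field; rewrite ?M0' ?MM0 ?S0.
move=> E mE; suff : m1 E = m2 mL E by [].
apply: (@curve_measure_unique R (int_itv 1 k) (grid_times a b) `[a, b] false
  (grid_times_sub ab) (grid_times_dense ab) m1 (m2 mL)) => //.
have cyl0 : (cylinder false [::] : set paths) = setT by apply/seteqP; split.
have := m12 [::] (fun e (e0 : e \in [::]) => False_ind _ (notF e0)).
rewrite cyl0 => ->.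
by rewrite /m2 /= /pushforward preimage_setT probability_setT ltry.
Qed.

End bridge_values.

Lemma curve_ext {R : realType} (A : set (nat * R)) (h1 h2 : curve_space A) :
  (forall i t, A (i, t) -> curve h1 i t = curve h2 i t) -> h1 = h2.
Proof.
move=> h12; apply/continuousEP => -[[i t] Ait].
by rewrite -!curveE h12//; exact: set_mem Ait.
Qed.

Section free_law_unique.
Context {R : realType} (k : nat) (a b : R) (x y : nat -> R).
Hypothesis ab : a < b.

Lemma lower0 (h : curve_space (int_itv 1 k `*` `[a, b])) : lower 0 h = h.
Proof.
apply: curve_ext => i t [/= ik tab].
by rewrite lowerE// mul0r mulr0 subr0.
Qed.

(** The case c = 0 of the Cameron-Martin formula. *)
Lemma free_law_unique (nu nu' : probability (curve_space (int_itv 1 k `*` `[a, b])) R) :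
  (0 < k)%N -> is_free_law x y nu -> is_free_law x y nu' ->
  forall E, measurable E -> nu E = nu' E.
Proof.
move=> k0 fnu fnu' E mE; have := free_cameron_martin ab 0 k0 fnu fnu' mE.
rewrite (_ : lower 0 @^-1` E = E); last first.
  by apply/seteqP; split=> h; rewrite /= lower0.
move=> <-; rewrite -[LHS]mul1e -integral_cst//; apply: eq_integral => h _.
by rewrite /cm_density mulr0 mul0r expr0n/= addr0 oppr0 mul0r expR0.
Qed.

End free_law_unique.

(** * A uniform tail bound for Brownian bridges *)

Section standard_bridges.
Context {R : realType} (k : nat).
Hypothesis k0 : (0 < k)%N.

Local Notation paths := (curve_space (int_itv 1 k `*` `[0 : R, 1])).

Definition bounded_curves (M : R) : set paths :=
  [set h | forall i t, int_itv 1 k i -> t \in `[0, 1] -> `|curve h i t| <= M].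

Lemma measurable_bounded_curves M : measurable (bounded_curves M).
Proof.
rewrite (_ : bounded_curves M = \bigcap_(i in int_itv 1 k)
   [set h | forall t, t \in `[0, 1] -> `|curve h i t| <= M]); last first.
  by apply/seteqP; split=> [h hM i ik t|h hM i t ik]; exact: hM.
apply: bigcap_measurableType => i ik.
apply: (measurable_forall_le (u := fun h t => `|curve h i t|)) => //.
  move=> h t; apply: cvg_norm; exact: curve_continuous.
by move=> t _; apply: measurableT_comp => //; exact: measurable_curve.
Qed.

Section one_family.
Context {d : measure_display} {T : measurableType d} (P : probability T R).
Variable W : nat -> R -> {RV P >-> R}.
Hypothesis bmW : bm_family k W.

Definition bm_bounded (M : R) : set T := [set w | forall i u,
  int_itv 1 k i -> u \in `[0, 1] -> `|W i u w - u * W i 1 w| <= M].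

Let B0 (w : T) : paths := curves_of _ _ (fun i t => W i t w - t * W i 1 w).

Let B0_continuous w i : int_itv 1 k i ->
  {within `[0, 1], continuous (fun t => W i t w - t * W i 1 w)}.
Proof.
move=> /(bmW.1)[_ Wc _ _] t.
apply: cvgB; last by apply: cvgMl; exact: (continuous_subspaceT (fun _ => cvg_id)).
apply: (continuous_subspaceW _ (Wc w)) => u /=.
by rewrite !in_itv/= => /andP[->].
Qed.

Let B0E w i t : int_itv 1 k i -> t \in `[0, 1] ->
  curve (B0 w) i t = W i t w - t * W i 1 w.
Proof.
by move=> ik t01; rewrite curves_ofE// => j jk; exact: B0_continuous.
Qed.

Let B0_measurable : measurable_fun setT B0.
Proof.
apply: (@measurable_curve_valued _ _ _ _ true (grid_times_sub ltr01)
  (grid_times_dense ltr01)) => i t ik /(grid_times_sub ltr01) tab.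
rewrite (_ : (fun _ => _) = (fun w => W i t w - t * W i 1 w)); last first.
  by apply/funext => w; rewrite B0E.
by apply: measurable_funB; [|apply: measurable_funM => //]; exact: measurable_funPT.
Qed.

HB.instance Definition _ := isMeasurableFun.Build _ _ _ _ B0 B0_measurable.

Lemma standard_bridge_law :
  exists2 nu : probability paths R, is_free_law (cst 0) (cst 0) nu &
    forall M, P (bm_bounded M) = nu (bounded_curves M).
Proof.
exists (distribution P B0); last first.
  move=> M; rewrite /distribution /pushforward; congr (P _).
  apply/seteqP; split=> w wM i t ik t01.
    by rewrite B0E//; exact: wM.
  by rewrite -B0E//; exact: wM.
exists d, T, P, W, B0; have [bm ind] := bmW; split => //.
move=> w i t ik t01; rewrite B0E// /bridge.
by rewrite !(subr0, divr1, sqrtr1, mul1r, mulr0, addr0).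
Qed.

Lemma measurable_bm_bounded M : measurable (bm_bounded M).
Proof.
rewrite (_ : bm_bounded M = B0 @^-1` bounded_curves M).
  rewrite -[X in measurable X]setTI; apply: B0_measurable => //.
  exact: measurable_bounded_curves.
apply/seteqP; split=> w wM i t ik t01.
  by rewrite B0E//; exact: wM.
by rewrite -B0E//; exact: wM.
Qed.

End one_family.

Lemma bounded_curves_cover (h : paths) : exists n : nat, bounded_curves n%:R h.
Proof.
have H i : int_itv 1 k i -> exists M : R, forall t, t \in `[0, 1] -> `|curve h i t| <= M.
  move=> ik.
  have ch : {within `[0, 1], continuous (fun t : R => `|curve h i t|)}.
    by move=> t; apply: cvg_norm; exact: curve_continuous.
  have [c _ cmax] := EVT_max (@ler01 R) ch.
  by exists `|curve h i c| => t; exact: cmax.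
pose m i := get [set M : R | forall t, t \in `[0, 1] -> `|curve h i t| <= M].
have mP i t : int_itv 1 k i -> t \in `[0, 1] -> `|curve h i t| <= m i.
  by move=> ik; move: t; exact: (@getPex _ [set M : R | _]) (H i ik).
pose S := \sum_(1 <= i < k.+1) `|m i|.
exists (Num.truncn S).+1 => i t ik t01.
rewrite (le_trans (mP i t ik t01))// (le_trans (ler_norm _))//.
rewrite (@le_trans _ _ S)//; last by rewrite ltW// truncnS_gt.
rewrite /S (bigD1_seq i) ?iota_uniq//=; last by rewrite mem_index_iota ltnS.
by rewrite lerDl sumr_ge0.
Qed.

(** The bound M must not depend on the realization of the Brownian motions,
    because the avoiding laws met later, one for each boundary condition, are
    realized on different spaces. All realizations induce the same law on paths,
    so a bound that works for one works for all; if there is no realization,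
    there is nothing to bound. *)
Lemma bm_tail (eps : R) : 0 < eps -> exists2 M : R, 0 < M &
  forall d (T : measurableType d) (P : probability T R)
    (W : nat -> R -> {RV P >-> R}), bm_family k W ->
    ((1 - eps)%:E <= P (bm_bounded W M))%E.
Proof.
move=> eps0.
have [[nu fnu]|nofree] := pselect (exists nu : probability paths R,
  is_free_law (cst 0) (cst 0) nu); last first.
  exists 1 => // d T P W bmW; exfalso; apply: nofree.
  by have [nu fnu _] := standard_bridge_law bmW; exists nu.
have cv : nu (bounded_curves n%:R) @[n --> \oo] --> nu setT.
  have -> : setT = \bigcup_n (bounded_curves n%:R).
    apply/seteqP; split=> // h _.
    by have [n hn] := bounded_curves_cover h; exists n.
  apply: nondecreasing_cvg_mu.
  - by move=> n; exact: measurable_bounded_curves.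
  - by apply: bigcupT_measurable => n; exact: measurable_bounded_curves.
  - move=> m n mn; apply/subsetPset => h hm i t ik t01.
    by rewrite (le_trans (hm i t ik t01))// ler_nat.
rewrite probability_setT in cv.
have [n nP] : exists n, ((1 - eps)%:E < nu (bounded_curves n%:R))%E.
  apply: contrapT => /forallNP nN.
  have : (1 <= (1 - eps)%:E :> \bar R)%E.
    rewrite -(cvg_lim _ cv)//; apply: lime_le; first by apply/cvg_ex; exists 1%E.
    by apply: nearW => n; rewrite leNgt; exact/negP/nN.
  by rewrite lee_fin; lra.
exists (n%:R + 1); first by rewrite ltr_wpDl.
move=> d T P W bmW; have [nu' fnu' ->] := standard_bridge_law bmW.
rewrite -(free_law_unique ltr01 k0 fnu fnu'); last exact: measurable_bounded_curves.
rewrite (le_trans (ltW nP))//; apply: le_measure; rewrite ?inE.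
- exact: measurable_bounded_curves.
- exact: measurable_bounded_curves.
- by move=> h hn i t ik t01; rewrite (le_trans (hn i t ik t01))// lerDl.
Qed.

End standard_bridges.

(** * The observable that detects the next curve *)

Section observable.
Context {R : realType} (k : nat) (a b : R).
Implicit Types (phi : nat -> R -> R) (c lev eps K : R).

Definition ordered phi : Prop :=
  forall r : R, r \in `[a, b] -> forall i, (1 <= i < k)%N -> phi i.+1 r < phi i r.

(** Undoes the lowering of the bottom curve. *)
Definition lift_bottom c phi (i : nat) (r : R) : R :=
  phi i r + (i == k)%:R * (c * tent a b r).

Definition endpoint_mean phi : R := (phi k a + phi k b) / 2.

(** The bottom curve, which is near its endpoint mean on a short interval, is
    pushed just below both lev and that mean. The extra eps will dominate the
    fluctuations of the curve. *)
Definition drop_height lev eps phi : R :=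
  Num.max (endpoint_mean phi - lev) 0 + eps.

(** The Cameron-Martin density with the endpoint values read off the curve
    itself, so that it is a function of the ensemble alone. *)
Definition tilt_density c phi : R :=
  expR (- (2 * c * (phi k ((a + b) / 2) - endpoint_mean phi) + c ^+ 2)
        / ((b - a) / 2)).

(** The bound on the density keeps the observable bounded, as the Gibbs property
    demands. The second condition makes the ensemble the lowering of an ordered
    one. *)
Definition admissible c K phi : Prop :=
  tilt_density c phi <= K /\ ordered (lift_bottom c phi).

(** Integrated against bridges, the density replaces the ensemble by the one with
    its bottom curve lowered; the expectation then becomes the probability that
    the lowered curve still stays above the next curve. Yet the observable
    itself is a function of the top k curves only. *)
Definition observable lev eps K phi : R :=
  let c := drop_height lev eps phi in
  tilt_density c phi * `[< admissible c K phi >]%:R.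

Lemma observable_bound lev eps K phi : 0 <= K ->
  0 <= observable lev eps K phi <= K.
Proof.
move=> K0; rewrite /observable; case: asboolP => [[DK _]|_].
  by rewrite mulr1 expR_ge0.
by rewrite mulr0 lexx.
Qed.

(** The observable reads the curves 1, ..., k on [a, b] and nothing else, so it
    may be evaluated on the whole ensemble, on its top k curves, or on their
    restriction to [a, b]. *)
Lemma eq_observable lev eps K phi psi : a < b -> (0 < k)%N ->
  (forall i r, int_itv 1 k i -> r \in `[a, b] -> phi i r = psi i r) ->
  observable lev eps K phi = observable lev eps K psi.
Proof.
move=> ab k0 pp.
have kk : int_itv 1 k k by rewrite /int_itv/= k0 leqnn.
have aab : a \in `[a, b] by rewrite bound_itvE ltW.
have bab : b \in `[a, b] by rewrite bound_itvE ltW.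
have mab : (a + b) / 2 \in `[a, b] by rewrite in_itv/= !midf_le// ltW.
have mE : endpoint_mean phi = endpoint_mean psi.
  by rewrite /endpoint_mean !pp.
have cE : drop_height lev eps phi = drop_height lev eps psi.
  by rewrite /drop_height mE.
rewrite /observable cE; set c := drop_height _ _ _.
have DE : tilt_density c phi = tilt_density c psi.
  by rewrite /tilt_density mE pp.
rewrite DE; congr (_ * (_ : bool)%:R).
have H : admissible c K phi <-> admissible c K psi.
  have oE : ordered (lift_bottom c phi) <-> ordered (lift_bottom c psi).
    have lE i r : int_itv 1 k i -> r \in `[a, b] ->
        lift_bottom c phi i r = lift_bottom c psi i r.
      by move=> ik rab; rewrite /lift_bottom pp.
    split=> o r rab i /andP[i1 ik]; have := o r rab i; rewrite i1 ik => /(_ isT);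
      by rewrite !lE// /int_itv/= ?i1// ltnW.
  by rewrite /admissible DE oE.
by apply/asboolP/asboolP => /H.
Qed.

Section measurability.
Hypotheses (ab : a < b) (k0 : (0 < k)%N).
Local Notation paths := (curve_space (int_itv 1 k `*` `[a, b])).

Lemma measurable_ordered_lift (c : paths -> R) : measurable_fun setT c ->
  measurable [set h : paths | ordered (lift_bottom (c h) (curve h))].
Proof.
move=> mc; rewrite (_ : [set _ | _] = \bigcap_(i in [set i | (1 <= i < k)%N])
  [set h : paths | forall r, r \in `[a, b] ->
    lift_bottom (c h) (curve h) i.+1 r - lift_bottom (c h) (curve h) i r < 0]); last first.
  apply/seteqP; split=> h /= ho.
    by move=> i ik r rab; rewrite subr_lt0; exact: ho.
  by move=> r rab i ik; rewrite -subr_lt0; exact: ho.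
have ml i r : measurable_fun setT (fun h : paths => lift_bottom (c h) (curve h) i r).
  apply: measurable_funD; first exact: measurable_curve.
  by apply: measurable_funM => //; apply: measurable_funM.
have cl h i : int_itv 1 k i ->
    {within `[a, b], continuous (lift_bottom (c h) (curve (h : paths)) i)}.
  move=> ik; move=> t; apply: cvgD; first exact: curve_continuous.
  apply: cvgMr; apply: cvgMr.
  by apply: continuous_subspaceT; exact: tent_continuous.
apply: bigcap_measurableType => i /= /andP[i1 ik].
apply: (measurable_forall_lt (u := fun h r =>
   lift_bottom (c h) (curve h) i.+1 r - lift_bottom (c h) (curve h) i r)) => //.
  move=> h t; apply: cvgB; apply: cl; rewrite /int_itv/= ?i1 ?ik//.
  exact: ltnW.
by move=> r _; apply: measurable_funB.
Qed.

Lemma measurable_tilt_density (c : paths -> R) : measurable_fun setT c ->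
  measurable_fun setT (fun h : paths => tilt_density (c h) (curve h)).
Proof.
move=> mc.
apply: measurableT_comp => //; apply: measurable_funM => //.
apply: measurableT_comp => //; apply: measurable_funD; last exact: measurable_funX.
apply: measurable_funM; first exact: measurable_funM.
apply: measurable_funB; first exact: measurable_curve.
by apply: measurable_funM => //; apply: measurable_funD; exact: measurable_curve.
Qed.

Lemma measurable_admissible (c : paths -> R) K : measurable_fun setT c ->
  measurable [set h : paths | admissible (c h) K (curve h)].
Proof.
move=> mc; apply: (measurableI [set h : paths | tilt_density (c h) (curve h) <= K]).
  by apply: measurable_set_le => //; exact: measurable_tilt_density.
exact: measurable_ordered_lift.
Qed.

Lemma measurable_observable lev eps K :
  measurable_fun setT (fun h : paths => observable lev eps K (curve h)).
Proof.
pose c (h : paths) := drop_height lev eps (curve h).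
have mc : measurable_fun setT c.
  apply: measurable_funD => //; apply: measurable_maxr => //.
  apply: measurable_funB => //; apply: measurable_funM => //.
  by apply: measurable_funD; exact: measurable_curve.
pose S := [set h : paths | admissible (c h) K (curve h)].
rewrite (_ : (fun _ => _) = (fun h : paths =>
    tilt_density (c h) (curve h) * \1_S h)).
  apply: measurable_funM; first exact: measurable_tilt_density.
  by apply: measurable_indic; exact: measurable_admissible.
apply/funext => h; rewrite /observable indicE; congr (_ * (_ : bool)%:R).
Qed.

End measurability.

End observable.

(** * The observable under an avoiding law *)

Lemma bridge_ends {R : realType} (a b x y : R) (W : R -> R) : a < b ->
  W 0 = 0 -> bridge a b x y W a = x /\ bridge a b x y W b = y.
Proof.
move=> ab W0; have ba : b - a != 0 by rewrite subr_eq0 gt_eqF.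
rewrite /bridge !subrr !mul0r divff// W0 !(mul1r, mul0r, subrr, mulr0, add0r, addr0).
by [].
Qed.

Section avoiding_observable.
Context {R : realType} (k : nat) (a b : R) (x y : nat -> R) (g : R -> R).
Hypotheses (k0 : (0 < k)%N) (ab : a < b).
Hypothesis cg : {within `[a, b], continuous g}.

Local Notation paths := (curve_space (int_itv 1 k `*` `[a, b])).

Definition avoids (phi : nat -> R -> R) : Prop :=
  ordered k a b phi /\ forall r : R, r \in `[a, b] -> g r < phi k r.

Let A : set paths := [set h | avoids (curve h)].

Let avoid_eventE : @avoid_event R k a b (fun=> +oo%E) (EFin \o g) = A.
Proof.
apply/seteqP; split=> h.
  move=> hA; split=> r rab.
    by move=> i ik; have [_ + _] := hA r rab; exact.
  by have [_ _] := hA r rab; rewrite lte_fin.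
move=> [ho hg] r rab; split.
- exact: ltry.
- by move=> i ik; exact: ho.
- by rewrite lte_fin; exact: hg.
Qed.

Let measurable_A : measurable A.
Proof.
rewrite (_ : A = [set h : paths | ordered k a b (lift_bottom k a b 0 (curve h))] `&`
    [set h | forall r, r \in `[a, b] -> g r - curve h k r < 0]).
  apply: measurableI.
    have mc0 : measurable_fun setT (cst 0 : paths -> R) by exact: measurable_cst.
    exact: (measurable_ordered_lift ab mc0).
  apply: (measurable_forall_lt (u := fun (h : paths) r => g r - curve h k r)) => //.
    move=> h t; apply: cvgB; first exact: cg.
    by apply: curve_continuous; rewrite /int_itv/= k0 leqnn.
  by move=> r _; apply: measurable_funB => //; exact: measurable_curve.
have E h : lift_bottom k a b 0 (curve h) = curve (h : paths).
  by apply/funext => i; apply/funext => r; rewrite /lift_bottom mul0r mulr0 addr0.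
apply/seteqP; split=> h /= [ho hg]; split; rewrite ?E//; last 2 first.
- by rewrite E in ho.
- by move=> r rab; rewrite -subr_lt0; exact: hg.
- by move=> r rab; rewrite subr_lt0; exact: hg.
Qed.

Variables (lev eps K : R).
Hypothesis eps0 : 0 < eps.

Let c : R := Num.max ((x k + y k) / 2 - lev) 0 + eps.

Let G : set paths := [set h | tilt_density k a b c (curve h) <= K /\
  ordered k a b (lift_bottom k a b c (curve h))].

(** The avoiding law is the free law conditioned on D. Writing its expectation
    as a free one and applying the Cameron-Martin formula turns the density into
    a lowering of the bottom curve: N is the event that the lowered ensemble
    still avoids g and is admissible. *)
Lemma avoid_integral (Q : probability paths R) :
  is_avoid_law x y (fun=> +oo%E) (EFin \o g) Q ->
  exists (d : measure_display) (T : measurableType d) (P : probability T R)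
    (W : nat -> R -> {RV P >-> R}) (B : T -> paths),
  let N := [set w | avoids (curve (lower c (B w))) /\
                    admissible k a b c K (curve (lower c (B w)))] in
  let D := [set w | avoids (curve (B w))] in
  [/\ bm_family k W,
      forall w i t, int_itv 1 k i -> t \in `[a, b] ->
        curve (B w) i t = bridge a b (x i) (y i) (fun s => W i s w) t,
      measurable N /\ measurable D,
      (0 < P D)%E
    & (\int[Q]_h (observable k a b lev eps K (curve h))%:E =
       (fine (P N) / fine (P D))%:E)%E].
Proof.
move=> [_ [nu [fnu nuA0 QE]]]; rewrite avoid_eventE in nuA0 QE.
have [d [T [P [W [B [bm ind BE nuE]]]]]] := fnu.
exists d, T, P, W, B => N D.
have mB E : measurable E -> measurable (B @^-1` E).
  by move=> mE; rewrite -[X in measurable X]setTI; exact: measurable_funPT.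
have mD : measurable D by apply: (mB A).
have mG : measurable G.
  have mc : measurable_fun setT (cst c : paths -> R) by exact: measurable_cst.
  exact: (measurable_admissible ab K mc).
have mAG : measurable (lower c @^-1` (A `&` G)).
  have mL : measurable_fun setT (lower c : paths -> paths) by exact: measurable_lower.
  rewrite -[X in measurable X]setTI; apply: mL => //; exact: measurableI.
have mN : measurable N by exact: (mB (lower c @^-1` (A `&` G))).
split => //.
  by move: nuA0; rewrite nuE.
have F0 h : 0 <= observable k a b lev eps K (curve (h : paths)).
  by rewrite /observable mulr_ge0// expR_ge0.
have mF := @measurable_observable R k a b ab lev eps K.
(* The avoiding law has density r * \1_A with respect to the free law. *)
pose r := (fine (nu A))^-1.
have r0 : 0 <= r by rewrite invr_ge0 fine_ge0.
have mdist (f : paths -> R) : measurable_fun setT f -> (forall h, 0 <= f h) ->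
    (\int[nu]_h (f h)%:E = \int[P]_w (f (B w))%:E)%E.
  move=> mf f0; rewrite (@eq_measure_integral _ _ _ _ (distribution P B)); last first.
    by move=> E mE _; exact: nuE.
  rewrite ge0_integral_pushforward//=; first exact/measurable_EFinP.
  by move=> h _; rewrite lee_fin.
have mrA (E : set paths) : measurable E -> measurable_fun setT (fun h => r * \1_E h : R).
  by move=> mE; apply: measurable_funM => //; exact: measurable_indic.
have r10 (E : set paths) h : 0 <= r * \1_E h by rewrite mulr_ge0.
have QrA E : measurable E -> (\int[nu]_(h in setT `&` id @^-1` E) (r * \1_A h)%:E = Q E)%E.
  move=> mE; rewrite setTI QE//.
  under eq_integral do rewrite EFinM.
  rewrite preimage_id ge0_integralZl_EFin//; last first.
    exact/measurable_EFinP/measurable_funTS/measurable_indic.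
  rewrite integral_indic// -[X in (_ * X)%E]fineK; last first.
    by apply: fin_num_measure; exact: measurableI.
  by rewrite -EFinM mulrC setIC.
have := @ge0_integral_density _ _ _ _ R nu Q setT id (fun h => r * \1_A h)
  measurableT (@measurable_id _ _ _) (mrA A measurable_A) (r10 A) QrA
  (fun h => observable k a b lev eps K (curve h)) setT measurableT mF F0.
rewrite setTI preimage_setT => <-.
rewrite (mdist (fun h => observable k a b lev eps K (curve h) * (r * \1_A h))); last 2 first.
- by apply: measurable_funM => //; exact: mrA.
- by move=> h; rewrite mulr_ge0.
transitivity (\int[P]_w (cm_density x y c (B w) * (r * \1_(A `&` G) (B w)))%:E)%E.
  apply: eq_integral => w _; congr EFin.
  have kk : int_itv 1 k k by rewrite /int_itv/= k0 leqnn.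
  have W0 : W k 0 w = 0 by have [] := bm k kk.
  have [Ba Bb] := @bridge_ends R a b (x k) (y k) (fun s => W k s w) ab W0.
  have aab : a \in `[a, b] by rewrite bound_itvE ltW.
  have bab : b \in `[a, b] by rewrite bound_itvE ltW.
  have Ca : curve (B w) k a = x k by rewrite (BE w k a kk aab) Ba.
  have Cb : curve (B w) k b = y k by rewrite (BE w k b kk bab) Bb.
  have mE : endpoint_mean k a b (curve (B w)) = (x k + y k) / 2.
    by rewrite /endpoint_mean Ca Cb.
  have cE : drop_height k a b lev eps (curve (B w)) = c by rewrite /drop_height mE.
  have DE : tilt_density k a b c (curve (B w)) = cm_density x y c (B w).
    by rewrite /tilt_density /cm_density mE.
  rewrite /observable cE DE -mulrA; congr (_ * _).
  rewrite mulrCA; congr (_ * _).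
  by rewrite indicI /= mulrC; congr (_ * _); rewrite indicE.
rewrite -(mdist (fun h => cm_density x y c h * (r * \1_(A `&` G) h))); last 2 first.
- apply: measurable_funM; first exact: measurable_cm_density.
  by apply: mrA; exact: measurableI.
- by move=> h; rewrite mulr_ge0// expR_ge0.
transitivity (r%:E * \int[nu]_(h in A `&` G) (cm_density x y c h)%:E)%E.
  rewrite -ge0_integralZl_EFin//; last 3 first.
  - exact: measurableI.
  - by move=> h _; rewrite lee_fin expR_ge0.
  - by apply/measurable_EFinP/measurable_funTS; exact: measurable_cm_density.
  rewrite [RHS]integral_mkcond; apply: eq_integral => h _.
  rewrite /patch indicE; case: ifPn => _; last by rewrite !mulr0.
  by rewrite mulr1 mulrC.
rewrite (free_cameron_martin ab c k0 fnu fnu); last exact: measurableI.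
rewrite /r !nuE// -[X in (_ * X)%E]fineK ?fin_num_measure//.
by rewrite -EFinM mulrC.
Qed.

End avoiding_observable.

Section avoiding_probability.
Context {R : realType} (k : nat) (a b : R) (x y : nat -> R) (g : R -> R).
Hypotheses (k0 : (0 < k)%N) (ab : a < b).

Local Notation paths := (curve_space (int_itv 1 k `*` `[a, b])).
Variables (lev eps K : R).
Hypothesis eps0 : 0 < eps.

Let c : R := Num.max ((x k + y k) / 2 - lev) 0 + eps.

Let c0 : 0 <= c.
Proof. by rewrite addr_ge0 ?le_max ?lexx ?orbT// ltW. Qed.

Lemma lift_lower (h : paths) i r : int_itv 1 k i -> r \in `[a, b] ->
  lift_bottom k a b c (curve (lower c h)) i r = curve h i r.
Proof. by move=> ik rab; rewrite /lift_bottom lowerE// subrK. Qed.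

Lemma ordered_lift_lower (h : paths) :
  ordered k a b (lift_bottom k a b c (curve (lower c h))) <->
  ordered k a b (curve h).
Proof.
split=> o r rab i /andP[i1 ik]; have := o r rab i; rewrite i1 ik => /(_ isT);
  by rewrite !lift_lower// /int_itv/= ?i1// ltnW.
Qed.

(** Lowering the bottom curve can only violate its constraint from below, and
    admissibility says that the unlowered curves were ordered. Hence N is
    contained in D, and the conditional expectation lies in [0, 1] although the
    observable is far from bounded by 1. *)
Lemma lower_avoids (h : paths) : avoids k a b g (curve (lower c h)) ->
  admissible k a b c K (curve (lower c h)) -> avoids k a b g (curve h).
Proof.
move=> [_ hg] [_ /ordered_lift_lower ho]; split=> // r rab.
rewrite (lt_le_trans (hg r rab))// lowerE//; last by rewrite /int_itv/= k0 leqnn.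
rewrite gerBl mulr_ge0// mulr_ge0//.
by have /andP[] := tent_ge0 ab rab.
Qed.

(** The deviation of a bridge from its chord is sqrt (b - a) times a standard
    bridge. *)
Definition close_to_chord (M : R) (h : paths) : Prop :=
  forall i (t : R), int_itv 1 k i -> t \in `[a, b] ->
  `|curve h i t - ((b - t) / (b - a) * x i + (t - a) / (b - a) * y i)| <=
    Num.sqrt (b - a) * M.

(** The two extreme cases for the ratio of the probabilities of N and D. If all
    ensembles close to their chords are in N, then the ratio is at least p; if
    they are all in D but not in N, then the numerator is at most 1 - p and the
    denominator at least p. *)
Lemma avoid_value (Q : probability paths R) :
  {within `[a, b], continuous g} ->
  is_avoid_law x y (fun=> +oo%E) (EFin \o g) Q -> exists v : R, [/\
    (\int[Q]_h (observable k a b lev eps K (curve h))%:E = v%:E)%E,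
    0 <= v <= 1
  & forall (p M : R), 0 < p ->
      (forall d (T : measurableType d) (P : probability T R)
         (W : nat -> R -> {RV P >-> R}), bm_family k W ->
         (p%:E <= P (bm_bounded k W M))%E) ->
      ((forall h, close_to_chord M h -> avoids k a b g (curve (lower c h)) /\
                   admissible k a b c K (curve (lower c h))) -> p <= v) /\
      ((forall h, close_to_chord M h -> avoids k a b g (curve h) /\
                   ~ avoids k a b g (curve (lower c h))) -> v <= (1 - p) / p)].
Proof.
move=> cg QL.
have [d [T [P [W [B]]]]] := avoid_integral k0 ab cg lev eps K QL.
rewrite -/c; set N := [set w | _]; set D := [set w | _] => -[bmW BE [mN mD] D0 QE].
have ND : N `<=` D by move=> w [Nw1 Nw2]; exact: lower_avoids Nw2.
have PD0 : 0 < fine (P D) by rewrite fine_gt0// D0 (le_lt_trans (probability_le1 P mD)) ?ltry.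
have PND : fine (P N) <= fine (P D).
  by rewrite fine_le ?fin_num_measure// le_measure ?inE.
have PD1 : fine (P D) <= 1.
  by rewrite -lee_fin fineK ?fin_num_measure// probability_le1.
have PN0 : 0 <= fine (P N) by rewrite fine_ge0.
exists (fine (P N) / fine (P D)); split => //.
  by apply/andP; split; [rewrite divr_ge0// ltW|rewrite ler_pdivrMr// mul1r].
move=> p M p0 pP; have {}pP := pP d T P W bmW.
have mb : measurable (bm_bounded k W M) by exact: measurable_bm_bounded.
have pb : p <= fine (P (bm_bounded k W M)).
  by rewrite -lee_fin fineK ?fin_num_measure.
have closeB w : bm_bounded k W M w -> close_to_chord M (B w).
  move=> wM i t ik tab; rewrite BE// /bridge.
  set u := (t - a) / (b - a).
  rewrite (_ : _ - _ = Num.sqrt (b - a) * (W i u w - u * W i 1 w)); last by rewrite /u; ring.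
  rewrite normrM ger0_norm ?sqrtr_ge0// ler_wpM2l ?sqrtr_ge0//.
  apply: wM => //; move: tab; rewrite !in_itv/= => /andP[at_ tb].
  rewrite /u divr_ge0 ?subr_ge0// ?(ltW ab)//= ler_pdivrMr ?subr_gt0// mul1r.
  by rewrite lerD2r.
split=> H.
  have bN : bm_bounded k W M `<=` N by move=> w /closeB /H.
  rewrite (le_trans pb)// (@le_trans _ _ (fine (P N)))//.
    by rewrite fine_le ?fin_num_measure// le_measure ?inE.
  by rewrite ler_pdivlMr// ler_piMr.
have bD : bm_bounded k W M `<=` D by move=> w /closeB /H[].
have Nb : N `<=` ~` bm_bounded k W M by move=> w [Nw _] /closeB /H[_].
have pD : p <= fine (P D).
  by rewrite (le_trans pb)// fine_le ?fin_num_measure// le_measure ?inE.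
have N1 : fine (P N) <= 1 - p.
  have : (P N <= P (~` bm_bounded k W M))%E.
    by apply: le_measure; rewrite ?inE//; exact: measurableC.
  rewrite probability_setC// => PN.
  rewrite -lee_fin fineK ?fin_num_measure// (le_trans PN)//.
  by rewrite EFinB leeB.
rewrite ler_pdivrMr// (le_trans N1)//.
have p1 : 0 <= 1 - p by rewrite (le_trans PN0).
by rewrite mulrAC ler_pdivlMr// ler_wpM2l.
Qed.

End avoiding_probability.

(** * Limit as the interval shrinks to a point *)

(* Inequalities between real numbers used for paths on a short interval. There p
   and q are the values at s of curve k and of the next curve, m is the mean of
   the endpoints, h a value of the bottom curve and t a value of the tent. *)

Lemma chord_bound (R : realFieldType) (D u x y h l m : R) :
  0 <= u -> u <= 1 -> `|h - ((1 - u) * x + u * y)| <= m -> m <= D / 2 ->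
  `|x - l| <= D / 2 -> `|y - l| <= D / 2 -> `|h - l| <= D.
Proof.
move=> u0 u1; have v0 : 0 <= 1 - u by rewrite subr_ge0.
rewrite !ler_norml => /andP[h1 h2] mD /andP[x1 x2] /andP[y1 y2].
have := ler_wpM2l v0 x1; have := ler_wpM2l v0 x2.
have := ler_wpM2l u0 y1; have := ler_wpM2l u0 y2.
by move=> ? ? ? ?; apply/andP; split; lra.
Qed.

Lemma gap_lt (R : realFieldType) (D p q u v : R) :
  q + 8 * D <= p -> `|u - p| <= D -> `|v - q| <= D -> 0 < D -> v < u.
Proof. by rewrite !ler_norml => ? /andP[? ?] /andP[? ?] ?; lra. Qed.

Lemma mean_bound (R : realFieldType) (D x y l : R) :
  `|x - l| <= D -> `|y - l| <= D -> `|(x + y) / 2 - l| <= D.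
Proof.
rewrite !ler_norml => /andP[? ?] /andP[? ?]; apply/andP; split; lra.
Qed.

Lemma drop_fails (R : realFieldType) (lev l h m d e : R) :
  lev <= l -> `|h - m| <= d -> d < e -> h - (Num.max (m - lev) 0 + e) <= l - 0.
Proof.
rewrite ler_norml => ? /andP[_ ?] ?.
have : m - lev <= Num.max (m - lev) 0 by rewrite le_max lexx.
by move=> ?; lra.
Qed.

Lemma drop_succeeds (R : realFieldType) (lev p q h m g D e t : R) :
  q + 8 * D <= p -> q + 8 * D <= lev -> 0 < D -> 0 < e -> e <= D -> 0 <= t <= 1 ->
  `|h - p| <= D -> `|m - p| <= D -> `|g - q| <= D ->
  g < h - (Num.max (m - lev) 0 + e) * t.
Proof.
rewrite !ler_norml => qp ql D0 e0 eD /andP[t0 t1].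
move=> /andP[h1 h2] /andP[m1 m2] /andP[g1 g2].
have c0 : 0 <= Num.max (m - lev) 0 + e by rewrite addr_ge0 ?le_max ?lexx ?orbT// ltW.
have : (Num.max (m - lev) 0 + e) * t <= Num.max (m - lev) 0 + e by rewrite ler_piMr.
have [ml|ml] := leP (m - lev) 0; lra.
Qed.

Lemma tilt_exponent_bound (R : realFieldType) (rho c C z D : R) :
  0 < rho -> 0 <= c <= C -> 0 <= D -> `|z| <= D ->
  rho * (C ^+ 2 + 2 * C * D) <= 1 ->
  - (2 * c * (z - c) + c ^+ 2) / rho <= rho^-1 ^+ 2.
Proof.
move=> rho0 /andP[c0 cC] D0; rewrite ler_norml => /andP[z1 z2] H.
have C0 : 0 <= C by exact: le_trans cC.
have c2 : c ^+ 2 <= C ^+ 2 by rewrite ler_sqr ?nnegrE.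
have cz : c * - z <= C * D.
  by apply: (le_trans (ler_wpM2l c0 (_ : - z <= D))); [lra|rewrite ler_wpM2r].
rewrite ler_pdivrMr// (_ : rho^-1 ^+ 2 * rho = rho^-1); last by field; rewrite gt_eqF.
rewrite -[leRHS]mul1r ler_pdivlMr// mulrC (le_trans _ H)// ler_wpM2l ?(ltW rho0)//.
have E : - (2 * c * (z - c) + c ^+ 2) = c ^+ 2 + 2 * (c * - z) by ring.
by rewrite E; nra.
Qed.

Lemma mean_dist (R : realFieldType) (h ha hb x y d D : R) :
  `|h - (x + y) / 2| <= d -> `|ha - x| <= d -> `|hb - y| <= d -> d <= D / 2 ->
  `|h - (ha + hb) / 2| <= D.
Proof.
rewrite !ler_norml => /andP[? ?] /andP[? ?] /andP[? ?] ?.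
by apply/andP; split; lra.
Qed.

Lemma drop_height_bound (R : realFieldType) (m p lev d D e : R) :
  `|m - p| <= d -> d <= D -> e <= D ->
  Num.max (m - lev) 0 + e <= `|p| + `|lev| + 2 * D.
Proof.
move=> mp dD eD.
have m0 : 0 <= `|p| + `|lev| + D.
  by rewrite !addr_ge0// (le_trans _ dD)// (le_trans _ mp).
have : Num.max (m - lev) 0 <= `|p| + `|lev| + D.
  rewrite ge_max m0 andbT.
  have := ler_norm (m - p); have := ler_norm p; have := ler_norm (- lev).
  by rewrite normrN => ? ? ?; lra.
by move=> ?; lra.
Qed.

Section shrinking_interval.
Context {R : realType} (k : nat) (l : nat -> R -> R) (s lev : R).
Hypothesis k0 : (0 < k)%N.
Hypothesis l_cont : forall i eta, int_itv 1 k.+1 i -> 0 < eta ->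
  exists2 delta, 0 < delta & forall t : R, `|s - t| < delta -> `|l i t - l i s| < eta.
Hypothesis l_ordered : forall i, int_itv 1 k i -> l i.+1 s < l i s.

Implicit Types e : R.

(** The interval around s has length e ^ 4, so that bridges on it fluctuate by a
    multiple of e ^ 2, which is negligible with respect to the margin e used in
    the drop height. *)
Definition half_width e : R := e ^+ 4 / 2.
(** On typical paths the logarithm of the density is of order 1 / half_width e,
    so this cap is eventually larger. *)
Definition density_cap e : R := expR ((half_width e)^-1 ^+ 2).

Lemma uniform_modulus eta : 0 < eta -> exists2 delta, 0 < delta &
  forall i (t : R), int_itv 1 k.+1 i -> `|s - t| < delta -> `|l i t - l i s| < eta.
Proof.
move=> eta0.
suff H n : (n <= k.+1)%N -> exists2 delta, 0 < delta &
    forall i (t : R), int_itv 1 n i -> `|s - t| < delta -> `|l i t - l i s| < eta.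
  exact: H.
elim: n => [_|n IHn nk].
  by exists 1 => // i t /andP[i1 i0]; move: (leq_trans i1 i0).
have [d1 d10 P1] := IHn (ltnW nk).
have [|d2 d20 P2] := @l_cont n.+1 eta _ eta0; first by rewrite /int_itv/= nk.
exists (Num.min d1 d2); first by rewrite lt_min d10.
move=> i t /andP[i1]; rewrite leq_eqVlt lt_min => /orP[/eqP ->|].
  by move=> /andP[_ ?]; exact: P2.
by move=> i_n /andP[? _]; apply: P1 => //; rewrite /int_itv/= i1 -ltnS.
Qed.

Lemma uniform_gap : exists2 gap, 0 < gap &
  forall i, int_itv 1 k i -> l i.+1 s + gap <= l i s.
Proof.
suff H n : (n <= k)%N -> exists2 gap, 0 < gap &
    forall i, int_itv 1 n i -> l i.+1 s + gap <= l i s.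
  exact: H.
elim: n => [_|n IHn nk].
  by exists 1 => // i /andP[i1 i0]; move: (leq_trans i1 i0).
have [d1 d10 P1] := IHn (ltnW nk).
have lo : l n.+2 s < l n.+1 s by apply: l_ordered; rewrite /int_itv/= nk.
exists (Num.min d1 (l n.+1 s - l n.+2 s)); first by rewrite lt_min d10 subr_gt0.
move=> i /andP[i1]; rewrite leq_eqVlt => /orP[/eqP ->|i_n].
  by rewrite addrC -lerBrDr ge_min lexx orbT.
rewrite (@le_trans _ _ (l i.+1 s + d1))//; first by rewrite lerD2l ge_min lexx.
by apply: P1; rewrite /int_itv/= i1 -ltnS.
Qed.

Section one_interval.
(* Delta is a fraction of the gaps between the curves at s; on the interval the
   curves vary by at most Delta / 2, and a bridge deviates from its chord by at
   most e ^ 2 * M, which is below both Delta / 2 and e. *)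
Variables (e M Delta : R).
Hypotheses (e0 : 0 < e) (M0 : 0 < M) (Delta0 : 0 < Delta).
Let rho := half_width e.
Let a := s - rho.
Let b := s + rho.
Local Notation paths := (curve_space (int_itv 1 k `*` `[a, b])).

Hypothesis gapP : forall i, int_itv 1 k i -> l i.+1 s + 8 * Delta <= l i s.
Hypothesis near_s : forall i (t : R), int_itv 1 k.+1 i -> t \in `[a, b] ->
  `|l i t - l i s| <= Delta / 2.
Hypothesis eM : e ^+ 2 * M <= Delta / 2.
Hypothesis eM1 : e ^+ 2 * M < e.
Hypothesis eDelta : e <= Delta.

(* C bounds the drop height. *)
Let C : R := `|l k s| + `|lev| + 2 * Delta.
Hypothesis rhoC : rho * (C ^+ 2 + 2 * C * Delta) <= 1.

Let rho0 : 0 < rho.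
Proof. by rewrite divr_gt0// exprn_gt0. Qed.

Lemma interval_ab : a < b.
Proof. by rewrite /a /b ltrD2l gtrN. Qed.

Let x i := l i a.
Let y i := l i b.
Let c : R := Num.max ((x k + y k) / 2 - lev) 0 + e.

Let sab : s \in `[a, b].
Proof. by rewrite in_itv/= /a /b lerDl gerBl ltW. Qed.

Let aab : a \in `[a, b]. Proof. by rewrite bound_itvE ltW ?interval_ab. Qed.
Let bab : b \in `[a, b]. Proof. by rewrite bound_itvE ltW ?interval_ab. Qed.

Let sqrt_ba : Num.sqrt (b - a) = e ^+ 2.
Proof.
rewrite (_ : b - a = (e ^+ 2) ^+ 2); first by rewrite sqrtr_sqr ger0_norm ?sqr_ge0.
by rewrite /b /a /rho /half_width; field.
Qed.

Let midE : (a + b) / 2 = s.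
Proof. by rewrite /a /b; field. Qed.

Let close_near (h : paths) : close_to_chord x y M h ->
  forall i (t : R), int_itv 1 k i -> t \in `[a, b] -> `|curve h i t - l i s| <= Delta.
Proof.
move=> hM i t ik tab; have := hM i t ik tab; rewrite sqrt_ba => H.
have ik1 : int_itv 1 k.+1 i by move: ik => /andP[i1 ik]; rewrite /int_itv/= i1 leqW.
have xn := near_s ik1 aab; have yn := near_s ik1 bab.
move: tab; rewrite in_itv/= => /andP[at_ tb].
have ba0 : 0 < b - a by rewrite subr_gt0 interval_ab.
set u : R := (t - a) / (b - a) in H.
have uE : (b - t) / (b - a) = 1 - u by rewrite /u; field; rewrite gt_eqF.
have u0 : 0 <= u by rewrite /u divr_ge0 ?subr_ge0// ltW// interval_ab.
have u1 : u <= 1 by rewrite /u ler_pdivrMr// mul1r lerD2r.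
rewrite uE in H.
exact: chord_bound u0 u1 H eM xn yn.
Qed.

Lemma close_avoids (h : paths) : close_to_chord x y M h ->
  avoids k a b (l k.+1) (curve h).
Proof.
move=> hM; have H := close_near hM; split=> r rab.
  move=> i /andP[i1 ik].
  have ki : int_itv 1 k i by rewrite /int_itv/= i1 ltnW.
  exact: gap_lt (gapP ki) (H i r ki rab) (H i.+1 r ik rab) Delta0.
have kk : int_itv 1 k k by rewrite /int_itv/= k0 leqnn.
have kk1 : int_itv 1 k.+1 k.+1 by rewrite /int_itv/= leqnn.
have half : Delta / 2 <= Delta by rewrite ler_pdivrMr// ler_pMr// ler1n.
exact: gap_lt (gapP kk) (H k r kk rab) (le_trans (near_s kk1 rab) half) Delta0.
Qed.

Let mean_near : `|(x k + y k) / 2 - l k s| <= Delta / 2.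
Proof.
have kk : int_itv 1 k.+1 k by rewrite /int_itv/= k0 leqW.
exact: mean_bound (near_s kk aab) (near_s kk bab).
Qed.

Let close_mean (h : paths) : close_to_chord x y M h ->
  `|curve h k s - (x k + y k) / 2| <= e ^+ 2 * M.
Proof.
have kk : int_itv 1 k k by rewrite /int_itv/= k0 leqnn.
move=> /(_ k s kk sab); rewrite sqrt_ba.
have ba0 : b - a != 0 by rewrite subr_eq0 gt_eqF// interval_ab.
have bs : b - s = (b - a) / 2 by rewrite /b /a; field.
have sa : s - a = (b - a) / 2 by rewrite /b /a; field.
rewrite bs sa (_ : (b - a) / 2 / (b - a) = 1 / 2); last by field.
by rewrite (_ : 1 / 2 * x k + 1 / 2 * y k = (x k + y k) / 2)//; field.
Qed.

(** The next curve is below lev and below curve k, by a margin: there is room for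
    the bottom curve to be lowered to just below the smaller of lev and its
    mean. *)
Lemma close_lower_admissible (h : paths) : l k.+1 s + 8 * Delta <= lev ->
  close_to_chord x y M h ->
  avoids k a b (l k.+1) (curve (lower c h)) /\
  admissible k a b c (density_cap e) (curve (lower c h)).
Proof.
move=> levl hM.
have kk : int_itv 1 k k by rewrite /int_itv/= k0 leqnn.
have kk1 : int_itv 1 k.+1 k.+1 by rewrite /int_itv/= leqnn.
have half : Delta / 2 <= Delta by rewrite ler_pdivrMr// ler_pMr// ler1n.
have iab := interval_ab.
have [ho hg] := close_avoids hM.
have c0 : 0 <= c by rewrite addr_ge0 ?le_max ?lexx ?orbT// ltW.
split; last first.
  split; last by exact: (ordered_lift_lower x y lev e h).2.
  have endE r : r \in `[a, b] -> tent a b r = 0 -> curve (lower c h) k r = curve h k r.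
    by move=> rab t0; rewrite lowerE// t0 !mulr0 subr0.
  have [ta tb] := tent_end iab.
  rewrite /tilt_density /density_cap ler_expR midE.
  rewrite (_ : endpoint_mean k a b (curve (lower c h)) =
               endpoint_mean k a b (curve h)); last first.
    by rewrite /endpoint_mean !endE.
  have kab : s \in `[a, b] by [].
  have hs : curve (lower c h) k s = curve h k s - c.
    by rewrite lowerE// eqxx mul1r -midE tent_mid mulr1.
  have ba2 : (b - a) / 2 = rho by rewrite /b /a; field.
  rewrite hs ba2.
  have ba0 : b - a != 0 by rewrite subr_eq0 gt_eqF.
  have ha : `|curve h k a - x k| <= e ^+ 2 * M.
    have := hM k a kk aab.
    by rewrite sqrt_ba subrr mul0r mul0r addr0 divff// mul1r.
  have hb : `|curve h k b - y k| <= e ^+ 2 * M.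
    have := hM k b kk bab.
    by rewrite sqrt_ba subrr mul0r mul0r add0r divff// mul1r.
  rewrite (_ : _ - c - _ = curve h k s - endpoint_mean k a b (curve h) - c); last by ring.
  apply: (@tilt_exponent_bound _ rho c C _ Delta) => //; last 2 first.
  - exact: ltW.
  - exact: mean_dist (close_mean hM) ha hb eM.
  rewrite c0/=; apply: drop_height_bound mean_near half eDelta.
split; last first.
  move=> r rab; rewrite lowerE// eqxx mul1r.
  apply: (@drop_succeeds _ lev (l k s) (l k.+1 s) _ _ _ Delta) => //.
  - exact: gapP.
  - exact: tent_ge0.
  - exact: close_near.
  - exact: le_trans mean_near half.
  - exact: le_trans (near_s kk1 rab) half.
move=> r rab i /andP[i1 ik].
have ki : int_itv 1 k i by rewrite /int_itv/= i1 ltnW.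
rewrite !lowerE//.
rewrite (ltn_eqF ik) mul0r subr0 (le_lt_trans _ (ho r rab i _)) ?i1//.
rewrite gerBl mulr_ge0// mulr_ge0//.
by have /andP[] := tent_ge0 iab rab.
Qed.

(** At the midpoint s the lowered curve is at most lev - e plus a fluctuation
    smaller than e, hence strictly below lev. The margin e also covers the case of
    equality in the hypothesis, where no gap is available. *)
Lemma close_lower_fails (h : paths) : lev <= l k.+1 s ->
  close_to_chord x y M h ->
  avoids k a b (l k.+1) (curve h) /\
  ~ avoids k a b (l k.+1) (curve (lower c h)).
Proof.
move=> levl hM; split; first exact: close_avoids.
have kk : int_itv 1 k k by rewrite /int_itv/= k0 leqnn.
move=> [_ /(_ s sab)]; rewrite lowerE ?interval_ab// eqxx mul1r.
have -> : tent a b s = 1 by rewrite -midE tent_mid.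
apply/negP; rewrite -leNgt mulr1 -[leRHS]subr0.
exact: drop_fails levl (close_mean hM) eM1.
Qed.

End one_interval.

(** The expectation of the observable under the avoiding law tells whether the
    lower boundary curve is below lev at s. Here l is a fixed realization of all
    the curves, which provides the boundary data of the avoiding laws on the
    intervals shrinking to s. *)
Lemma observable_limit eps : 0 < eps -> exists2 eta, 0 < eta &
  forall e, 0 < e -> e <= eta ->
  let a := s - half_width e in let b := s + half_width e in
  forall Q : probability (curve_space (int_itv 1 k `*` `[a, b])) R,
  {within `[a, b], continuous (l k.+1)} ->
  is_avoid_law (l^~ a) (l^~ b) (fun=> +oo%E) (EFin \o l k.+1) Q ->
  exists2 v : R,
    (\int[Q]_h (observable k a b lev e (density_cap e) (curve h))%:E = v%:E)%E
    & `|v - (l k.+1 s < lev)%R%:R| <= eps.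
Proof.
(* With probability p = 1 - eps1 of good paths, (1 - p) / p <= 2 * eps1 <= eps. *)
move=> eps0; pose eps1 := Num.min (eps / 2) (1 / 2).
have eps10 : 0 < eps1 by rewrite lt_min !divr_gt0.
have [e1 e2] : eps1 <= eps / 2 /\ eps1 <= 1 / 2.
  by split; rewrite ge_min lexx ?orbT.
have [M M0 MP] := bm_tail k0 eps10.
have [gap gap0 gapP] := uniform_gap.
(* The distance from the next curve to lev matters only when it is positive. *)
pose gap' := if l k.+1 s < lev then lev - l k.+1 s else 1.
have gap'0 : 0 < gap' by rewrite /gap'; case: ifPn => //; rewrite subr_gt0.
pose Delta := Num.min (gap / 8) (gap' / 8).
have Delta0 : 0 < Delta by rewrite lt_min !divr_gt0.
have [D1 D2] : Delta <= gap / 8 /\ Delta <= gap' / 8.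
  by split; rewrite ge_min lexx ?orbT.
have Dh0 : 0 < Delta / 2 by rewrite divr_gt0.
have [delta delta0 deltaP] := uniform_modulus Dh0.
pose C : R := `|l k s| + `|lev| + 2 * Delta.
pose B : R := C ^+ 2 + 2 * C * Delta.
have C0 : 0 <= C by rewrite !addr_ge0// mulr_ge0// ltW.
have B0 : 0 <= B by rewrite addr_ge0 ?exprn_ge0// !mulr_ge0// ltW.
exists (Num.min 1 (Num.min Delta (Num.min ((2 * M)^-1) (Num.min delta (B + 1)^-1)))).
  rewrite lt_min ltr01/= lt_min Delta0/= lt_min invr_gt0 mulr_gt0//=.
  by rewrite lt_min delta0/= invr_gt0 ltr_wpDl.
move=> e e0; rewrite le_min => /andP[eone]; rewrite le_min => /andP[eD].
rewrite le_min => /andP[eM]; rewrite le_min => /andP[ed eB] a b Q cg QL.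
have rho_e : half_width e <= e / 2.
  rewrite /half_width ler_pM2r// exprS ler_piMr ?(ltW e0)//.
  by rewrite exprn_ile1// ltW.
have eM2 : e * M <= 1 / 2.
  by rewrite -(ler_pM2r (_ : 0 < 2 * M)) ?mulr_gt0// mulVf ?gt_eqF ?mulr_gt0// in eM; lra.
have eeM : e ^+ 2 * M <= e / 2.
  by rewrite expr2 -mulrA ler_pM2l// (le_trans eM2)// div1r.
have Hgap i : int_itv 1 k i -> l i.+1 s + 8 * Delta <= l i s.
  by move=> /gapP; apply: le_trans; rewrite lerD2l; lra.
have Hnear i (t : R) : int_itv 1 k.+1 i -> t \in `[a, b] -> `|l i t - l i s| <= Delta / 2.
  move=> ik; rewrite in_itv/= /a /b => /andP[at_ tb]; apply/ltW/deltaP => //.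
  by rewrite ltr_distlC; apply/andP; split; lra.
have HeM : e ^+ 2 * M <= Delta / 2 by lra.
have HeM1 : e ^+ 2 * M < e by lra.
have HB : half_width e * B <= 1.
  have : e * (B + 1) <= 1.
    by rewrite -(ler_pM2r (_ : 0 < B + 1)) ?ltr_wpDl// mulVf ?gt_eqF ?ltr_wpDl// in eB.
  have : half_width e * B <= e / 2 * B by rewrite ler_wpM2r.
  have : 0 <= e * B by rewrite mulr_ge0// ltW.
  lra.
have ab : a < b by exact: interval_ab.
have [v [vE v01 vP]] := @avoid_value R k a b (l^~ a) (l^~ b) (l k.+1) k0 ab lev e
  (density_cap e) e0 Q cg QL.
exists v => //.
have p0 : 0 < 1 - eps1 by lra.
have [vlow vup] := vP (1 - eps1) M p0 MP.
move: v01 => /andP[v0 v1].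
case: (ltP (l k.+1 s) lev) => ll.
  have : 1 - eps1 <= v.
    apply: vlow => h hM; apply: (@close_lower_admissible e M Delta) => //.
    by move: D2; rewrite /gap' ll; lra.
  by move=> ?; rewrite /= mulr1n ler_norml; apply/andP; split; lra.
have : v <= (1 - (1 - eps1)) / (1 - eps1).
  by apply: vup => h hM; exact: (@close_lower_fails e M Delta).
rewrite ler_pdivlMr// mulr0n subr0 ger0_norm// => ?.
nra.
Qed.

End shrinking_interval.

(** * Consequences of the Gibbs property *)

Lemma curve_restrict {R : realType} (A B : set (nat * R)) (BA : B `<=` A)
    (h : curve_space A) i t : B (i, t) ->
  curve (restrict_curves BA h) i t = curve h i t.
Proof.
move=> Bit; have Ait := BA _ Bit.
rewrite (curveE _ (mem_set Bit)) (curveE _ (mem_set Ait)).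
rewrite /restrict_curves /pullback /=; congr (h _).
exact: val_inj.
Qed.

Lemma curve_reindex {R : realType} (k : nat) (I : set R)
    (q : curve_space (int_itv 1 (k - 1).+1 `*` I)) i t : (0 < k)%N ->
  int_itv 1 k i -> I t -> curve (reindex_curves q) i t = curve q i t.
Proof.
move=> k0 ik It.
have Bit : (int_itv 1 k `*` I) (i, t) by [].
have Ait : (int_itv 1 (k - 1).+1 `*` I) (i, t).
  by split => //; rewrite /int_itv/= subn1 prednK.
rewrite (curveE _ (mem_set Bit)) (curveE _ (mem_set Ait)).
rewrite /reindex_curves /pullback /=; congr (q _).
by apply: val_inj => /=; rewrite /shift_index/= subn1.
Qed.

Section one_ensemble.
Context {R : realType} (N : option nat) (Lam : set R).
Context {d : measure_display} {T : measurableType d} {P : probability T R}.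
Variable L : {RV P >-> curve_space (index_set N `*` Lam)}.
Hypothesis gibbs : partial_brownian_gibbs L.

Definition below (l : seq (nat * R * R)) : set T :=
  [set w | forall e, e \in l -> curve (L w) e.1.1 e.1.2 < e.2].

Lemma measurable_curve_RV i t : measurable_fun setT (fun w => curve (L w) i t).
Proof. exact: (measurableT_comp (measurable_curve i t) (measurable_funPT L)). Qed.

Lemma measurable_below l : measurable (below l).
Proof.
rewrite (_ : below l = \bigcap_(e in [set` l]) [set w | curve (L w) e.1.1 e.1.2 < e.2]).
  rewrite bigcap_seq; apply: big_ind; [exact: measurableT| |].
    by move=> ? ? ? ?; exact: measurableI.
  by move=> e _; apply: measurable_set_lt => //; exact: measurable_curve_RV.
by apply/seteqP; split.
Qed.

(** Conditions on the curves below the k-th one are external at all times, and so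
    are conditions on the others at times outside the interval. *)
Lemma ext_sigma_below k a b l :
  (forall e, e \in l -> [/\ index_set N e.1.1, Lam e.1.2 &
     int_itv 1 k e.1.1 -> ~ (e.1.2 \in `]a, b[)]) ->
  ext_sigma L 1 k a b (below l).
Proof.
move=> lP; rewrite /ext_sigma /sigma_generated.
pose X (p : nat * R) (w : T) : R := curve (L w) p.1 p.2.
set D := _ `\` _; rewrite -/X.
rewrite (_ : below l = \bigcap_(e in [set` l]) (X e.1 @^-1` `]-oo, e.2[)); last first.
  apply/seteqP; split=> w wl e el; have := wl e el;
    by rewrite /X /= in_itv.
pose S := g_sigma_algebraType (\bigcup_(j in D) preimage_set_system setT (X j) measurable).
suff : measurable (\bigcap_(e in [set` l]) (X e.1 @^-1` `]-oo, e.2[) : set S) by [].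
rewrite bigcap_seq big_seq; apply: big_ind; [exact: measurableT| |].
  by move=> ? ? ? ?; exact: measurableI.
move=> e el; apply: sub_sigma_algebra; exists e.1.
  have [Ne Le H] := lP e el; split; first by split.
  by move=> [ek eab]; exact: (H ek).
by exists `]-oo, e.2[%classic => //; rewrite setTI.
Qed.

Lemma ext_sigma_measurable k a b E : ext_sigma L 1 k a b E -> measurable E.
Proof.
apply: smallest_sub; first exact: sigma_algebra_measurable.
move=> _ [j _ [B mB <-]]; exact: measurable_curve_RV.
Qed.

Definition obs_on (k : nat) (s lev e : R) (phi : nat -> R -> R) : R :=
  observable k (s - half_width e) (s + half_width e) lev e (density_cap e) phi.

Lemma half_width_gt0 (e : R) : 0 < e -> 0 < half_width e.
Proof. by move=> e0; rewrite divr_gt0// exprn_gt0. Qed.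

(** The Gibbs property for the top k curves and the observable, with its
    restriction and reindexing maps eliminated. *)
Lemma gibbs_version (k : nat) (s lev e : R) :
  let a := s - half_width e in let b := s + half_width e in
  (0 < k)%N -> index_set N k.+1 -> 0 < e -> `[a, b] `<=` Lam ->
  exists2 Y : T -> R,
    measurable_fun setT Y /\ (forall E, ext_sigma L 1 k a b E ->
      (\int[P]_(w in E) (Y w)%:E =
       \int[P]_(w in E) (obs_on k s lev e (curve (L w)))%:E)%E)
  & {ae P, forall w,
      exists2 Q : probability (curve_space (int_itv 1 (k - 1).+1 `*` `[a, b])) R,
        is_avoid_law ((curve (L w))^~ a) ((curve (L w))^~ b) (fun=> +oo%E)
          (EFin \o curve (L w) (k - 1).+2) Q
      & ((Y w)%:E = \int[Q]_q (obs_on (k - 1).+1 s lev e (curve q))%:E)%E}.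
Proof.
move=> a b k0 Nk e0 abL.
have kE : (k - 1).+1 = k by rewrite subn1 prednK.
have ab : a < b by rewrite /a /b ltrD2l gtrN// half_width_gt0.
have KS : int_itv 1 k `<=` index_set N.
  move=> i /andP[i1 ik]; move: Nk; rewrite /index_set/= i1.
  by case: N => //= n; exact/leq_trans/leqW.
have kN : is_true (if N is Some n then (k <= n - 1)%N else true).
  move: Nk; rewrite /index_set/=; case: N => //= n kn.
  by rewrite leq_subRL ?add1n// (leq_trans _ kn).
have [_ /(_ 1%N k a b k0 ab KS abL kN)] := gibbs.
pose F (h : curve_space (int_itv 1 k `*` `[a, b])) := obs_on k s lev e (curve h).
have mF : measurable_fun setT F by exact: measurable_observable.
have bF : exists M, forall q, `|F q| <= M.
  exists (density_cap e) => q.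
  have /andP[F0 F1] :=
    @observable_bound R k a b lev e (density_cap e) (curve q) (expR_ge0 _).
  by rewrite ger0_norm.
move=> /(_ F mF bF)[Y [Y1 Y2 Y3] aeY]; exists Y.
  split.
    move=> _ B mB; rewrite setTI; apply: (@ext_sigma_measurable k a b).
    exact: Y1.
  move=> E HE; rewrite Y3//; apply: eq_integral => w _; congr EFin.
  apply: eq_observable => // i r ik rab.
  by rewrite curve_restrict.
apply: filterS aeY => w [Q QL YQ]; exists Q.
  have fE : (fun r : R => if 1.-1 \in index_set N then (curve (L w) 1.-1 r)%:E
      else +oo%E) = (fun=> +oo%E).
    by apply/funext => r; rewrite memNset// => -[].
  have gE : EFin \o curve (L w) (k - 1).+2 = (fun r => (curve (L w) k.+1 r)%:E).
    by rewrite kE.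
  by rewrite fE -gE in QL.
rewrite YQ; apply: eq_integral => q _; congr EFin.
rewrite /F /obs_on.
rewrite (@eq_observable R k a b lev e (density_cap e) (curve (reindex_curves q))
  (curve q) ab k0).
  by move: (curve q) => phi; rewrite kE.
by move=> i r ik rab; exact: curve_reindex.
Qed.

(** Almost surely the avoiding laws are defined for all the intervals of the
    sequence, and the deterministic limit applies to the realization. *)
Lemma version_limit (k : nat) (s lev : R) (e : nat -> R) (Y : nat -> T -> R) :
  (0 < k)%N -> index_set N k.+1 -> (forall n, 0 < e n) ->
  e n @[n --> \oo] --> 0 -> interior Lam s ->
  (forall n, `[s - half_width (e n), s + half_width (e n)] `<=` Lam) ->
  (forall n, {ae P, forall w,
      exists2 Q : probability (curve_space (int_itv 1 (k - 1).+1 `*`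
          `[s - half_width (e n), s + half_width (e n)])) R,
        is_avoid_law ((curve (L w))^~ (s - half_width (e n)))
          ((curve (L w))^~ (s + half_width (e n))) (fun=> +oo%E)
          (EFin \o curve (L w) (k - 1).+2) Q
      & ((Y n w)%:E = \int[Q]_q (obs_on (k - 1).+1 s lev (e n) (curve q))%:E)%E}) ->
  {ae P, forall w, (forall n, `|Y n w| <= 1) /\
    Y n w @[n --> \oo] --> ((curve (L w) k.+1 s < lev)%R%:R : R)}.
Proof.
move=> k0 Nk e0 e_cvg sLam eLam /ae_foralln aeQ.
have [nonint _] := gibbs.
apply: filterS2 aeQ nonint => w wQ wN.
(* The types of the avoiding laws mention (k - 1).+1, so k is rewritten into it
   and not the other way round. *)
have kE : (k - 1).+1 = k by rewrite subn1 prednK.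
set kk := (k - 1).+1 in kE wQ *; have kk0 : (0 < kk)%N by [].
rewrite -kE in Nk *; move: wQ; rewrite -/kk => wQ {kE}.
have KS i : int_itv 1 kk.+1 i -> index_set N i.
  move=> /andP[i1 ik]; move: Nk; rewrite /index_set/= i1.
  by case: N => //= n; exact: leq_trans.
have Ls : Lam s by exact: interior_subset.
have lc i eta : int_itv 1 kk.+1 i -> 0 < eta -> exists2 delta : R, 0 < delta &
    forall t : R, `|s - t| < delta -> `|curve (L w) i t - curve (L w) i s| < eta.
  move=> ik eta0.
  have nb : nbhs (curve (L w) i s) (ball (curve (L w) i s) eta) by exact: nbhsx_ballx.
  have [d1 d10 P1] := curve_near (KS i ik) Ls nb.
  have /nbhs_ballP[d2 d20 P2] := sLam.
  exists (Num.min d1 d2); first by rewrite lt_min d10.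
  move=> t; rewrite lt_min => /andP[t1 t2].
  by have := P1 t (P2 t t2) t1; rewrite /ball/= distrC.
have lo i : int_itv 1 kk i -> curve (L w) i.+1 s < curve (L w) i s.
  move=> /andP[i1 ik]; apply: wN => //; apply: KS; rewrite /int_itv/= ?i1//.
  exact: leqW.
have cg n : {within `[s - half_width (e n), s + half_width (e n)],
    continuous (curve (L w) kk.+1)}.
  apply: continuous_subspaceW (@curve_continuous _ _ _ (L w) kk.+1 Nk).
  exact: eLam.
split.
  move=> n; have [Q QL YQ] := wQ n.
  have ab : s - half_width (e n) < s + half_width (e n).
    by rewrite ltrD2l gtrN// half_width_gt0.
  have [v [vE /andP[v0 v1] _]] := avoid_value kk0 ab lev (density_cap (e n)) (e0 n) (cg n) QL.
  have : (Y n w)%:E = v%:E by rewrite YQ -vE.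
  by case=> ->; rewrite ger0_norm.
apply/cvgrPdist_le => eps eps0.
have [eta eta0 etaP] := observable_limit lev kk0 lc lo eps0.
have : \forall n \near \oo, e n < eta.
  by move/cvgr_lt : e_cvg; apply.
apply: filterS => n en.
have [Q QL YQ] := wQ n.
have [v vE vP] := etaP (e n) (e0 n) (ltW en) Q (cg n) QL.
have : (Y n w)%:E = v%:E by rewrite YQ -vE.
by case=> ->; rewrite distrC.
Qed.

(** The key formula: one more inequality on curve k + 1 is obtained as a limit of
    integrals of functions of the top k curves, over events that only have to be
    external. Conditional expectations are bounded by 1, so dominated convergence
    applies to them, whereas it would not apply to the observables. *)
Lemma gibbs_limit (k : nat) (s lev : R) (e : nat -> R) l :
  (0 < k)%N -> index_set N k.+1 -> (forall n, 0 < e n) ->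
  e n @[n --> \oo] --> 0 -> interior Lam s ->
  (forall n, `[s - half_width (e n), s + half_width (e n)] `<=` Lam) ->
  (forall n x, x \in l -> [/\ index_set N x.1.1, Lam x.1.2 &
     int_itv 1 k x.1.1 ->
     ~ (x.1.2 \in `]s - half_width (e n), s + half_width (e n)[)]) ->
  (\int[P]_(w in below l) (obs_on k s lev (e n) (curve (L w)))%:E)%E
    @[n --> \oo] --> P (below ((k.+1, s, lev) :: l)).
Proof.
move=> k0 Nk e0 e_cvg sLam eLam lP.
have /choice[Y YP] : forall n, exists Y : T -> R,
    (measurable_fun setT Y /\ (forall E,
      ext_sigma L 1 k (s - half_width (e n)) (s + half_width (e n)) E ->
      (\int[P]_(w in E) (Y w)%:E =
       \int[P]_(w in E) (obs_on k s lev (e n) (curve (L w)))%:E)%E)) /\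
    {ae P, forall w,
      exists2 Q : probability (curve_space (int_itv 1 (k - 1).+1 `*`
          `[s - half_width (e n), s + half_width (e n)])) R,
        is_avoid_law ((curve (L w))^~ (s - half_width (e n)))
          ((curve (L w))^~ (s + half_width (e n))) (fun=> +oo%E)
          (EFin \o curve (L w) (k - 1).+2) Q
      & ((Y w)%:E = \int[Q]_q (obs_on (k - 1).+1 s lev (e n) (curve q))%:E)%E}.
  move=> n; have [Y ? ?] := gibbs_version lev k0 Nk (e0 n) (eLam n).
  by exists Y.
have mb := measurable_below l.
have aeY := version_limit k0 Nk e0 e_cvg sLam eLam (fun n => (YP n).2).
pose S := [set w | curve (L w) k.+1 s < lev].
have mS : measurable S by apply: measurable_set_lt => //; exact: measurable_curve_RV.
have mY n : measurable_fun (below l) (EFin \o Y n).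
  by apply/measurable_EFinP/measurable_funTS; exact: (YP n).1.1.
have mI : measurable_fun (below l) (fun w => (\1_S w)%:E : \bar R).
  by apply/measurable_EFinP/measurable_funTS/measurable_indic.
have i1 : P.-integrable (below l) (cst (1%E : \bar R)).
  apply/integrableP; split; first exact: measurable_cst.
  rewrite /= normr1 integral_cst// mul1e.
  by rewrite (le_lt_trans (probability_le1 P mb)) ?ltry.
have YS : {ae P, forall w, below l w ->
    (EFin \o Y n) w @[n --> \oo] --> (\1_S w)%:E}.
  apply: filterS aeY => w [_ Yw] _.
  rewrite indicE (_ : (w \in S) = (curve (L w) k.+1 s < lev)).
    by apply: cvg_EFin => //; exact: nearW.
  by apply/idP/idP; rewrite inE.
have Y1 : {ae P, forall w n, below l w -> (`|(EFin \o Y n) w| <= cst 1 w)%E}.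
  by apply: filterS aeY => w [Yw _] n _; rewrite /= lee_fin.
have [_ _ ] := @dominated_convergence _ _ _ P (below l) mb (fun n => EFin \o Y n)
  (fun w => (\1_S w)%:E) (cst 1%E) mY mI YS i1 Y1.
rewrite integral_indic//.
have -> : S `&` below l = below ((k.+1, s, lev) :: l).
  apply/seteqP; split=> [w [wS wl] x|w wl].
    by rewrite inE => /orP[/eqP ->|/wl].
  split=> [|x xl]; first by apply: (wl (k.+1, s, lev)); rewrite inE eqxx.
  by apply: wl; rewrite inE xl orbT.
apply: cvg_trans; apply: near_eq_cvg; apply: nearW => n /=.
rewrite (YP n).1.2//; apply: ext_sigma_below => x /(lP n)[? ? H]; split => //.
Qed.

End one_ensemble.

(** * Induction on the number of curves *)

Section dense_subsets.
Context {R : realType} (Lam : set R).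
Hypotheses (Lam_itv : is_interval Lam) (Lam_int : interior Lam !=set0).

(** If Lam is an interval with interior, then even its endpoints are limits of
    interior points. *)
Lemma interval_near t p q : Lam t -> p < t -> t < q ->
  exists u v : R, u < v /\ forall x, u < x < v -> Lam x /\ p < x < q.
Proof.
move=> Lt pt tq; have [z zLam] := Lam_int.
have /nbhs_ballP[r /= r0 rLam] := zLam.
have [tz|zt] := ltP t z.
  exists t, (Num.min q z); split; first by rewrite lt_min tq.
  move=> x /andP[tx]; rewrite lt_min => /andP[xq xz]; split.
    apply: (Lam_itv Lt (interior_subset zLam)); by rewrite !ltW.
  by rewrite (lt_trans pt tx).
have r20 : 0 < r / 2 by rewrite divr_gt0.
have zr : Lam (z - r / 2).
  by apply: rLam; rewrite /ball/= opprB addrC subrK gtr0_norm// ltr_pdivrMr// ltr_pMr// ltr1n.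
have zrt : z - r / 2 < t by rewrite (lt_le_trans _ zt)// ltrBlDr ltrDl.
exists (Num.max p (z - r / 2)), t; split; first by rewrite gt_max pt.
move=> x /andP[]; rewrite gt_max => /andP[px zx] xt; split.
  by apply: (Lam_itv zr Lt); rewrite !ltW.
by rewrite px (lt_trans xt tq).
Qed.

Lemma dense_in_interior : dense_in (interior Lam) Lam.
Proof.
move=> t p q Lt pt tq; have [u [v [uv H]]] := interval_near Lt pt tq.
have m := midf_lt uv.
exists ((u + v) / 2); last by apply: (H _ _).2; rewrite !m.
apply: (@filterS _ _ _ `]u, v[%classic).
  by move=> x; rewrite /= in_itv/= => /H[].
by apply: near_in_itvoo; rewrite in_itv/= !m.
Qed.

Lemma dense_in_remove s : dense_in (Lam `\ s) Lam.
Proof.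
move=> t p q Lt pt tq; have [u [v [uv H]]] := interval_near Lt pt tq.
have m := midf_lt uv.
have [sm|sm] := eqVneq s ((u + v) / 2); last first.
  have [L1 L2] : Lam ((u + v) / 2) /\ p < (u + v) / 2 < q by apply: H; rewrite !m.
  by exists ((u + v) / 2) => //; split => //= E; rewrite E eqxx in sm.
have us : u < s by rewrite sm m.
have m' := midf_lt us.
have [L1 L2] : Lam ((u + s) / 2) /\ p < (u + s) / 2 < q.
  by apply: H; rewrite m'/= (lt_trans (_ : _ < s)) ?m'// sm m.
exists ((u + s) / 2) => //; split => //= E.
by have := (m').2; rewrite E ltxx.
Qed.

Lemma dense_in_self : dense_in Lam Lam.
Proof.
move=> t p q Lt pt tq; have [x xL pxq] := dense_in_interior Lt pt tq.
by exists x => //; exact: interior_subset.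
Qed.

End dense_subsets.

Section two_ensembles.
Context {R : realType} (N : option nat) (Lam : set R).
Hypotheses (Lam_itv : is_interval Lam) (Lam_int : interior Lam !=set0).

Definition top_curves (k : nat) (h : curve_space (index_set N `*` Lam)) :
  curve_space (int_itv 1 k `*` Lam) := curves_of _ _ (curve h).

Lemma index_set_le k i : index_set N k -> int_itv 1 k i -> index_set N i.
Proof.
move=> Nk /andP[i1 ik]; move: Nk; rewrite /index_set/= i1 => /andP[_].
by case: N => //= n; exact: leq_trans.
Qed.

Lemma top_curvesE k h i t : index_set N k -> int_itv 1 k i -> Lam t ->
  curve (top_curves k h) i t = curve h i t.
Proof.
move=> Nk ik Lt; rewrite curves_ofE// => j jk.
exact/curve_continuous/(index_set_le Nk).
Qed.

Lemma measurable_top_curves k : index_set N k -> measurable_fun setT (top_curves k).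
Proof.
move=> Nk; apply: (@measurable_curve_valued _ _ _ _ true (@subset_refl _ Lam)
  (dense_in_self Lam_itv Lam_int)) => i t ik Lt.
rewrite (_ : (fun _ => _) = (fun h => curve h i t)); first exact: measurable_curve.
by apply/funext => h; rewrite top_curvesE.
Qed.

Context {d1 d2 : measure_display} {T1 : measurableType d1} {T2 : measurableType d2}.
Context {P1 : probability T1 R} {P2 : probability T2 R}.
Variables (L1 : {RV P1 >-> curve_space (index_set N `*` Lam)})
          (L2 : {RV P2 >-> curve_space (index_set N `*` Lam)}).

Definition same_top (k : nat) : Prop :=
  forall E : set (curve_space (int_itv 1 k `*` Lam)), measurable E ->
    P1 [set w | E (top_curves k (L1 w))] = P2 [set w | E (top_curves k (L2 w))].

(** The induction on the number of conditions on curve k + 1 needs the law of the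
    top k curves on the event that these conditions hold. *)
Definition same_top_below (k : nat) (lo : seq (nat * R * R)) : Prop :=
  forall E : set (curve_space (int_itv 1 k `*` Lam)), measurable E ->
    P1 (below L1 lo `&` [set w | E (top_curves k (L1 w))]) =
    P2 (below L2 lo `&` [set w | E (top_curves k (L2 w))]).

Lemma exists_radius k s (l : seq (nat * R * R)) : interior Lam s ->
  (forall e, e \in l -> int_itv 1 k e.1.1 -> e.1.2 <> s) ->
  exists2 e0 : R, 0 < e0 & forall e, 0 < e -> e <= e0 ->
    `[s - half_width e, s + half_width e] `<=` Lam /\
    forall x, x \in l -> int_itv 1 k x.1.1 ->
      ~ (x.1.2 \in `]s - half_width e, s + half_width e[).
Proof.
move=> /nbhs_ballP[r /= r0 rLam] ls.
have hw (e : R) : 0 < e -> e <= 1 -> half_width e < e.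
  move=> e0 e1; rewrite /half_width ltr_pdivrMr// exprS.
  have e3 : e * e ^+ 3 <= e by rewrite ler_piMr ?exprn_ile1// ltW.
  by rewrite (le_lt_trans e3)// ltr_pMr// ltr1n.
elim: l ls => [_|x l IHl ls].
  exists (Num.min 1 r); first by rewrite lt_min ltr01.
  move=> e e0; rewrite le_min => /andP[e1 er]; split=> // t.
  rewrite /= in_itv/= => /andP[st ts]; apply: rLam; rewrite /ball/= ltr_distlC.
  have := hw e e0 e1 => he.
  by apply/andP; split; [apply: lt_le_trans st|apply: le_lt_trans ts _]; lra.
have [|e0 e00 IH] := IHl; first by move=> y yl; apply: ls; rewrite inE yl orbT.
have [ik|Nik] := pselect (int_itv 1 k x.1.1); last first.
  exists e0 => // e ep ee; have [H1 H2] := IH e ep ee; split=> // y.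
  by rewrite inE => /orP[/eqP -> //|yl]; exact: H2.
have xs : x.1.2 != s by apply/eqP; apply: ls => //; exact: mem_head.
exists (Num.min e0 (Num.min 1 `|x.1.2 - s|)).
  by rewrite !lt_min e00 ltr01 normr_gt0 subr_eq0.
move=> e ep; rewrite !le_min => /and3P[ee e1 ex].
have [H1 H2] := IH e ep ee; split=> // y.
rewrite inE => /orP[/eqP -> _|yl]; last exact: H2.
have := hw e ep e1 => he.
rewrite in_itv/= -ltr_distl => H; move: (lt_trans H he).
by rewrite ltNge ex.
Qed.

(** Both sides are integrals of f against the common image measure. *)
Lemma transfer_integral k lo (f : curve_space (int_itv 1 k `*` Lam) -> R) A :
  index_set N k -> same_top_below k lo -> measurable A ->
  measurable_fun setT f -> (forall h, 0 <= f h) ->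
  (\int[P1]_(w in below L1 lo `&` [set w | A (top_curves k (L1 w))])
     (f (top_curves k (L1 w)))%:E =
   \int[P2]_(w in below L2 lo `&` [set w | A (top_curves k (L2 w))])
     (f (top_curves k (L2 w)))%:E)%E.
Proof.
move=> Nk same mA mf f0.
have mb1 := measurable_below L1 lo; have mb2 := measurable_below L2 lo.
have mt1 : measurable_fun setT (top_curves k \o L1).
  exact: (measurableT_comp (measurable_top_curves Nk) (measurable_funPT L1)).
have mt2 : measurable_fun setT (top_curves k \o L2).
  exact: (measurableT_comp (measurable_top_curves Nk) (measurable_funPT L2)).
pose nu : {measure set _ -> \bar R} := pushforward (mrestr P1 mb1) (top_curves k \o L1).
have nu1 E : measurable E ->
    (\int[P1]_(w in below L1 lo `&` (top_curves k \o L1) @^-1` E) 1%:E = nu mt1 E)%E.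
  move=> mE; rewrite integral_cst ?mul1e.
    by rewrite /nu /= /pushforward /mrestr setIC.
  by apply: measurableI => //; rewrite -[X in measurable X]setTI; exact: mt1.
have nu2 E : measurable E ->
    (\int[P2]_(w in below L2 lo `&` (top_curves k \o L2) @^-1` E) 1%:E = nu mt1 E)%E.
  move=> mE; rewrite integral_cst ?mul1e.
    rewrite /nu /= /pushforward /mrestr [in RHS]setIC; exact/esym/same.
  by apply: measurableI => //; rewrite -[X in measurable X]setTI; exact: mt2.
have H1 := @ge0_integral_density _ _ _ _ R P1 (nu mt1) _ _ (cst 1) mb1 mt1
  (measurable_cst _) (fun=> ler01) nu1 f A mA mf f0.
have H2 := @ge0_integral_density _ _ _ _ R P2 (nu mt1) _ _ (cst 1) mb2 mt2
  (measurable_cst _) (fun=> ler01) nu2 f A mA mf f0.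
transitivity (\int[nu mt1]_(x in A) (f x)%:E)%E.
  by rewrite -H1; apply: eq_integral => w _; rewrite mulr1.
by rewrite -H2; apply: eq_integral => w _; rewrite mulr1.
Qed.

Lemma measurable_obs_on k s lev (e : R) : (0 < k)%N -> 0 < e ->
  `[s - half_width e, s + half_width e] `<=` Lam ->
  measurable_fun setT
    (fun h : curve_space (int_itv 1 k `*` Lam) => obs_on k s lev e (curve h)).
Proof.
move=> k0 e0; rewrite /obs_on.
set a := s - half_width e; set b := s + half_width e => abL.
have ab : a < b by rewrite /a /b ltrD2l gtrN// half_width_gt0.
pose rho (h : curve_space (int_itv 1 k `*` Lam)) :
  curve_space (int_itv 1 k `*` `[a, b]) := curves_of _ _ (curve h).
have rhoE h i t : int_itv 1 k i -> t \in `[a, b] -> curve (rho h) i t = curve h i t.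
  move=> ik tab; rewrite curves_ofE// => j jk.
  by apply: (continuous_subspaceW abL); exact: curve_continuous.
have mrho : measurable_fun setT rho.
  apply: (@measurable_curve_valued _ _ _ _ true (grid_times_sub ab)
    (grid_times_dense ab)) => i t ik /(grid_times_sub ab) tab.
  rewrite (_ : (fun _ => _) = (fun h : curve_space (int_itv 1 k `*` Lam) => curve h i t)).
    exact: measurable_curve.
  by apply/funext => h; rewrite rhoE.
rewrite (_ : (fun _ => _) = (fun h : curve_space (int_itv 1 k `*` `[a, b]) =>
    observable k a b lev e (density_cap e) (curve h)) \o rho).
  exact: (measurableT_comp (measurable_observable ab lev e (density_cap e)) mrho).
by apply/funext => h; apply: eq_observable => // i r ik rab; rewrite /= rhoE.
Qed.

Hypotheses (gibbs1 : partial_brownian_gibbs L1) (gibbs2 : partial_brownian_gibbs L2).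

Lemma below_cat d (T : measurableType d) (P : probability T R)
    (L : {RV P >-> curve_space (index_set N `*` Lam)}) k lo l :
  index_set N k ->
  (forall e, e \in l -> int_itv 1 k e.1.1 /\ Lam e.1.2) ->
  below L lo `&` [set w | cylinder false l (top_curves k (L w))] = below L (lo ++ l).
Proof.
move=> Nk lP; apply/seteqP; split=> w.
  move=> [wlo wl] e; rewrite mem_cat => /orP[/wlo//|el].
  by have [ek Le] := lP e el; have := wl e el; rewrite top_curvesE.
move=> wl; split=> [e elo|e el]; first by apply: wl; rewrite mem_cat elo.
have [ek Le] := lP e el.
by rewrite /= top_curvesE//; apply: wl; rewrite mem_cat el orbT.
Qed.

(** Adds one condition on curve k + 1 at an interior time s. For the top k curves
    it is enough to consider cylinders at times other than s, which are dense;
    on a short enough interval around s these cylinders are external, and so are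
    the conditions on curve k + 1 already present. The limit formula expresses
    both sides by integrals that agree by hypothesis. *)
Lemma same_top_below_cons k s lev lo : (0 < k)%N -> index_set N k.+1 ->
  interior Lam s ->
  (forall e, e \in lo -> e.1.1 = k.+1 /\ Lam e.1.2) ->
  same_top_below k lo -> same_top_below k ((k.+1, s, lev) :: lo).
Proof.
move=> k0 Nk1 sLam loP same.
have Nk : index_set N k by apply: (index_set_le Nk1); rewrite /int_itv/= k0 leqnSn.
have cyl_case (l : seq (nat * R * R)) :
    (forall e, e \in l -> int_itv 1 k e.1.1 /\ (Lam `\ s) e.1.2) ->
    P1 (below L1 ((k.+1, s, lev) :: lo ++ l)) =
    P2 (below L2 ((k.+1, s, lev) :: lo ++ l)).
  move=> lP.
  have [|e0 e00 eP] := @exists_radius k s (lo ++ l) sLam.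
    move=> e; rewrite mem_cat => /orP[elo|/lP[_ []]//].
    by have [-> _] := loP e elo; rewrite /int_itv/= ltnn.
  pose e n : R := e0 / n.+1%:R.
  have ep n : 0 < e n by rewrite divr_gt0.
  have ee n : e n <= e0 by rewrite ler_pdivrMr// ler_pMr// ler1n.
  have e_cvg : e n @[n --> \oo] --> 0.
    rewrite -(mulr0 e0); apply: cvgMr; exact: cvg_harmonic.
  have eLam n := (eP (e n) (ep n) (ee n)).1.
  have lP' n x : x \in lo ++ l -> [/\ index_set N x.1.1, Lam x.1.2 &
      int_itv 1 k x.1.1 ->
      ~ (x.1.2 \in `]s - half_width (e n), s + half_width (e n)[)].
    move=> xl; split; last exact: (eP (e n) (ep n) (ee n)).2.
      move: xl; rewrite mem_cat => /orP[/loP[-> _]//|/lP[xk _]].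
      exact: index_set_le xk.
    by move: xl; rewrite mem_cat => /orP[/loP[]//|/lP[_ []]].
  have lim1 := gibbs_limit gibbs1 (lev := lev) k0 Nk1 ep e_cvg sLam eLam lP'.
  have lim2 := gibbs_limit gibbs2 (lev := lev) k0 Nk1 ep e_cvg sLam eLam lP'.
  apply: (cvg_unique _ lim1) => //; apply: cvg_trans lim2.
  apply: near_eq_cvg; apply: nearW => n; apply: esym.
  have lP2 x : x \in l -> int_itv 1 k x.1.1 /\ Lam x.1.2 by move=> /lP[? []].
  have ab : s - half_width (e n) < s + half_width (e n).
    by rewrite ltrD2l gtrN// half_width_gt0.
  have obsE d (T : measurableType d) (P : probability T R)
      (L : {RV P >-> curve_space (index_set N `*` Lam)}) w :
      obs_on k s lev (e n) (curve (L w)) =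
      obs_on k s lev (e n) (curve (top_curves k (L w))).
    apply: eq_observable => // i r ik rab; rewrite top_curvesE//.
    exact: (eLam n r rab).
  transitivity (\int[P1]_(w in below L1 (lo ++ l))
      (obs_on k s lev (e n) (curve (top_curves k (L1 w))))%:E)%E.
    by apply: eq_integral => w _; rewrite obsE.
  transitivity (\int[P2]_(w in below L2 (lo ++ l))
      (obs_on k s lev (e n) (curve (top_curves k (L2 w))))%:E)%E; last first.
    by apply: eq_integral => w _; rewrite obsE.
  rewrite -(below_cat L1 lo Nk lP2) -(below_cat L2 lo Nk lP2).
  apply: (@transfer_integral k lo (fun h => obs_on k s lev (e n) (curve h))) => //.
  - exact: measurable_cylinder.
  - exact: measurable_obs_on.
  - by move=> h; rewrite /obs_on /observable mulr_ge0// expR_ge0.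
set lo' := (k.+1, s, lev) :: lo in cyl_case *.
have mb1 := measurable_below L1 lo'; have mb2 := measurable_below L2 lo'.
have mt1 : measurable_fun setT (top_curves k \o L1).
  exact: (measurableT_comp (measurable_top_curves Nk) (measurable_funPT L1)).
have mt2 : measurable_fun setT (top_curves k \o L2).
  exact: (measurableT_comp (measurable_top_curves Nk) (measurable_funPT L2)).
pose m1 : {measure set _ -> \bar R} := pushforward (mrestr P1 mb1) (top_curves k \o L1).
pose m2 : {measure set _ -> \bar R} := pushforward (mrestr P2 mb2) (top_curves k \o L2).
have m1E E : m1 mt1 E = P1 (below L1 lo' `&` [set w | E (top_curves k (L1 w))]).
  by rewrite /m1 /= /pushforward /mrestr setIC.
have m2E E : m2 mt2 E = P2 (below L2 lo' `&` [set w | E (top_curves k (L2 w))]).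
  by rewrite /m2 /= /pushforward /mrestr setIC.
move=> E mE; rewrite -m1E -m2E.
apply: (@curve_measure_unique R (int_itv 1 k) (Lam `\ s) Lam false
  (@subIsetl _ _ _) (dense_in_remove Lam_itv Lam_int s) (m1 mt1) (m2 mt2)) => //.
  rewrite m1E (_ : _ `&` _ = below L1 lo'); last by apply/seteqP; split=> // w [].
  by rewrite (le_lt_trans (probability_le1 P1 mb1)) ?ltry.
move=> l lP; rewrite m1E m2E.
have lP2 x : x \in l -> int_itv 1 k x.1.1 /\ Lam x.1.2 by move=> /lP[? []].
rewrite (below_cat L1 lo' Nk lP2) (below_cat L2 lo' Nk lP2).
exact: cyl_case.
Qed.

Lemma same_top_below_all k lo : (0 < k)%N -> index_set N k.+1 ->
  (forall e, e \in lo -> e.1.1 = k.+1 /\ interior Lam e.1.2) ->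
  same_top k -> same_top_below k lo.
Proof.
move=> k0 Nk loP same; elim: lo loP => [_ E mE|[[i s] lev] lo IH loP].
  have b0 d (T : measurableType d) (P : probability T R)
      (L : {RV P >-> curve_space (index_set N `*` Lam)}) : below L [::] = setT.
    by apply/seteqP; split.
  by rewrite !b0 !setTI; exact: same.
have [/= -> sLam] := loP (i, s, lev) (mem_head _ _).
have loP' e : e \in lo -> e.1.1 = k.+1 /\ interior Lam e.1.2.
  by move=> el; apply: loP; rewrite inE el orbT.
apply: same_top_below_cons => //; last exact: IH.
by move=> e /loP'[-> /interior_subset].
Qed.

(** Cylinders of the top k + 1 curves at interior times split into conditions on
    curve k + 1 and a cylinder of the top k curves. *)
Lemma same_top_succ k : (0 < k)%N -> index_set N k.+1 -> same_top k ->
  same_top k.+1.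
Proof.
move=> k0 Nk1 same.
have Nk : index_set N k by apply: (index_set_le Nk1); rewrite /int_itv/= k0 leqnSn.
have mt1 : measurable_fun setT (top_curves k.+1 \o L1).
  exact: (measurableT_comp (measurable_top_curves Nk1) (measurable_funPT L1)).
have mt2 : measurable_fun setT (top_curves k.+1 \o L2).
  exact: (measurableT_comp (measurable_top_curves Nk1) (measurable_funPT L2)).
pose m1 : {measure set _ -> \bar R} := pushforward P1 (top_curves k.+1 \o L1).
pose m2 : {measure set _ -> \bar R} := pushforward P2 (top_curves k.+1 \o L2).
move=> E mE; suff : m1 mt1 E = m2 mt2 E by [].
apply: (@curve_measure_unique R (int_itv 1 k.+1) (interior Lam) Lam false
  (@interior_subset _ _) (dense_in_interior Lam_itv Lam_int) (m1 mt1) (m2 mt2)) => //.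
  rewrite /m1 /= /pushforward preimage_setT.
  by rewrite (le_lt_trans (probability_le1 P1 _)) ?ltry.
move=> l lP; rewrite /m1 /m2 /= /pushforward.
pose lo := [seq e <- l | e.1.1 == k.+1].
pose l' := [seq e <- l | e.1.1 != k.+1].
have l'P e : e \in l' -> int_itv 1 k e.1.1 /\ Lam e.1.2.
  rewrite mem_filter => /andP[ek /lP[/andP[e1 e2] /interior_subset ?]]; split=> //.
  by rewrite /int_itv/= e1 -ltnS ltn_neqAle ek.
have splitE d (T : measurableType d) (P : probability T R)
    (L : {RV P >-> curve_space (index_set N `*` Lam)}) :
    (top_curves k.+1 \o L) @^-1` cylinder false l =
    below L lo `&` [set w | cylinder false l' (top_curves k (L w))].
  rewrite below_cat//; apply/seteqP; split=> w wl e.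
    rewrite mem_cat !mem_filter -andb_orl orbN/= => el.
    have [ek Le] := lP e el; have := wl e el.
    by rewrite /= top_curvesE//; exact: interior_subset.
  move=> el; have [ek /interior_subset Le] := lP e el.
  rewrite /= top_curvesE//; apply: wl.
  by rewrite mem_cat !mem_filter el !andbT orbN.
rewrite !splitE; apply: same_top_below_all => //; last exact: measurable_cylinder.
by move=> e; rewrite mem_filter => /andP[/eqP -> /lP[]].
Qed.

End two_ensembles.

(** * The top curve and the whole ensemble *)

Lemma seq_min (R : realDomainType) (s : seq R) : s != [::] ->
  exists2 x, x \in s & forall y, y \in s -> x <= y.
Proof.
elim: s => // a [|b s] IH _.
  by exists a; rewrite ?mem_head// => y; rewrite inE => /eqP ->.
have [x xs xP] := IH isT.
have [ax|xa] := leP a x.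
  exists a; first exact: mem_head.
  by move=> y; rewrite inE => /orP[/eqP ->//|/xP]; exact: le_trans.
exists x; first by rewrite inE xs orbT.
by move=> y; rewrite inE => /orP[/eqP ->|/xP//]; exact: ltW.
Qed.

Section base_case.
Context {R : realType} (N : option nat) (Lam : set R).
Hypotheses (Lam_itv : is_interval Lam) (Lam_int : interior Lam !=set0).
Hypothesis N1 : index_set N 1.
Context {d1 d2 : measure_display} {T1 : measurableType d1} {T2 : measurableType d2}.
Context {P1 : probability T1 R} {P2 : probability T2 R}.
Variables (L1 : {RV P1 >-> curve_space (index_set N `*` Lam)})
          (L2 : {RV P2 >-> curve_space (index_set N `*` Lam)}).
Hypothesis fdd_top : forall (k : nat) (t x : 'I_k -> R),
  (forall i, Lam (t i)) -> (forall i j : 'I_k, (i < j)%N -> t i < t j) ->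
  P1 [set w | forall i, curve (L1 w) 1 (t i) <= x i] =
  P2 [set w | forall i, curve (L2 w) 1 (t i) <= x i].

(** A cylinder may prescribe several bounds at the same time and in any order;
    sorting the times and keeping the smallest bound at each of them puts it into
    the form for which the two laws are assumed to agree. *)
Lemma same_top_one : same_top L1 L2 1.
Proof.
have mt1 : measurable_fun setT (top_curves 1 \o L1).
  exact: (measurableT_comp (measurable_top_curves Lam_itv Lam_int N1) (measurable_funPT L1)).
have mt2 : measurable_fun setT (top_curves 1 \o L2).
  exact: (measurableT_comp (measurable_top_curves Lam_itv Lam_int N1) (measurable_funPT L2)).
pose m1 : {measure set _ -> \bar R} := pushforward P1 (top_curves 1 \o L1).
pose m2 : {measure set _ -> \bar R} := pushforward P2 (top_curves 1 \o L2).
move=> E mE; suff : m1 mt1 E = m2 mt2 E by [].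
apply: (@curve_measure_unique R (int_itv 1 1) Lam Lam true
  (@subset_refl _ Lam) (dense_in_self Lam_itv Lam_int) (m1 mt1) (m2 mt2)) => //.
  rewrite /m1 /= /pushforward preimage_setT.
  by rewrite (le_lt_trans (probability_le1 P1 _)) ?ltry.
move=> l lP; rewrite /m1 /m2 /= /pushforward.
pose ts := sort <=%R (undup [seq e.1.2 | e <- l]).
have ts_lt : sorted <%R ts.
  by rewrite lt_sorted_uniq_le sort_uniq undup_uniq sort_le_sorted.
have mem_ts e : e \in l -> e.1.2 \in ts.
  by move=> el; rewrite mem_sort mem_undup; apply/mapP; exists e.
pose values t := [seq e.2 | e <- l & e.1.2 == t].
pose m t := get [set x | x \in values t /\ forall y, y \in values t -> x <= y].
have mP t : t \in ts -> m t \in values t /\ forall y, y \in values t -> m t <= y.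
  rewrite mem_sort mem_undup => /mapP[e el et].
  apply: (@getPex _ [set x | x \in values t /\ forall y, y \in values t -> x <= y]).
  have [|x xv xP] := @seq_min R (values t); last by exists x.
  suff : e.2 \in values t by case: (values t).
  by apply/mapP; exists e => //; rewrite mem_filter et eqxx.
pose t (i : 'I_(size ts)) := nth 0 ts i.
have tts i : t i \in ts by rewrite mem_nth.
have eventE d (T : measurableType d) (P : probability T R)
    (L : {RV P >-> curve_space (index_set N `*` Lam)}) :
    (top_curves 1 \o L) @^-1` cylinder true l =
    [set w | forall i, curve (L w) 1 (t i) <= m (t i)].
  have e1 e : e \in l -> e.1.1 = 1%N.
    by move=> /lP[/andP[e1 e2] _]; apply/eqP; rewrite eqn_leq e2.
  apply/seteqP; split=> w wl.
    move=> i; have [/mapP[e + ->] _] := mP (t i) (tts i).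
    rewrite mem_filter => /andP[/eqP <- el]; have [ek Le] := lP e el.
    by have := wl e el; rewrite /= top_curvesE// e1.
  move=> e el; have [ek Le] := lP e el; rewrite /= top_curvesE// e1//.
  have es := mem_ts e el; have := wl (Ordinal (_ : (index e.1.2 ts < size ts)%N)).
  rewrite /t /= nth_index// => H; rewrite (le_trans (H _)) ?index_mem//.
  have [_] := mP _ es; apply.
  by apply/mapP; exists e => //; rewrite mem_filter eqxx.
rewrite !eventE; apply: fdd_top.
  move=> i; have := tts i; rewrite mem_sort mem_undup => /mapP[e el ->].
  by have [] := lP e el.
move=> i j ij; rewrite /t (lt_sorted_ltn_nth 0 ts_lt) ?inE//.
Qed.

End base_case.

Theorem theorem2p10 (R : realType) (N : option nat) (Lam : set R)
  (N_pos : if N is Some n then (0 < n)%N else true)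
  (Lam_itv : is_interval Lam) (Lam_int : interior Lam !=set0)
  (d1 d2 : measure_display) (T1 : measurableType d1) (T2 : measurableType d2)
  (P1 : probability T1 R) (P2 : probability T2 R)
  (L1 : {RV P1 >-> curve_space (index_set N `*` Lam)})
  (L2 : {RV P2 >-> curve_space (index_set N `*` Lam)})
  (gibbs1 : partial_brownian_gibbs L1) (gibbs2 : partial_brownian_gibbs L2)
  (fdd_top : forall (k : nat) (t x : 'I_k -> R),
     (forall i, Lam (t i)) -> (forall i j : 'I_k, (i < j)%N -> t i < t j) ->
     P1 [set w | forall i, curve (L1 w) 1 (t i) <= x i] =
     P2 [set w | forall i, curve (L2 w) 1 (t i) <= x i]) :
  forall E : set (curve_space (index_set N `*` Lam)), measurable E ->
    distribution P1 L1 E = distribution P2 L2 E.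
Proof.
have N1 : index_set N 1 by rewrite /index_set/=; move: N_pos; case: (N).
have same k : (0 < k)%N -> index_set N k -> same_top L1 L2 k.
  elim: k => // -[_ _ _|k IH _ Nk]; first exact: same_top_one.
  apply: same_top_succ => //; apply: IH => //.
  by apply: (index_set_le Nk); rewrite /int_itv/= leqnSn.
apply: (@curve_measure_unique R (index_set N) Lam Lam false
  (@subset_refl _ Lam) (dense_in_self Lam_itv Lam_int)
  (distribution P1 L1) (distribution P2 L2)) => //.
  change (P1 (L1 @^-1` setT) < +oo)%E.
  by rewrite preimage_setT probability_setT ltry.
move=> l lP.
have [k [k0 Nk lk]] : exists k, [/\ (0 < k)%N, index_set N k &
    forall e, e \in l -> int_itv 1 k e.1.1].
  elim: l lP => [_|e l IH lP]; first by exists 1%N.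
  have [|k [k0 Nk lk]] := IH; first by move=> e' el; apply: lP; rewrite inE el orbT.
  have [Ne _] := lP e (mem_head _ _).
  exists (maxn k e.1.1); split.
  - by rewrite leq_max k0.
  - by case: (leqP k e.1.1).
  move=> e'; rewrite inE => /orP[/eqP ->|/lk/andP[? ek]].
    by move: Ne => /andP[e1 _]; rewrite /int_itv/= e1 leq_maxr.
  by rewrite /int_itv/= leq_max ek andbT.
have eventE d (T : measurableType d) (P : probability T R)
    (L : {RV P >-> curve_space (index_set N `*` Lam)}) :
    L @^-1` cylinder false l = [set w | cylinder false l (top_curves k (L w))].
  by apply/seteqP; split=> w wl e el; have [_ Le] := lP e el;
    have ek := lk e el; have := wl e el; rewrite /= top_curvesE.
change (P1 (L1 @^-1` cylinder false l) = P2 (L2 @^-1` cylinder false l)).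
rewrite !eventE; apply: (same k k0 Nk).
exact: measurable_cylinder.
Qed.
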